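(* For every positive integer $t$ there exist an irrational number $\lambda_t\in(0,1/6)$, $3$-graphs $\mathcal{G}_1,\ldots,\mathcal{G}_t$ with $v(\mathcal{G}_i)=3t+5$ for every $i\in\{1,\ldots,t\}$, and a finite family $\mathcal{M}_t$ of $3$-graphs with the following properties. (a) $\pi(\mathcal{M}_t)=6\lambda_t$. (b) There exist constants $\epsilon=\epsilon(t)>0$ and $N_0=N_0(t)$ such that for every integer $n\ge N_0$, every $n$-vertex $\mathcal{M}_t$-free $3$-graph with minimum degree at least $(3\lambda_t-\epsilon)n^2$ is $\mathcal{G}_i$-colorable for some $i\in\{1,\ldots,t\}$. (c) $\xi(\mathcal{M}_t)=t$.
   Context: For an integer $r\ge 2$, an $r$-graph $\mathcal{H}$ is a collection of $r$-element subsets (edges) of a finite vertex set $V(\mathcal{H})$; $\mathcal{H}$ is identified with its edge set, $|\mathcal{H}|$ is the number of edges and $v(\mathcal{H})=|V(\mathcal{H})|$. The degree of a vertex is the number of edges containing it, and the minimum degree is the minimum over all vertices. Given a family $\mathcal{F}$ of $r$-graphs, $\mathcal{H}$ is $\mathcal{F}$-free if it contains no member of $\mathcal{F}$ as a (not necessarily induced) subgraph. $\mathrm{ex}(n,\mathcal{F})$ is the maximum number of edges of an $\mathcal{F}$-free $r$-graph on $n$ vertices, and the Turán density is $\pi(\mathcal{F})=\lim_{n\to\infty}\mathrm{ex}(n,\mathcal{F})/\binom{n}{r}$. An $r$-graph $\mathcal{H}$ is $\mathcal{G}$-colorable, for an $r$-graph $\mathcal{G}$, if there is a map $\phi\colon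 V(\mathcal{H})\to V(\mathcal{G})$ with $\phi(E)\in\mathcal{G}$ for all $E\in\mathcal{H}$. Stability number: for an integer $s\ge 1$, a family $\mathcal{F}$ of $r$-graphs is $s$-stable if for every $m\in\mathbb{N}$ there exist $r$-graphs $\mathcal{S}_1(m),\ldots,\mathcal{S}_s(m)$ on $m$ vertices such that the following holds: for every $\delta>0$ there exist $\epsilon>0$ and $N_0$ such that for all $n\ge N_0$, if $\mathcal{H}$ is an $\mathcal{F}$-free $r$-graph on $n$ vertices with $|\mathcal{H}|>(1-\epsilon)\,\mathrm{ex}(n,\mathcal{F})$, then $\mathcal{H}$ can be transformed into (an isomorphic copy of) some $\mathcal{S}_i(n)$ by adding and removing at most $\delta n^r$ edges. The stability number $\xi(\mathcal{F})$ is the minimum integer $s$ such that $\mathcal{F}$ is $s$-stable, and $\xi(\mathcal{F})=\infty$ if there is no such $s$. *)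

(* Defs.v *)
From HB Require Import structures.
From mathcomp Require Import all_boot all_order all_algebra.
From mathcomp Require Import all_classical all_reals all_analysis.

Set Implicit Arguments.
Unset Strict Implicit.
Unset Printing Implicit Defensive.

Import Order.TTheory GRing.Theory Num.Theory.
Import numFieldNormedType.Exports.

Local Open Scope ring_scope.

Definition is_uniform (r : nat) (V : finType) (A : {set {set V}}) : bool :=
  [forall E in A, #|E| == r].

Record hypergraph (r : nat) (V : finType) := Hypergraph {
  edges :> {set {set V}};
  edges_uniform : is_uniform r edges
}.

HB.instance Definition _ r V := [isSub for @edges r V].
HB.instance Definition _ r V := [Finite of hypergraph r V by <:].

Definition hdegree r (V : finType) (H : hypergraph r V) (v : V) : nat :=
  #|[set E in edges H | v \in E]|.

(* The neutral value #|edges H| bounds every degree, so it only matters when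
   there are no vertices. *)
Definition min_degree r (V : finType) (H : hypergraph r V) : nat :=
  \big[minn/#|edges H|]_(v : V) hdegree H v.

Definition contains_copy r (V W : finType) (H : hypergraph r V)
    (F : hypergraph r W) :
    Prop :=
  exists phi : W -> V,
    injective phi /\ forall E, E \in edges F -> phi @: E \in edges H.

Definition hcolorable r (V W : finType) (G : hypergraph r W)
    (H : hypergraph r V) :
    Prop :=
  exists phi : V -> W, forall E, E \in edges H -> phi @: E \in edges G.

(* Freeness depends on the members of a family only up to isomorphism, so the
   members are taken on the vertex sets 'I_k, with k arbitrary. *)
Definition hfamily (r : nat) := set {k : nat & hypergraph r 'I_k}.

Definition family_free r (FF : hfamily r) (V : finType)
    (H : hypergraph r V) : Prop :=
  forall F, FF F -> ~ contains_copy H (tagged F).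

(* The value is 0 if no r-graph on n vertices is FF-free. *)
Definition turan_number r (FF : hfamily r) (n : nat) : nat :=
  \max_(H : hypergraph r 'I_n | `[< family_free FF H >]) #|edges H|.

(* The equality pi(FF) = x, including the existence of the limit. *)
Definition has_turan_density (R : realType) r (FF : hfamily r) (x : R) : Prop :=
  ((fun n : nat => (turan_number FF n)%:R / 'C(n, r)%:R : R)
     @ \oo --> x)%classic.

(* The copy of G on the vertex set of H given by phi has edge set
   [set E | phi @: E \in edges G]. *)
Definition edit_close (R : realType) r (V W : finType)
    (H : hypergraph r V) (G : hypergraph r W) (x : R) : Prop :=
  exists phi : V -> W, bijective phi /\
    let G' := [set E : {set V} | phi @: E \in edges G] in
    #|(edges H :\: G') :|: (G' :\: edges H)|%:R <= x.

Definition s_stable (R : realType) r (FF : hfamily r) (s : nat) : Prop :=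
  exists S : 'I_s -> forall m : nat, hypergraph r 'I_m,
    forall delta : R, 0 < delta ->
    exists (eps : R) (N0 : nat), 0 < eps /\
    forall n : nat, (N0 <= n)%N ->
    forall (V : finType) (H : hypergraph r V), #|V| = n -> family_free FF H ->
      (1 - eps) * (turan_number FF n)%:R < #|edges H|%:R ->
      exists i : 'I_s, edit_close H (S i n) (delta * n%:R ^+ r).

(* None stands for infinity. *)
Definition stability_number (R : realType) r (FF : hfamily r) : option nat :=
  match pselect (exists s : nat, `[< (0 < s)%N /\ s_stable R FF s >]) with
  | left h => Some (ex_minn h)
  | right _ => None
  end.

(* Main.v *)
Require Import Defs.
From mathcomp Require Import all_boot all_order perm all_algebra.
From mathcomp Require Import all_classical all_reals all_analysis.
From mathcomp Require Import ring lra zify.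

Set Implicit Arguments.
Unset Strict Implicit.
Unset Printing Implicit Defensive.

Import Order.TTheory GRing.Theory Num.Theory.
Local Open Scope ring_scope.

(** A 3-graph is handled as a symmetric ternary relation, and its edges are counted
    as ordered triples; this replaces the density lambda by Lam = 6 lambda.

    The patterns.  G_i has two hubs y and z, m further vertices x_a, and a
    permutation s_i of these m vertices with two cycles.  Its edges are all triples
    y z x_a, all triples z x_a x_b, and those triples y x_a x_b for which x_a and
    x_b are not consecutive on a cycle.  For given weights of the hubs, the
    Lagrange polynomial depends on the other weights only through their sum S, the
    sum of their squares and the sum of the products of consecutive ones
    [cubic_form_hub].  Two applications of the Cauchy-Schwarz inequality show that
    it is maximised when the x_a have equal weights; so all patterns have the same
    optimum, it is unique, and S solves a quadratic equation [hub_bound,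
    hub_stability, hub_system].  The discriminant is essentially
    3 (m - 2)^2 + 1, which for m divisible by 4 is 5 modulo 8 and hence not a
    square; so the common maximum is irrational [hub_Lam_irrational].  The lengths
    of the cycles tell the t patterns apart [cycle_system].

    The family consists of all 3-graphs with at most L vertices that are not
    colorable by any pattern [obstructions].  Blowups of the patterns avoid it, and
    in a 3-graph that avoids it every set of L vertices is colorable.

    From local to global colorings.  Every pair of vertices of a pattern lies in an
    edge.  Therefore a coloring of a copy T of G_i uses G_i as well and is an
    automorphism on T [rigid_copy]; a vertex whose link contains the link of c in T
    must have the color of c.  If each vertex v is attached in this way to a copy
    of the pattern whose vertices are themselves attached to a fixed T, then the
    color of v is the same in all colorings of small sets that contain T and this
    witness, and these colors form a global coloring [coloring_from_witnesses].  A
    suitable T and the witnesses are found in random samples of bounded size: when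
    all degrees are almost Lam n^2, some sample has density almost Lam, and so has
    the link of v in it.  Being colorable, the sample is then almost a complete
    blowup with nearly optimal class sizes, and the link of v is almost the full
    link of its color, since no link can be much larger near the optimum
    [link_form_le]; a random transversal of the classes does the rest
    [core_exists, witness_exists].

    Density and stability number.  A part U with maximal value of
    e(U) - (Lam - e) |U|^3 has large minimum degree, so it is colorable.  This gives
    the upper bound on the density [turan_upper_bound], and it shows that an almost
    extremal 3-graph is close to an optimal blowup of one of the patterns
    [near_extremal_coloring, color_matching].  Optimal blowups of two patterns are
    not close to each other, since otherwise a transversal would embed one pattern
    in the other [blowups_far_apart]. *)

(** * Product measures on finite function spaces *)

Definition product_mean (R : comPzRingType) (I V : finType) (mu : I -> V -> R)
    (F : {ffun I -> V} -> R) : R :=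
  \sum_(f : {ffun I -> V}) (\prod_i mu i (f i)) * F f.

Section ProductMean.
Variables (R : realFieldType) (I V : finType) (mu : I -> V -> R).
Hypothesis mu_ge0 : forall i v, 0 <= mu i v.
Hypothesis mu_sum1 : forall i, \sum_v mu i v = 1.

Lemma eq_product_mean (F G : {ffun I -> V} -> R) :
  F =1 G -> product_mean mu F = product_mean mu G.
Proof. by move=> FG; apply: eq_bigr => f _; rewrite FG. Qed.

Lemma product_mean_prod (h : I -> V -> R) :
  product_mean mu (fun f => \prod_i h i (f i)) = \prod_i \sum_v mu i v * h i v.
Proof.
rewrite bigA_distr_bigA; apply: eq_bigr => f _.
by rewrite -big_split.
Qed.

Lemma product_mean_sum (J : finType) (P : pred J) (F : J -> {ffun I -> V} -> R) :
  product_mean mu (fun f => \sum_(j | P j) F j f)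
  = \sum_(j | P j) product_mean mu (F j).
Proof.
rewrite /product_mean exchange_big; apply: eq_bigr => f _.
by rewrite mulr_sumr.
Qed.

Lemma product_meanD (F G : {ffun I -> V} -> R) :
  product_mean mu (fun f => F f + G f)
  = product_mean mu F + product_mean mu G.
Proof. by rewrite -big_split; apply: eq_bigr => f _; rewrite mulrDr. Qed.

Lemma product_meanZ (a : R) (F : {ffun I -> V} -> R) :
  product_mean mu (fun f => a * F f) = a * product_mean mu F.
Proof. by rewrite mulr_sumr; apply: eq_bigr => f _; rewrite mulrCA. Qed.

Lemma product_mean_ge0 (F : {ffun I -> V} -> R) :
  (forall f, 0 <= F f) -> 0 <= product_mean mu F.
Proof. by move=> F0; apply: sumr_ge0 => f _; rewrite mulr_ge0 ?prodr_ge0. Qed.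

Lemma product_mean1 : product_mean mu (fun=> 1) = 1.
Proof.
have := product_mean_prod (fun _ _ => 1).
rewrite (_ : product_mean _ _ = product_mean mu (fun=> 1)); last first.
  by apply: eq_product_mean => f; rewrite big1.
by move->; rewrite big1// => i _; under eq_bigr do rewrite mulr1.
Qed.

Lemma product_mean_coord1 a (F : V -> R) :
  product_mean mu (fun f => F (f a)) = \sum_u mu a u * F u.
Proof.
transitivity (product_mean mu
    (fun f => \prod_i (if i == a then F else fun=> 1) (f i))).
  apply: eq_product_mean => f.
  rewrite (bigD1 a)//= eqxx big1 ?mulr1// => i /negPf ->.
  by [].
rewrite (product_mean_prod (fun i => if i == a then F else fun=> 1)).
rewrite (bigD1 a)//= eqxx [X in _ * X]big1 ?mulr1// => i /negPf ->.
by under eq_bigr do rewrite mulr1.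
Qed.

Let dirac (x y : V) : R := (x == y)%:R.

Let sum_dirac (F : V -> R) y : \sum_x F x * dirac x y = F y.
Proof.
rewrite (bigD1 y)//= /dirac eqxx mulr1 big1 ?addr0// => x /negPf ->.
by rewrite mulr0.
Qed.

Let sum_mu_dirac i x : \sum_v mu i v * dirac x v = mu i x.
Proof. by rewrite -[RHS]sum_dirac; apply: eq_bigr => v _; rewrite /dirac eq_sym. Qed.

Lemma product_mean_coord2 a b (F : V -> V -> R) : a != b ->
  product_mean mu (fun f => F (f a) (f b))
  = \sum_u \sum_v mu a u * mu b v * F u v.
Proof.
move=> ab; have ba : b != a by rewrite eq_sym.
pose h u v (i : I) : V -> R :=
  if i == a then dirac u else if i == b then dirac v else fun=> 1.
have hE u v (G : I -> (V -> R) -> R) : (forall i, G i (fun=> 1) = 1) ->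
    \prod_i G i (h u v i) = G a (dirac u) * G b (dirac v).
  move=> G1; rewrite (bigD1 a)//= (bigD1 b)//= /h eqxx (negPf ba) eqxx.
  rewrite [X in _ * (_ * X)]big1 ?mulr1// => i /andP[/negPf -> /negPf ->].
  exact: G1.
transitivity (product_mean mu
    (fun f => \sum_u \sum_v F u v * \prod_i h u v i (f i))).
  apply: eq_product_mean => f.
  rewrite -[LHS](sum_dirac (F^~ (f b))); apply: eq_bigr => u _.
  rewrite -(sum_dirac (F u)) mulr_suml; apply: eq_bigr => v _.
  by rewrite (hE u v (fun i g => g (f i)))// -mulrA (mulrC (dirac v _)).
rewrite product_mean_sum; apply: eq_bigr => u _.
rewrite product_mean_sum; apply: eq_bigr => v _.
rewrite product_meanZ product_mean_prod mulrC; congr (_ * _).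
rewrite (hE u v (fun i g => \sum_v mu i v * g v)) ?sum_mu_dirac// => i.
by under eq_bigr do rewrite mulr1.
Qed.

Lemma product_mean_coord3 a b c (F : V -> V -> V -> R) :
  a != b -> a != c -> b != c ->
  product_mean mu (fun f => F (f a) (f b) (f c))
  = \sum_u \sum_v \sum_w mu a u * mu b v * mu c w * F u v w.
Proof.
move=> ab ac bc.
have [ba ca cb] : [/\ b != a, c != a & c != b] by split; rewrite eq_sym.
pose h u v w (i : I) : V -> R :=
  if i == a then dirac u else if i == b then dirac v
  else if i == c then dirac w else fun=> 1.
have hE u v w (G : I -> (V -> R) -> R) : (forall i, G i (fun=> 1) = 1) ->
    \prod_i G i (h u v w i) = G a (dirac u) * G b (dirac v) * G c (dirac w).
  move=> G1; rewrite (bigD1 a)//= (bigD1 b)//= (bigD1 c) ?ca//= /h.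
  rewrite eqxx (negPf ba) eqxx (negPf ca) (negPf cb) eqxx.
  rewrite [X in _ * (_ * (_ * X))]big1 ?mulr1 ?mulrA// => i.
  by move=> /andP[/andP[/negPf -> /negPf ->] /negPf ->]; apply: G1.
transitivity (product_mean mu
    (fun f => \sum_u \sum_v \sum_w F u v w * \prod_i h u v w i (f i))).
  apply: eq_product_mean => f.
  rewrite -[LHS](sum_dirac (fun u => F u (f b) (f c))); apply: eq_bigr => u _.
  rewrite -(sum_dirac (fun v => F u v (f c))) mulr_suml; apply: eq_bigr => v _.
  rewrite -(sum_dirac (F u v)) !mulr_suml; apply: eq_bigr => w _.
  by rewrite (hE u v w (fun i g => g (f i)))//; ring.
rewrite product_mean_sum; apply: eq_bigr => u _.
rewrite product_mean_sum; apply: eq_bigr => v _.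
rewrite product_mean_sum; apply: eq_bigr => w _.
rewrite product_meanZ product_mean_prod mulrC; congr (_ * _).
rewrite (hE u v w (fun i g => \sum_v mu i v * g v)) ?sum_mu_dirac// => i.
by under eq_bigr do rewrite mulr1.
Qed.

Lemma product_mean_exists (F : {ffun I -> V} -> R) (A : R) :
  A <= product_mean mu F -> 
  exists f : {ffun I -> V}, (forall i, 0 < mu i (f i)) /\ A <= F f.
Proof.
move=> AF; apply: contrapT => noF.
have pF (f : {ffun I -> V}) : 0 < \prod_i mu i (f i) -> F f < A.
  move=> pf; rewrite ltNge; apply/negP => FA; apply: noF; exists f; split=> // i.
  rewrite lt_def mu_ge0 andbT; apply: contraTneq pf => mu0.
  by rewrite (bigD1 i)//= mu0 mul0r ltxx.
suff : product_mean mu F < A * product_mean mu (fun=> 1).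
  by rewrite product_mean1 mulr1 ltNge AF.
rewrite /product_mean mulr_sumr.
have [f0 pf0] : exists f0 : {ffun I -> V}, 0 < \prod_i mu i (f0 i).
  apply: contrapT => nof.
  suff : product_mean mu (fun=> 1) = 0.
    by move/eqP; rewrite product_mean1 oner_eq0.
  rewrite /product_mean big1// => f _; rewrite mulr1; apply/eqP.
  apply: contrapT => /negP f_neq0; apply: nof; exists f.
  by rewrite lt_def f_neq0 prodr_ge0.
rewrite (bigD1 f0)//= [ltRHS](bigD1 f0)//= mulr1 mulrC.
apply: ltr_leD; first by rewrite ltr_pM2r// pF.
apply: ler_sum => f _; rewrite mulr1 mulrC.
have [->|/eqP pf] := eqVneq (\prod_i mu i (f i)) 0; first by rewrite !mulr0.
have pf0' : 0 < \prod_i mu i (f i) by rewrite lt_def prodr_ge0// andbT; apply/eqP.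
by rewrite ler_pM2r// ltW// pF.
Qed.

End ProductMean.

(** * Ordered triples, color classes and cubic forms *)

(** The relational form of a 3-graph: a symmetric relation all of whose triples
    have distinct entries. *)
Definition is_triple_system (V : Type) (h : V -> V -> V -> bool) :=
  [/\ forall a b c, h a b c = h b a c, forall a b c, h a b c = h a c b
    & forall a b, h a a b = false].

Definition triple_count (R : pzSemiRingType) (V : finType)
    (h : V -> V -> V -> bool) : R :=
  \sum_a \sum_b \sum_c (h a b c)%:R.

Definition pair_count (R : pzSemiRingType) (V : finType)
    (e : V -> V -> bool) : R :=
  \sum_a \sum_b (e a b)%:R.

Definition cubic_form (R : pzSemiRingType) (W : finType)
    (g : W -> W -> W -> bool) (x : W -> R) : R :=
  \sum_a \sum_b \sum_c (g a b c)%:R * (x a * (x b * x c)).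

Definition link_form (R : pzSemiRingType) (W : finType)
    (g : W -> W -> W -> bool) (c : W) (x : W -> R) : R :=
  \sum_a \sum_b (g c a b)%:R * (x a * x b).

Definition class_size (R : pzSemiRingType) (X W : finType) (chi : X -> W)
    (c : W) : R :=
  \sum_p (chi p == c)%:R.

Arguments triple_count {R V} h.
Arguments pair_count {R V} e.
Arguments class_size {R X W} chi c.

Section Counting.
Variable R : realFieldType.

Lemma triple_count_le (V : finType) (h h' : V -> V -> V -> bool) :
  (forall a b c, h a b c -> h' a b c) ->
  triple_count h <= triple_count h' :> R.
Proof.
move=> hh; apply: ler_sum => a _; apply: ler_sum => b _; apply: ler_sum => c _.
by have := hh a b c; case: (h a b c) => // ->.
Qed.

Lemma triple_count_ge0 (V : finType) (h : V -> V -> V -> bool) :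
  0 <= triple_count h :> R.
Proof. by do 3 (apply: sumr_ge0 => ? _). Qed.

Lemma triple_count_link (V : finType) (h : V -> V -> V -> bool) :
  triple_count h = \sum_v pair_count (h v) :> R.
Proof. by []. Qed.

Lemma sumr_const_card (V : finType) (a : R) : \sum_(v : V) a = #|V|%:R * a.
Proof. by rewrite sumr_const mulr_natl. Qed.

Section Classes.
Variables (X W : finType) (chi : X -> W).
Local Notation n := (class_size chi : W -> R).

Lemma class_size_ge0 c : 0 <= n c.
Proof. exact: sumr_ge0. Qed.

Lemma sum_over_classes (F : W -> R) : \sum_p F (chi p) = \sum_c n c * F c.
Proof.
under [RHS]eq_bigr do rewrite mulr_suml.
rewrite exchange_big; apply: eq_bigr => p _.
rewrite (bigD1 (chi p))//= eqxx mul1r big1 ?addr0// => c.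
by rewrite eq_sym => /negPf ->; rewrite mul0r.
Qed.

Lemma sum_class_size : \sum_c n c = #|X|%:R.
Proof.
have := sum_over_classes (fun=> 1); rewrite sumr_const_card mulr1 => ->.
by apply: eq_bigr => c _; rewrite mulr1.
Qed.

Lemma triple_count_classes (g : W -> W -> W -> bool) :
  triple_count (fun p q r => g (chi p) (chi q) (chi r)) = cubic_form g n.
Proof.
rewrite /triple_count (sum_over_classes
  (fun a => \sum_q \sum_r (g a (chi q) (chi r))%:R)).
apply: eq_bigr => a _.
rewrite (sum_over_classes (fun b => \sum_r (g a b (chi r))%:R)) mulr_sumr.
apply: eq_bigr => b _.
rewrite (sum_over_classes (fun c => (g a b c)%:R)) !mulr_sumr.
by apply: eq_bigr => c _; ring.
Qed.

Lemma pair_count_classes (g : W -> W -> W -> bool) c :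
  pair_count (fun p q => g c (chi p) (chi q)) = link_form g c n.
Proof.
rewrite /pair_count (sum_over_classes (fun a => \sum_q (g c a (chi q))%:R)).
apply: eq_bigr => a _.
rewrite (sum_over_classes (fun b => (g c a b)%:R)) mulr_sumr.
by apply: eq_bigr => b _; ring.
Qed.

End Classes.

Lemma triple_count_diff (V : finType) (h k : V -> V -> V -> bool) :
  (forall a b c, h a b c -> k a b c) ->
  triple_count (fun a b c => k a b c && ~~ h a b c)
  = triple_count k - triple_count h :> R.
Proof.
move=> hk; rewrite -!sumrB; apply: eq_bigr => a _.
rewrite -sumrB; apply: eq_bigr => b _.
rewrite -sumrB; apply: eq_bigr => c _.
by have := hk a b c; case: (h a b c) => [->//|_]; rewrite ?subrr// andbT subr0.
Qed.

Lemma pair_count_diff (V : finType) (h k : V -> V -> bool) :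
  (forall a b, h a b -> k a b) ->
  pair_count (fun a b => k a b && ~~ h a b)
  = pair_count k - pair_count h :> R.
Proof.
move=> hk; rewrite -!sumrB; apply: eq_bigr => a _.
rewrite -sumrB; apply: eq_bigr => b _.
by have := hk a b; case: (h a b) => [->//|_]; rewrite ?subrr// andbT subr0.
Qed.

End Counting.

Section LinkBound.
Variables (R : realFieldType) (W : finType) (g : W -> W -> W -> bool) (Lam : R).
Hypothesis g_sys : is_triple_system g.
Hypothesis g_le : forall x : W -> R, (forall c, 0 <= x c) ->
  cubic_form g x <= Lam * (\sum_c x c) ^+ 3.

(** Expand the form at the new point: the terms of degree two and three in t are
    nonnegative, and by symmetry the linear ones add up to three links. *)
Lemma cubic_form_increment (x : W -> R) c t :
  (forall c, 0 <= x c) -> 0 <= t ->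
  cubic_form g x + 3 * t * link_form g c x
  <= cubic_form g (fun b => x b + t * (b == c)%:R).
Proof.
move=> x0 t0; case: g_sys => sym12 sym23 _.
have sel (F : W -> R) : \sum_b (b == c)%:R * F b = F c.
  rewrite (bigD1 c)//= eqxx mul1r big1 ?addr0// => b /negPf ->.
  by rewrite mul0r.
pose d b : R := (b == c)%:R.
have e1 : \sum_a \sum_b \sum_e (g a b e)%:R * (d a * (x b * x e))
    = link_form g c x.
  transitivity (\sum_a d a * link_form g a x); last exact: sel.
  apply: eq_bigr => a _; rewrite mulr_sumr; apply: eq_bigr => b _.
  by rewrite mulr_sumr; apply: eq_bigr => e _; ring.
have e2 : \sum_a \sum_b \sum_e (g a b e)%:R * (x a * (d b * x e))
    = link_form g c x.
  rewrite exchange_big -e1; apply: eq_bigr => a _; apply: eq_bigr => b _.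
  by apply: eq_bigr => e _; rewrite sym12; ring.
have e3 : \sum_a \sum_b \sum_e (g a b e)%:R * (x a * (x b * d e))
    = link_form g c x.
  rewrite -e2; apply: eq_bigr => a _; rewrite exchange_big.
  apply: eq_bigr => b _.
  by apply: eq_bigr => e _; rewrite sym23; ring.
rewrite (_ : 3 * t * _ = t * link_form g c x + (t * link_form g c x +
  t * link_form g c x)); last by ring.
rewrite -{1}e1 -{1}e2 -{1}e3 !mulr_sumr -!big_split; apply: ler_sum => a _.
rewrite !mulr_sumr -!big_split; apply: ler_sum => b _.
rewrite !mulr_sumr -!big_split; apply: ler_sum => e _ /=.
have d0 u : 0 <= d u by [].
rewrite -/(d a) -/(d b) -/(d e).
rewrite -subr_ge0.
have -> : forall G : R, G * ((x a + t * d a) * ((x b + t * d b) * (x e + t * d e)))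
    - (G * (x a * (x b * x e)) + (t * (G * (d a * (x b * x e))) +
      (t * (G * (x a * (d b * x e))) + t * (G * (x a * (x b * d e))))))
  = G * (t * t * (d a * d b * x e + d a * x b * d e + x a * d b * d e)
         + t * t * t * (d a * d b * d e)) by move=> G; ring.
by rewrite !(mulr_ge0, addr_ge0).
Qed.

(** A point that nearly maximises the cubic form has no derivative much larger
    than three times the maximum, since moving towards c would otherwise
    exceed the bound on the form. *)
Lemma link_form_le (x : W -> R) c th :
  0 <= Lam <= 1 -> 0 < th <= 1 -> (forall c, 0 <= x c) ->
  (Lam - th ^+ 2) * (\sum_c x c) ^+ 3 <= cubic_form g x ->
  link_form g c x <= (Lam + 2 * th) * (\sum_c x c) ^+ 2.
Proof.
move=> /andP[L0 L1] /andP[th0 th1] x0 gx.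
set N := \sum_c x c in gx *.
have N0 : 0 <= N by apply: sumr_ge0.
have [Nz|Npos] := eqVneq N 0.
  have xz a : x a = 0.
    apply/eqP; rewrite eq_le x0 andbT -Nz /N (bigD1 a)//= lerDl.
    exact: sumr_ge0.
  rewrite Nz expr0n mulr0 /link_form big1// => a _; rewrite big1// => b _.
  by rewrite xz; ring.
have {}Npos : 0 < N by rewrite lt_def Npos.
have tN : 0 <= th * N by rewrite mulr_ge0// ltW.
have := cubic_form_increment c x0 tN.
have y0 b : 0 <= x b + th * N * (b == c)%:R by rewrite addr_ge0// mulr_ge0.
move/le_trans => /(_ _ (g_le y0)).
rewrite big_split -mulr_sumr /= -/N.
have -> : \sum_b (b == c)%:R = 1 :> R.
  by rewrite (bigD1 c)//= eqxx big1 ?addr0// => b /negPf ->.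
move=> H.
set l := link_form g c x in H *.
have H1 : 3 * th * l * N <= (Lam * (3 * th + 3 * th ^+ 2 + th ^+ 3) + th ^+ 2) * N ^+ 3.
  by move: H gx; lra.
have H2 : 3 * th * l <= (Lam * (3 * th + 3 * th ^+ 2 + th ^+ 3) + th ^+ 2) * N ^+ 2.
  rewrite -(ler_pM2r Npos); apply: (le_trans H1).
  by rewrite le_eqVlt; apply/orP; left; apply/eqP; ring.
rewrite -(@ler_pM2l _ (3 * th)) ?mulr_gt0//.
apply: (le_trans H2); rewrite [leRHS]mulrA ler_wpM2r ?exprn_ge0//.
rewrite -subr_ge0.
have -> : 3 * th * (Lam + 2 * th) -
    (Lam * (3 * th + 3 * th ^+ 2 + th ^+ 3) + th ^+ 2)
  = th ^+ 2 * (5 - 3 * Lam - Lam * th) by ring.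
rewrite mulr_ge0 ?exprn_ge0 ?(ltW th0)//.
have : Lam * th <= 1 by rewrite mulr_ile1// ltW.
lra.
Qed.

End LinkBound.

(** * Random transversals and random samples *)

Section Transversal.
Variables (R : realFieldType) (X W : finType) (chi : X -> W) (beta : R).
Hypotheses (beta_gt0 : 0 < beta) (X_gt0 : (0 < #|X|)%N).
Hypothesis class_large : forall c, beta * #|X|%:R <= class_size chi c.

Let N : R := #|X|%:R.
Let mu c p : R := (chi p == c)%:R / class_size chi c.

Let N_gt0 : 0 < N. Proof. by rewrite ltr0n. Qed.

Let class_gt0 c : 0 < class_size chi c :> R.
Proof. by apply: lt_le_trans (class_large c); rewrite mulr_gt0. Qed.

Let mu_ge0 c p : 0 <= mu c p.
Proof. by rewrite mulr_ge0// invr_ge0 ltW. Qed.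

Let mu_sum1 c : \sum_p mu c p = 1.
Proof. by rewrite /mu -mulr_suml -/(class_size chi c) divff// gt_eqF. Qed.

Let mu_le c p : mu c p <= (beta * N)^-1.
Proof.
apply: (@le_trans _ _ (1 / class_size chi c)).
  apply: ler_wpM2r; first by rewrite invr_ge0 ltW.
  by rewrite lern1 leq_b1.
by rewrite mul1r lef_pV2 ?class_large// posrE// mulr_gt0.
Qed.

(** Choose a vertex of each class uniformly at random.  As no class is small, a
    penalised vertex, pair or triple turns up in a given place with probability at
    most its density times 1 / beta, 1 / beta ^ 2 or 1 / beta ^ 3, so that the
    last hypothesis makes the expected total penalty less than 1. *)
Lemma transversal_exists (b1 : X -> R) (b2 : X -> X -> R)
    (b3 : X -> X -> X -> R) (e1 e2 e3 : R) :
  (forall p, 0 <= b1 p) -> (forall p q, 0 <= b2 p q) ->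
  (forall p q r, 0 <= b3 p q r) ->
  \sum_p b1 p <= e1 * N -> \sum_p \sum_q b2 p q <= e2 * N ^+ 2 ->
  \sum_p \sum_q \sum_r b3 p q r <= e3 * N ^+ 3 ->
  #|W|%:R * (e1 / beta) + #|W|%:R ^+ 2 * (e2 / beta ^+ 2)
    + #|W|%:R ^+ 3 * (e3 / beta ^+ 3) < 1 ->
  exists T : W -> X,
    [/\ forall c, chi (T c) = c,
        forall a, b1 (T a) < 1,
        forall a b, a != b -> b2 (T a) (T b) < 1
      & forall a b c, a != b -> a != c -> b != c -> b3 (T a) (T b) (T c) < 1].
Proof.
move=> b1_ge0 b2_ge0 b3_ge0 b1_le b2_le b3_le small.
have bN0 : 0 <= (beta * N)^-1 by rewrite invr_ge0 mulr_ge0// ltW.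
have E1 a : product_mean mu (fun T => b1 (T a)) <= e1 / beta.
  rewrite product_mean_coord1//.
  apply: (@le_trans _ _ (\sum_u (beta * N)^-1 * b1 u)).
    by apply: ler_sum => u _; rewrite ler_wpM2r.
  rewrite -mulr_sumr mulrC ler_pdivrMr ?mulr_gt0//.
  apply: (le_trans b1_le); rewrite le_eqVlt; apply/orP; left; apply/eqP.
  by field; rewrite gt_eqF.
have E2 a b : a != b -> product_mean mu (fun T => b2 (T a) (T b)) <= e2 / beta ^+ 2.
  move=> ab; rewrite product_mean_coord2//.
  apply: (@le_trans _ _ (\sum_u \sum_v ((beta * N)^-1) ^+ 2 * b2 u v)).
    apply: ler_sum => u _; apply: ler_sum => v _; rewrite ler_wpM2r// expr2.
    by apply: ler_pM.
  under eq_bigr do rewrite -mulr_sumr.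
  rewrite -mulr_sumr exprVn mulrC ler_pdivrMr ?exprn_gt0 ?mulr_gt0//.
  apply: (le_trans b2_le); rewrite le_eqVlt; apply/orP; left; apply/eqP.
  by field; rewrite gt_eqF.
have E3 a b c : a != b -> a != c -> b != c ->
    product_mean mu (fun T => b3 (T a) (T b) (T c)) <= e3 / beta ^+ 3.
  move=> ab ac bc; rewrite product_mean_coord3//.
  apply: (@le_trans _ _
      (\sum_u \sum_v \sum_w ((beta * N)^-1) ^+ 3 * b3 u v w)).
    apply: ler_sum => u _; apply: ler_sum => v _; apply: ler_sum => w _.
    rewrite ler_wpM2r// !exprS expr0 mulr1 -mulrA.
    apply: ler_pM => //; first exact: mulr_ge0.
    exact: ler_pM.
  under eq_bigr do under eq_bigr do rewrite -mulr_sumr.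
  under eq_bigr do rewrite -mulr_sumr.
  rewrite -mulr_sumr exprVn mulrC ler_pdivrMr ?exprn_gt0 ?mulr_gt0//.
  apply: (le_trans b3_le); rewrite le_eqVlt; apply/orP; left; apply/eqP.
  by field; rewrite gt_eqF.
pose F1 (T : {ffun W -> X}) := \sum_a b1 (T a).
pose F2 (T : {ffun W -> X}) := \sum_a \sum_(b | a != b) b2 (T a) (T b).
pose F3 (T : {ffun W -> X}) := \sum_a \sum_(b | a != b)
  \sum_(c | (a != c) && (b != c)) b3 (T a) (T b) (T c).
pose F T := F1 T + F2 T + F3 T.
have e1_ge0 : 0 <= e1 / beta.
  by rewrite divr_ge0 ?(ltW beta_gt0)// -(pmulr_lge0 _ N_gt0) (le_trans _ b1_le)// sumr_ge0.
have e2_ge0 : 0 <= e2 / beta ^+ 2.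
  rewrite divr_ge0 ?exprn_ge0 ?(ltW beta_gt0)//.
  rewrite -(pmulr_lge0 _ (exprn_gt0 2 N_gt0)) (le_trans _ b2_le)//.
  by do 2 (apply: sumr_ge0 => ? _).
have e3_ge0 : 0 <= e3 / beta ^+ 3.
  rewrite divr_ge0 ?exprn_ge0 ?(ltW beta_gt0)//.
  rewrite -(pmulr_lge0 _ (exprn_gt0 3 N_gt0)) (le_trans _ b3_le)//.
  by do 3 (apply: sumr_ge0 => ? _).
have sub (P : pred W) (G : W -> R) (a : R) : 0 <= a ->
    (forall c, P c -> G c <= a) -> \sum_(c | P c) G c <= #|W|%:R * a.
  move=> a0 Ga; rewrite -sumr_const_card [leLHS]big_mkcond.
  by apply: ler_sum => c _; case: ifP => // /Ga.
have EF : product_mean mu F < 1.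
  rewrite !product_meanD (le_lt_trans _ small)// !lerD//.
  - rewrite product_mean_sum; exact: sub.
  - rewrite product_mean_sum expr2 -mulrA; apply: (sub _ _ _) => [|a _].
      by rewrite mulr_ge0.
    by rewrite product_mean_sum; apply: (sub _ _ _) => // b; exact: E2.
  - rewrite product_mean_sum exprS -mulrA; apply: (sub _ _ _) => [|a _].
      by rewrite mulr_ge0// exprn_ge0.
    rewrite product_mean_sum expr2 -mulrA; apply: (sub _ _ _) => [|b ab].
      by rewrite mulr_ge0.
    by rewrite product_mean_sum; apply: (sub _ _ _) => // c /andP[]; exact: E3.
have [|T [muT FT]] := @product_mean_exists _ _ _ _ mu_ge0 mu_sum1
    (fun T => - F T) (- product_mean mu F).
  rewrite -mulN1r -product_meanZ le_eqVlt; apply/orP; left; apply/eqP.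
  by apply: eq_product_mean => T; rewrite mulN1r.
have {}FT : F T < 1 by move: FT EF; lra.
have F1_ge0 : 0 <= F1 T by exact: sumr_ge0.
have F2_ge0 : 0 <= F2 T by do 2 (apply: sumr_ge0 => ? _).
have F3_ge0 : 0 <= F3 T by do 3 (apply: sumr_ge0 => ? _).
exists T; split=> [c|a|a b ab|a b c ab ac bc].
- apply/eqP; apply: contraT => Tc.
  by have := muT c; rewrite /mu (negPf Tc) mul0r ltxx.
- apply: le_lt_trans FT; rewrite /F -addrA; apply: ler_wpDr; first exact: addr_ge0.
  by rewrite /F1 (bigD1 a)//= lerDl sumr_ge0.
- apply: le_lt_trans FT; rewrite /F; apply: ler_wpDr => //; apply: ler_wpDl => //.
  rewrite /F2 (bigD1 a)//= (bigD1 b)//= -addrA lerDl addr_ge0 ?sumr_ge0//.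
  by move=> *; rewrite sumr_ge0.
- apply: le_lt_trans FT; rewrite /F; apply: ler_wpDl; first exact: addr_ge0.
  rewrite /F3 (bigD1 a)//= (bigD1 b)//= (bigD1 c) ?ac//= -!addrA lerDl.
  rewrite !addr_ge0 ?sumr_ge0// => *; rewrite sumr_ge0// => *.
  by rewrite sumr_ge0.
Qed.

End Transversal.

Section Sampling.
Variables (R : realFieldType) (V X : finType).

Section Means.
Variable mu : V -> R.
Hypotheses (mu_ge0 : forall v, 0 <= mu v) (mu_sum1 : \sum_v mu v = 1).

Local Notation mean := (product_mean (fun _ : X => mu)).

(** Pairs of distinct points are mapped to independent vertices; the summand
    #|X| pays for the coincident ones. *)
Lemma mean_pair_ge (e : V -> V -> R) : (forall u v, 0 <= e u v <= 1) ->
  (\sum_u \sum_v mu u * mu v * e u v) * #|X|%:R ^+ 2 - #|X|%:R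
  <= mean (fun f => \sum_p \sum_q e (f p) (f q)).
Proof.
move=> e01; set d := \sum_u _.
have d1 : d <= 1.
  apply: (@le_trans _ _ (\sum_u \sum_v mu u * mu v)).
    apply: ler_sum => u _; apply: ler_sum => v _.
    by rewrite ler_piMr ?mulr_ge0//; case/andP: (e01 u v).
  under eq_bigr do rewrite -mulr_sumr mu_sum1 mulr1.
  by rewrite mu_sum1.
have Epq p q : d - (p == q)%:R <= mean (fun f => e (f p) (f q)).
  have [<-|pq] := eqVneq p q; last by rewrite product_mean_coord2// subr0.
  apply: (@le_trans _ _ 0); first by rewrite subr_le0.
  by apply: product_mean_ge0 => // f; case/andP: (e01 (f p) (f p)).
rewrite product_mean_sum.
under eq_bigr do rewrite product_mean_sum.
apply: le_trans (ler_sum _ (fun p _ => ler_sum _ (fun q _ => Epq p q))).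
under eq_bigr => p _.
  rewrite sumrB sumr_const_card (bigD1 p)//= eqxx big1; last first.
    by move=> q; rewrite eq_sym => /negPf ->.
  over.
rewrite sumr_const_card addr0 le_eqVlt; apply/orP; left; apply/eqP; rewrite mulr1n; ring.
Qed.

Lemma mean_triple_ge (h : V -> V -> V -> bool) :
  (cubic_form h mu) * #|X|%:R ^+ 3 - 3 * #|X|%:R ^+ 2
  <= mean (fun f => triple_count (fun p q r => h (f p) (f q) (f r))).
Proof.
set d := cubic_form h mu.
have d1 : d <= 1.
  apply: (@le_trans _ _ (\sum_u \sum_v \sum_w mu u * (mu v * mu w))).
    apply: ler_sum => u _; apply: ler_sum => v _; apply: ler_sum => w _.
    by rewrite ler_piMl ?mulr_ge0// lern1 leq_b1.
  under eq_bigr do under eq_bigr do rewrite -!mulr_sumr mu_sum1 mulr1.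
  under eq_bigr do rewrite -mulr_sumr mu_sum1 mulr1.
  by rewrite mu_sum1.
have Epq p q r : d - ((p == q)%:R + (p == r)%:R + (q == r)%:R)
    <= mean (fun f => (h (f p) (f q) (f r))%:R).
  have m0 : 0 <= mean (fun f => (h (f p) (f q) (f r))%:R).
    exact: product_mean_ge0.
  have [pq|pq] := eqVneq p q.
    by apply: le_trans m0; rewrite subr_le0 -addrA ler_wpDr ?mulr1n ?addr_ge0.
  have [pr|pr] := eqVneq p r.
    by apply: le_trans m0; rewrite subr_le0 add0r ler_wpDr ?mulr1n.
  have [qr|qr] := eqVneq q r.
    by apply: le_trans m0; rewrite subr_le0 !add0r ?mulr1n.
  rewrite !addr0 subr0 (product_mean_coord3 _ (fun u v w => (h u v w)%:R))//.
  rewrite le_eqVlt; apply/orP; left; apply/eqP.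
  apply: eq_bigr => u _; apply: eq_bigr => v _; apply: eq_bigr => w _.
  by rewrite mulrC mulrA.
rewrite product_mean_sum.
under eq_bigr do rewrite product_mean_sum.
under eq_bigr do under eq_bigr do rewrite product_mean_sum.
apply: le_trans (ler_sum _ (fun p _ => ler_sum _ (fun q _ =>
  ler_sum _ (fun r _ => Epq p q r)))).
have diag p : \sum_q (p == q)%:R = 1 :> R.
  by rewrite (bigD1 p)//= eqxx big1 ?addr0// => q; rewrite eq_sym => /negPf ->.
under eq_bigr => p _.
  under eq_bigr => q _.
    rewrite sumrB !big_split /= !sumr_const_card !diag.
    over.
  rewrite sumrB !big_split /= !sumr_const_card -!mulr_sumr diag.
  over.
rewrite sumr_const_card le_eqVlt; apply/orP; left; apply/eqP; ring.
Qed.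

End Means.

(** A random map X -> V does not miss the averages of h, e and B by much, but all
    three goals have to be met by the same map.  The triple count is at most
    Lam for every map, and the count of B is nonnegative; so when these two are
    weighted by 2 / eta, a deviation of size eta from the extreme value in one
    of them is a loss that the bounded average of e cannot make up for. *)
Lemma sample_exists (h : V -> V -> V -> bool) (e : V -> V -> R) (B : pred V)
    (Lam eps tau eta : R) :
  (0 < #|V|)%N -> (0 < #|X|)%N -> 0 <= Lam -> 0 < eta <= 1 ->
  eps + 3 / #|X|%:R + tau <= eta ^+ 2 / 6 ->
  (forall f : X -> V, triple_count (fun p q r => h (f p) (f q) (f r))
     <= Lam * #|X|%:R ^+ 3) ->
  (forall u v, 0 <= e u v <= 1) ->
  (Lam - eps) * #|V|%:R ^+ 3 <= triple_count h ->
  (Lam - eps) * #|V|%:R ^+ 2 <= \sum_u \sum_v e u v ->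
  \sum_v (B v)%:R <= tau * #|V|%:R ->
  exists f : X -> V,
    [/\ (Lam - eta) * #|X|%:R ^+ 3
          <= triple_count (fun p q r => h (f p) (f q) (f r)),
        (Lam - eta) * #|X|%:R ^+ 2 <= \sum_p \sum_q e (f p) (f q)
      & \sum_p (B (f p))%:R <= eta * #|X|%:R].
Proof.
move=> V0 X0 L0 /andP[eta0 eta1] small loc e01 hV eV BV.
set n : R := #|V|%:R in hV eV BV *; set l : R := #|X|%:R in small loc *.
have n0 : 0 < n by rewrite ltr0n.
have l0 : 0 < l by rewrite ltr0n.
pose mu (v : V) := n^-1.
have mu0 v : 0 <= mu v by rewrite invr_ge0 ltW.
have mu1 : \sum_v mu v = 1 by rewrite sumr_const_card divff// gt_eqF.
pose D (f : {ffun X -> V}) : R := triple_count (fun p q r => h (f p) (f q) (f r)).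
pose E (f : {ffun X -> V}) : R := \sum_p \sum_q e (f p) (f q).
pose b (f : {ffun X -> V}) : R := \sum_p (B (f p))%:R.
have [K K0 K2] : exists2 K, 0 < K & K * eta = 2.
  by exists (2 / eta); rewrite ?divr_gt0// divfK// gt_eqF.
pose F f := l ^- 2 * E f + (K * l ^- 3 * D f + (- (K / l)) * b f).
pose eps' := eps + 3 / l + tau.
have mD : (Lam - eps - 3 / l) <= l ^- 3 * product_mean (fun=> mu) D.
  rewrite [leRHS]mulrC ler_pdivlMr ?exprn_gt0//.
  apply: le_trans (mean_triple_ge mu0 mu1 h); rewrite -/l.
  have dE : Lam - eps <= cubic_form h mu.
    rewrite (_ : cubic_form h mu = n ^- 3 * triple_count h).
      by rewrite [leRHS]mulrC ler_pdivlMr ?exprn_gt0.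
    rewrite mulr_sumr; apply: eq_bigr => u _.
    rewrite mulr_sumr; apply: eq_bigr => v _.
    rewrite mulr_sumr; apply: eq_bigr => w _.
    by rewrite /mu mulrC !exprS expr0 mulr1 !invfM.
  rewrite [leLHS]mulrBl lerB// ?ler_wpM2r ?exprn_ge0 ?(ltW l0)//.
  rewrite le_eqVlt; apply/orP; left; apply/eqP; field; by rewrite gt_eqF.
have mE : (Lam - eps - 1 / l) <= l ^- 2 * product_mean (fun=> mu) E.
  rewrite [leRHS]mulrC ler_pdivlMr ?exprn_gt0//.
  apply: le_trans (mean_pair_ge mu0 mu1 e01); rewrite -/l.
  have dE : Lam - eps <= \sum_u \sum_v mu u * mu v * e u v.
    rewrite (_ : (\sum_u _) = n ^- 2 * \sum_u \sum_v e u v).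
      by rewrite [leRHS]mulrC ler_pdivlMr ?exprn_gt0.
    rewrite mulr_sumr; apply: eq_bigr => u _.
    rewrite mulr_sumr; apply: eq_bigr => v _.
    by rewrite /mu expr2 !invfM.
  rewrite [leLHS]mulrBl lerB// ?ler_wpM2r ?exprn_ge0 ?(ltW l0)//.
  rewrite le_eqVlt; apply/orP; left; apply/eqP; field; by rewrite gt_eqF.
have mb : product_mean (fun=> mu) b <= tau * l.
  rewrite product_mean_sum.
  apply: (@le_trans _ _ (\sum_(p : X) tau)); last first.
    by rewrite sumr_const_card mulrC.
  apply: ler_sum => p _; rewrite (product_mean_coord1 _ _ (fun v => (B v)%:R))//.
  by rewrite -mulr_sumr mulrC ler_pdivrMr.
have Kb : K / l * product_mean (fun=> mu) b <= K * tau.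
  by rewrite -mulrA ler_wpM2l ?(ltW K0)// [leLHS]mulrC ler_pdivrMr.
have [|f [_ Ff]] := @product_mean_exists _ X V _ (fun=> mu0) (fun=> mu1) F
   (Lam - eps - 1 / l + K * (Lam - eps - 3 / l) - K * tau).
  rewrite /F !product_meanD !product_meanZ -addrA !lerD//.
    by rewrite -mulrA ler_wpM2l ?(ltW K0).
  by rewrite mulNr lerN2.
have il0 : 0 < l^-1 by rewrite invr_gt0.
set x := l ^- 2 * E f; set y := l ^- 3 * D f; set z := b f / l.
have Fxyz : F f = x + K * y - K * z by rewrite /F /x /y /z; ring.
rewrite {}Fxyz in Ff.
have x1 : x <= 1.
  rewrite /x mulrC ler_pdivrMr ?exprn_gt0// mul1r.
  apply: (@le_trans _ _ (\sum_(p : X) \sum_(q : X) 1)).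
    apply: ler_sum => p _; apply: ler_sum => q _.
    by case/andP: (e01 (f p) (f q)).
  by rewrite !sumr_const_card mulr1 expr2.
have yL : y <= Lam by rewrite /y mulrC ler_pdivrMr ?exprn_gt0//; exact: loc.
have z0 : 0 <= z by rewrite divr_ge0 ?(ltW l0)//; exact: sumr_ge0.
have Keps : (K + 1) * eps' <= eta / 2.
  apply: (@le_trans _ _ ((K + 1) * (eta ^+ 2 / 6))).
    by rewrite ler_wpM2l// addr_ge0// ltW.
  rewrite (_ : (K + 1) * (eta ^+ 2 / 6) = (2 * eta + eta * eta) / 6); last first.
    by rewrite -K2; ring.
  have : eta * eta <= eta by rewrite ler_piMr// ltW.
  lra.
have tau0 : 0 <= tau.
  by rewrite -(pmulr_lge0 _ n0) (le_trans _ BV)// sumr_ge0.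
have Ky : 0 <= K * (Lam - y) by rewrite mulr_ge0 ?subr_ge0// ltW.
have Kz : 0 <= K * z by rewrite mulr_ge0// ltW.
have key : K * (Lam - y) + K * z <= x - Lam + (K + 1) * eps'.
  move: Ff tau0 il0; rewrite /eps' !mul1r; lra.
have le2 : x - Lam + (K + 1) * eps' <= 2 by move: x1 L0 Keps eta1; lra.
exists f; split.
- have : y >= Lam - eta.
    rewrite -(ler_pM2l K0); move: key le2 K2 Kz; lra.
  by rewrite /y mulrC ler_pdivlMr ?exprn_gt0.
- have : x >= Lam - eta by move: key Ky Kz Keps eta0; lra.
  by rewrite /x mulrC ler_pdivlMr ?exprn_gt0.
- have : z <= eta.
    rewrite -(ler_pM2l K0); move: key le2 K2 Ky; lra.
  by rewrite /z ler_pdivrMr.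
Qed.

End Sampling.

(** * Extremal systems of patterns and their rigidity *)

(** Patterns g i on a common vertex set whose cubic forms have the same maximum
    Lam on the simplex, attained only at xs.  As triples are counted in all six
    orders, Lam is six times the usual Lagrangian.  Stability is required in
    homogeneous form, so that it applies to class sizes directly. *)
Record extremal_system (R : realFieldType) (t : nat) (W : finType) (Lam : R)
    (xs : W -> R) (g : 'I_t -> W -> W -> W -> bool) : Prop := ExtremalSystem {
  sys_triple : forall i, is_triple_system (g i);
  sys_cover : forall i a b, a != b -> exists c, g i a b c;
  sys_Lam : 0 < Lam <= 1;
  sys_le : forall i x, (forall c, 0 <= x c) ->
    cubic_form (g i) x <= Lam * (\sum_c x c) ^+ 3;
  sys_stable : forall d, 0 < d -> exists2 e, 0 < e &
    forall i x, (forall c, 0 <= x c) ->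
      (Lam - e) * (\sum_c x c) ^+ 3 <= cubic_form (g i) x ->
      forall c, `|x c - xs c * \sum_c x c| <= d * \sum_c x c;
  sys_opt : forall i, cubic_form (g i) xs = Lam;
  sys_pos : forall c, 0 < xs c;
  sys_sum : \sum_c xs c = 1;
  sys_rigid : forall i j (s : W -> W), injective s ->
    (forall a b c, g i a b c -> g j (s a) (s b) (s c)) -> i = j
}.

Definition coloring_on (V W : finType) (h : V -> V -> V -> bool)
    (g : W -> W -> W -> bool) (S : {set V}) (psi : V -> W) :=
  forall a b c, a \in S -> b \in S -> c \in S ->
    h a b c -> g (psi a) (psi b) (psi c).

Definition locally_colorable (t : nat) (W : finType)
    (g : 'I_t -> W -> W -> W -> bool) (L : nat) (V : finType)
    (h : V -> V -> V -> bool) :=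
  forall S : {set V}, (#|S| <= L)%N -> exists i psi, coloring_on h (g i) S psi.

Definition is_copy (V W : finType) (h : V -> V -> V -> bool)
    (g : W -> W -> W -> bool) (T : W -> V) :=
  forall a b c, g a b c -> h (T a) (T b) (T c).

Definition attached (V W : finType) (h : V -> V -> V -> bool)
    (g : W -> W -> W -> bool) (T : W -> V) (c : W) (v : V) :=
  [forall a, forall b, g c a b ==> h v (T a) (T b)].

Lemma attachedP (V W : finType) (h : V -> V -> V -> bool)
    (g : W -> W -> W -> bool) (T : W -> V) (c : W) (v : V) :
  reflect (forall a b, g c a b -> h v (T a) (T b)) (attached h g T c v).
Proof.
apply: (iffP 'forall_'forall_implyP) => H a b; exact: H.
Qed.

Lemma triple_system_neq (V : finType) (h : V -> V -> V -> bool) a b c :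
  is_triple_system h -> h a b c -> [/\ a != b, a != c & b != c].
Proof.
move=> [s12 s23 irr] habc; split; apply/eqP => E; move: habc.
- by rewrite E irr.
- by rewrite E s23 irr.
- by rewrite E s12 s23 irr.
Qed.

Lemma locally_colorableW (t : nat) (W : finType)
    (g : 'I_t -> W -> W -> W -> bool) (L L' : nat) (V : finType)
    (h : V -> V -> V -> bool) :
  (L' <= L)%N -> locally_colorable g L h -> locally_colorable g L' h.
Proof. by move=> LL loc S SL; apply: loc; apply: leq_trans LL. Qed.

Lemma small_pos_exists (R : realFieldType) (A : R) : 0 <= A ->
  exists2 th : R, 0 < th <= 1 & th * A < 1.
Proof.
move=> A0; have A1 : 0 < A + 1 by rewrite ltr_wpDl.
exists (A + 1)^-1; last by rewrite mulrC ltr_pdivrMr// mul1r ltrDl.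
by rewrite invr_gt0 A1 invf_le1// lerDr.
Qed.

Section System.
Variables (R : realFieldType) (t : nat) (W : finType) (Lam : R) (xs : W -> R).
Variable g : 'I_t -> W -> W -> W -> bool.
Hypothesis sys : extremal_system Lam xs g.

Local Notation k := (#|W|%:R : R).

(** The link of c contains a pair through any other vertex c', whereas no pair of
    the link of c' contains c'. *)
Lemma link_determines i c c' :
  (forall a b, g i c a b -> g i c' a b) -> c' = c.
Proof.
move=> sub; apply/eqP; apply: contraT => cc'.
have [s12 s23 irr] := sys_triple sys i.
have [d gd] : exists d, g i c' c d by exact: sys_cover sys i _ _ cc'.
by have := sub c' d; rewrite s12 gd irr => /(_ isT).
Qed.

(** Any two vertices of a pattern lie in a common edge, so a coloring is
    injective on every copy of a pattern and maps it to an embedded pattern;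
    by the rigidity of the system it acts there as an automorphism. *)
Lemma rigid_copy (V : finType) (h : V -> V -> V -> bool) i j
    (T : W -> V) (S : {set V}) (psi : V -> W) :
  is_copy h (g i) T -> (forall c, T c \in S) -> coloring_on h (g j) S psi ->
  j = i /\ exists ta : W -> W,
    (forall a b c, g i (ta a) (ta b) (ta c) = g i a b c) /\
    forall c, ta (psi (T c)) = c.
Proof.
move=> copyT TS colpsi; pose s c := psi (T c).
have hom a b c : g i a b c -> g j (s a) (s b) (s c).
  by move=> /copyT; apply: colpsi.
have s_inj : injective s.
  move=> a b sab; apply/eqP; apply: contraT => /(sys_cover sys i)[c /hom].
  by rewrite sab; have [_ _ ->] := sys_triple sys j.
have ij := sys_rigid sys s_inj hom; split; first by [].
subst j.
(* An injective map that preserves a finite relation reflects it, too. *)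
pose A := [set p : W * W * W | g i p.1.1 p.1.2 p.2].
pose s3 (p : W * W * W) := (s p.1.1, s p.1.2, s p.2).
have s3_inj : injective s3.
  by move=> [[a b] c] [[a' b'] c'] [/s_inj -> /s_inj -> /s_inj ->].
have s3A : s3 @: A = A.
  apply/eqP; rewrite eqEcard card_imset// leqnn andbT.
  by apply/fintype.subsetP => _ /imsetP[p + ->]; rewrite !inE => /hom.
exists (invF s_inj); split=> [a b c|c]; last exact: invF_f.
apply/idP/idP => [/hom|gabc]; first by rewrite !f_invF.
have : (a, b, c) \in A by rewrite inE.
rewrite -s3A => /imsetP[[[a' b'] c']]; rewrite inE /= => g' [-> -> ->].
by rewrite !invF_f.
Qed.

Lemma coloring_attached (V : finType) (h : V -> V -> V -> bool) i
    (T : W -> V) (S : {set V}) (psi : V -> W) c v :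
  coloring_on h (g i) S psi -> (forall c, T c \in S) ->
  (forall c, psi (T c) = c) -> v \in S -> attached h (g i) T c v -> psi v = c.
Proof.
move=> col TS psiT vS /attachedP att; apply: (link_determines (i := i)) => a b.
by move/att/col; rewrite !psiT; apply.
Qed.

(** All colorings that map the c-th vertex of T to c agree on the vertices
    attached to T, hence also on the vertices attached to a copy that consists of
    such vertices.  Every edge lies with T and its witnesses in a small set, and
    rigidity normalises the coloring of this set on T. *)
Lemma coloring_from_witnesses (V : finType) (h : V -> V -> V -> bool) i
    (T : W -> V) (col : V -> W) (wit : V -> W -> V) :
  locally_colorable g (4 * #|W| + 3) h -> is_copy h (g i) T ->
  (forall v a, attached h (g i) T a (wit v a)) ->
  (forall v, attached h (g i) (wit v) (col v) v) ->
  forall u v w, h u v w -> g i (col u) (col v) (col w).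
Proof.
move=> loc copyT witT witv u v w huvw.
pose im (x : W -> V) := [set x a | a in W].
pose S := im T :|: im (wit u) :|: im (wit v) :|: im (wit w)
          :|: [set u] :|: [set v] :|: [set w].
have imW x : (#|im x| <= #|W|)%N by exact: leq_imset_card.
have SW : (#|S| <= 4 * #|W| + 3)%N.
  have cU (A B : {set V}) m n : (#|A| <= m -> #|B| <= n -> #|A :|: B| <= m + n)%N.
    by move=> Am Bn; apply: leq_trans (leq_add Am Bn); rewrite cardsU leq_subr.
  have -> : (4 * #|W| + 3 = #|W| + #|W| + #|W| + #|W| + 1 + 1 + 1)%N by lia.
  by rewrite /S; do ![apply: (cU)]; rewrite ?cards1.
have [j [psi0 col0]] := loc S SW.
have TS c : T c \in S by rewrite !inE imset_f.
have [ji [ta [taE taT]]] := rigid_copy copyT TS col0; subst j.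
pose psi x := ta (psi0 x).
have colpsi : coloring_on h (g i) S psi.
  by move=> a b c aS bS cS habc; rewrite /psi taE; apply: col0.
have colE x : x \in S -> (forall a, wit x a \in S) -> psi x = col x.
  move=> xS wS; apply: (coloring_attached colpsi wS _ xS (witv x)) => c.
  exact: (coloring_attached colpsi TS taT (wS c) (witT x c)).
rewrite -!colE; first by apply: colpsi => //; rewrite !inE eqxx ?orbT.
all: try by move=> a; rewrite !inE imset_f ?orbT.
all: by rewrite !inE eqxx ?orbT.
Qed.

(** The product of all weights is a lower bound for each of them. *)
Lemma weights_bounded_below :
  exists2 beta : R, 0 < beta & forall c, 2 * beta <= xs c.
Proof.
exists ((\prod_c xs c) / 2).
  by rewrite divr_gt0// prodr_gt0// => c _; exact: sys_pos sys c.
move=> c; rewrite [2 * _]mulrC divfK ?pnatr_eq0// (bigD1 c)//=.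
rewrite ler_piMr ?(ltW (sys_pos sys c))//.
rewrite prodr_ile1// => b _; rewrite (ltW (sys_pos sys b))/=.
rewrite -(sys_sum sys) (bigD1 b)//= lerDl sumr_ge0// => a _.
exact: ltW (sys_pos sys a).
Qed.

Lemma classes_large : exists beta eta : R, [/\ 0 < beta, 0 < eta
  & forall i (X : finType) (chi : X -> W),
    (Lam - eta) * #|X|%:R ^+ 3
      <= triple_count (fun p q r => g i (chi p) (chi q) (chi r)) ->
    forall c, beta * #|X|%:R <= class_size chi c].
Proof.
have [beta b0 bxs] := weights_bounded_below.
have [eta e0 H] := sys_stable sys b0.
exists beta, eta; split=> // i X chi; rewrite triple_count_classes => D c.
have := H i (class_size chi) (class_size_ge0 R chi).
rewrite sum_class_size => /(_ D c); rewrite ler_norml => /andP[+ _].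
have N0 : 0 <= #|X|%:R :> R by [].
by have := ler_wpM2r N0 (bxs c); lra.
Qed.

Lemma colored_triple_count_le i (X : finType) (chi : X -> W) :
  triple_count (fun p q r => g i (chi p) (chi q) (chi r)) <= Lam * #|X|%:R ^+ 3.
Proof.
rewrite triple_count_classes -(sum_class_size R chi).
by apply: (sys_le sys) => c; exact: class_size_ge0.
Qed.

Lemma sample_count_le (V X : finType) (h : V -> V -> V -> bool) (f : X -> V) :
  locally_colorable g #|X| h ->
  triple_count (fun p q r => h (f p) (f q) (f r)) <= Lam * #|X|%:R ^+ 3.
Proof.
move=> loc; have [i [psi col]] := loc [set f p | p in X] (leq_imset_card _ _).
apply: le_trans (colored_triple_count_le i (fun p => psi (f p))).
by apply: triple_count_le => p q r; apply: col; rewrite imset_f.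
Qed.

Section Deficits.
Variables (V X : finType) (h : V -> V -> V -> bool) (f : X -> V).
Variables (i : 'I_t) (psi : V -> W) (S : {set V}).
Hypotheses (col : coloring_on h (g i) S psi) (fS : forall p, f p \in S).

Definition missing_triple p q r :=
  g i (psi (f p)) (psi (f q)) (psi (f r)) && ~~ h (f p) (f q) (f r).

Definition missing_pair v p q :=
  g i (psi v) (psi (f p)) (psi (f q)) && ~~ h v (f p) (f q).

Lemma sample_colored_count :
  triple_count (fun p q r => h (f p) (f q) (f r))
  <= triple_count (fun p q r => g i (psi (f p)) (psi (f q)) (psi (f r))) :> R.
Proof. by apply: triple_count_le => p q r; apply: col. Qed.

Lemma missing_triple_count eta :
  (Lam - eta) * #|X|%:R ^+ 3
    <= triple_count (fun p q r => h (f p) (f q) (f r)) ->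
  triple_count missing_triple <= eta * #|X|%:R ^+ 3.
Proof.
move=> D; rewrite triple_count_diff => [|p q r]; last exact: col.
have := colored_triple_count_le i (fun p => psi (f p)); move: D; lra.
Qed.

(** The pairs of the sample in the link of v all have the colors of pairs in the
    link of the color of v, and the number of such pairs is bounded because the
    sample has nearly extremal density. *)
Lemma missing_pair_count th v :
  0 < th <= 1 -> v \in S ->
  (Lam - th ^+ 2) * #|X|%:R ^+ 3
    <= triple_count (fun p q r => h (f p) (f q) (f r)) ->
  pair_count (missing_pair v)
  <= (Lam + 2 * th) * #|X|%:R ^+ 2 - pair_count (fun p q => h v (f p) (f q)).
Proof.
move=> th01 vS D; rewrite pair_count_diff => [|p q]; last exact: col.
rewrite lerD2r.
rewrite (pair_count_classes R (fun p => psi (f p)) (g i)).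
rewrite -(sum_class_size R (fun p => psi (f p))).
apply: (@link_form_le _ _ _ Lam) => //.
- exact: sys_triple sys i.
- exact: sys_le sys i.
- by have /andP[/ltW -> ->] := sys_Lam sys.
- by move=> c; exact: class_size_ge0.
- rewrite sum_class_size -triple_count_classes.
  exact: le_trans D sample_colored_count.
Qed.

End Deficits.
End System.

(** * From local to global colorings *)

Section MainColoring.
Variables (R : realType) (t : nat) (W : finType) (Lam : R) (xs : W -> R).
Variable g : 'I_t -> W -> W -> W -> bool.
Hypothesis sys : extremal_system Lam xs g.

Local Notation k := (#|W|%:R : R).

Definition unattached (V : finType) (h : V -> V -> V -> bool)
    (i : 'I_t) (T : W -> V) (v : V) := [forall c, ~~ attached h (g i) T c v].

(** A random transversal of a dense sample is a copy of the pattern, and on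
    average over all vertices v it avoids the few pairs of the sample that are
    missing in the link of v. *)
Lemma core_exists (tau : R) : 0 < tau ->
  exists2 eta : R, 0 < eta <= 1 &
  forall (V X : finType) (h : V -> V -> V -> bool) (f : X -> V),
    is_triple_system h -> (0 < #|V|)%N -> (0 < #|X|)%N ->
    locally_colorable g #|X|.+1 h ->
    (Lam - eta) * #|X|%:R ^+ 3
      <= triple_count (fun p q r => h (f p) (f q) (f r)) ->
    (Lam - eta) * #|X|%:R ^+ 2 * #|V|%:R
      <= \sum_v pair_count (fun p q => h v (f p) (f q)) ->
    exists i (T : W -> V), is_copy h (g i) T /\
      \sum_v (unattached h i T v)%:R <= tau * #|V|%:R.
Proof.
move=> tau0.
have [beta [eta0 [b0 eta0_gt0 large]]] := classes_large sys.
pose A := k ^+ 3 / beta ^+ 3 + 3 * k ^+ 4 / (tau * beta ^+ 2).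
have A0 : 0 <= A.
  by rewrite addr_ge0// divr_ge0 ?mulr_ge0 ?exprn_ge0// ltW.
have [th /andP[th0 th1] thA] := small_pos_exists A0.
pose eta := Num.min (th ^+ 2) eta0.
have eta_gt0 : 0 < eta by rewrite lt_min exprn_gt0.
have eta_th2 : eta <= th ^+ 2 by rewrite ge_min lexx.
have th2 : th ^+ 2 <= th by rewrite expr2 ler_piMr// ltW.
exists eta; first by rewrite eta_gt0 (le_trans eta_th2)// (le_trans th2).
move=> V X h f hsys V0 X0 loc D P.
set N : R := #|X|%:R in D P *; set n : R := #|V|%:R in P *.
have N0 : 0 < N by rewrite ltr0n.
have n0 : 0 < n by rewrite ltr0n.
have [i [psi col]] := loc [set f p | p in X] (leqW (leq_imset_card _ _)).
have fS p : f p \in [set f p | p in X] by rewrite imset_f.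
have /choice[col' colP] : forall v, exists c : 'I_t * (V -> W),
    coloring_on h (g c.1) (v |: [set f p | p in X]) c.2.
  move=> v; have [|j [ph cph]] := loc (v |: [set f p | p in X]).
    by rewrite cardsU1 -add1n leq_add ?leq_b1// leq_imset_card.
  by exists (j, ph).
pose miss v := missing_pair g h f (col' v).1 (col' v).2 v.
have fS' v p : f p \in v |: [set f p | p in X] by rewrite !inE fS orbT.
have missP v : pair_count (miss v)
    <= (Lam + 2 * th) * N ^+ 2 - pair_count (fun p q => h v (f p) (f q)).
  apply: (missing_pair_count sys (colP v) (fS' v)).
  - by rewrite th0.
  - by rewrite !inE eqxx.
  - apply: le_trans D; rewrite ler_wpM2r ?exprn_ge0 ?(ltW N0)//.
    by rewrite lerD2l lerN2.
(* The factor is chosen such that b2 p q < 1 leaves at most a proportion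
   tau / k ^+ 2 of the vertices for which the pair (p, q) is missing. *)
pose b2 p q : R := k ^+ 2 / (tau * n) * \sum_v (miss v p q)%:R.
have k2 : 0 <= k ^+ 2 / (tau * n).
  by rewrite divr_ge0 ?exprn_ge0 ?mulr_ge0// ltW.
have b2_le : \sum_p \sum_q b2 p q <= k ^+ 2 / tau * (2 * th + eta) * N ^+ 2.
  have -> : \sum_p \sum_q b2 p q = k ^+ 2 / (tau * n) * \sum_v pair_count (miss v).
    under eq_bigr do rewrite -mulr_sumr.
    rewrite -mulr_sumr; congr (_ * _); rewrite [RHS]exchange_big.
    apply: eq_bigr => p _; rewrite [RHS]exchange_big.
    by apply: eq_bigr => q _.
  have : \sum_v pair_count (miss v) <= (2 * th + eta) * N ^+ 2 * n.
    apply: le_trans (ler_sum _ (fun v _ => missP v)) _.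
    rewrite sumrB sumr_const_card -/n; move: P; lra.
  move=> /(ler_wpM2l k2)/le_trans; apply.
  rewrite le_eqVlt; apply/orP; left; apply/eqP; field.
  by rewrite !gt_eqF.
have [||||||||T [TW _ T2 T3]] := @transversal_exists R X W (fun p => psi (f p))
    beta b0 X0 (fun c => _) (fun=> 0) b2
    (fun p q r => (missing_triple g h f i psi p q r)%:R)
    0 (k ^+ 2 / tau * (2 * th + eta)) eta => //.
- apply: large; apply: (le_trans _ (sample_colored_count R col fS)).
  apply: le_trans D; rewrite ler_wpM2r ?exprn_ge0 ?(ltW N0)//.
  by rewrite lerD2l lerN2 ge_min lexx orbT.
- by move=> p q; rewrite mulr_ge0// sumr_ge0.
- by rewrite big1// mul0r.
- exact: (missing_triple_count sys col fS).
- rewrite mul0r mulr0 add0r; apply: le_lt_trans thA.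
  have -> : th * A = k ^+ 2 * (k ^+ 2 / tau * (3 * th) / beta ^+ 2)
      + k ^+ 3 * (th / beta ^+ 3).
    by rewrite /A; field; rewrite !gt_eqF.
  have eth : eta <= th by apply: le_trans th2.
  apply: lerD; apply: ler_wpM2l; rewrite ?exprn_ge0//.
    apply: ler_wpM2r; first by rewrite invr_ge0 exprn_ge0// ltW.
    apply: ler_wpM2l; first by rewrite divr_ge0 ?exprn_ge0// ltW.
    by move: eth; lra.
  by apply: ler_wpM2r => //; rewrite invr_ge0 exprn_ge0// ltW.
have copyT : is_copy h (g i) (fun c => f (T c)).
  move=> a b c gabc; have [ab ac bc] := triple_system_neq (sys_triple sys i) gabc.
  have := T3 a b c ab ac bc.
  by rewrite /missing_triple !TW gabc /=; case: (h _ _ _) => //=; rewrite ltxx.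
exists i, (fun c => f (T c)); split=> //.
(* Vertices in whose link no pair of the copy is missing are attached to it:
   to the vertex of the copy that an automorphism matches with their color. *)
pose hit v : R := \sum_a \sum_(b | a != b) (miss v (T a) (T b))%:R.
have unhit v : (unattached h i (fun c => f (T c)) v)%:R <= hit v.
  have [/forallP un|] := boolP (unattached _ _ _ _); last first.
    by move=> _; do 2 (apply: sumr_ge0 => ? _).
  have [|c] := rigid_copy sys copyT _ (colP v); first by move=> c; exact: fS'.
  move=> [ta [taE taT]].
  have := un (ta ((col' v).2 v)).
  rewrite negb_forall => /existsP[a]; rewrite negb_forall => /existsP[b].
  rewrite negb_imply => /andP[gab nh].
  have [_ _ ab] := triple_system_neq (sys_triple sys i) gab.
  rewrite /hit (bigD1 a)//= (bigD1 b)//=.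
  have -> : miss v (T a) (T b).
    rewrite /miss /missing_pair nh andbT; move: taE taT gab.
    by rewrite -c => taE taT; rewrite -{1}(taT a) -{1}(taT b) taE.
  by rewrite -addrA lerDl addr_ge0 ?sumr_ge0// => ? _; rewrite sumr_ge0.
apply: le_trans (ler_sum _ (fun v _ => unhit v)) _.
rewrite /hit exchange_big.
under eq_bigr do rewrite exchange_big.
have k_gt0 : 0 < k.
  by rewrite ltr0n; apply/card_gt0P; exists (psi (f (enum_val (Ordinal X0)))).
have pairle a b : a != b -> \sum_v (miss v (T a) (T b))%:R <= tau * n / k ^+ 2.
  move=> /T2; rewrite /b2 => /ltW; rewrite mulrC.
  have kt : 0 < k ^+ 2 / (tau * n) by rewrite divr_gt0 ?exprn_gt0 ?mulr_gt0.
  rewrite -ler_pdivlMr// => /le_trans; apply.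
  rewrite le_eqVlt; apply/orP; left; apply/eqP; field.
  by rewrite !gt_eqF.
apply: (@le_trans _ _ (\sum_(a : W) \sum_(b : W) (tau * n / k ^+ 2))).
  apply: ler_sum => a _; rewrite [leLHS]big_mkcond; apply: ler_sum => b _.
  case: ifP => [/pairle//|_].
  by rewrite divr_ge0 ?mulr_ge0 ?exprn_ge0// ltW.
rewrite !sumr_const_card le_eqVlt; apply/orP; left; apply/eqP; field.
by rewrite gt_eqF.
Qed.

(** The link of v in a sample of almost extremal density is almost full, and
    most of the sample is attached to the core T; so the link contains a
    transversal consisting of vertices that are attached to T. *)
Lemma witness_exists :
  exists2 eta : R, 0 < eta <= 1 &
  forall (V X : finType) (h : V -> V -> V -> bool) i (T : W -> V) v
         (f : X -> V),
    is_triple_system h -> (0 < #|X|)%N ->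
    locally_colorable g (#|W| + #|X|.+1) h -> is_copy h (g i) T ->
    (Lam - eta) * #|X|%:R ^+ 3
      <= triple_count (fun p q r => h (f p) (f q) (f r)) ->
    (Lam - eta) * #|X|%:R ^+ 2 <= pair_count (fun p q => h v (f p) (f q)) ->
    \sum_p (unattached h i T (f p))%:R <= eta * #|X|%:R ->
    exists c (x : W -> V),
      (forall a, attached h (g i) T a (x a)) /\ attached h (g i) x c v.
Proof.
have [beta [eta0 [b0 eta0_gt0 large]]] := classes_large sys.
pose A := k / beta + 3 * k ^+ 2 / beta ^+ 2.
have A0 : 0 <= A.
  by rewrite addr_ge0// divr_ge0 ?mulr_ge0 ?exprn_ge0// ltW.
have [th /andP[th0 th1] thA] := small_pos_exists A0.
pose eta := Num.min (th ^+ 2) eta0.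
have eta_gt0 : 0 < eta by rewrite lt_min exprn_gt0.
have eta_th2 : eta <= th ^+ 2 by rewrite ge_min lexx.
have th2 : th ^+ 2 <= th by rewrite expr2 ler_piMr// ltW.
exists eta; first by rewrite eta_gt0 (le_trans eta_th2)// (le_trans th2).
move=> V X h i T v f hsys X0 loc copyT D P U.
set N : R := #|X|%:R in D P U *.
have N0 : 0 < N by rewrite ltr0n.
pose S := [set T c | c in W] :|: (v |: [set f p | p in X]).
have SL : (#|S| <= #|W| + #|X|.+1)%N.
  rewrite (leq_trans (leq_card_setU _ _))// leq_add ?leq_imset_card//.
  by rewrite cardsU1 -add1n leq_add ?leq_b1// leq_imset_card.
have [j [psi0 col0]] := loc S SL.
have TS c : T c \in S by rewrite !inE imset_f.
have fS p : f p \in S by rewrite !inE imset_f ?orbT.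
have vS : v \in S by rewrite !inE eqxx ?orbT.
have [ji [ta [taE taT]]] := rigid_copy sys copyT TS col0; subst j.
pose psi x := ta (psi0 x).
have col : coloring_on h (g i) S psi.
  by move=> a b c aS bS cS habc; rewrite /psi taE; apply: col0.
pose miss := missing_pair g h f i psi v.
have missP : pair_count miss <= (2 * th + eta) * N ^+ 2.
  have : pair_count miss
    <= (Lam + 2 * th) * N ^+ 2 - pair_count (fun p q => h v (f p) (f q)).
    apply: (missing_pair_count sys col fS) => //.
      by rewrite th0.
    apply: le_trans D; rewrite ler_wpM2r ?exprn_ge0 ?(ltW N0)//.
    by rewrite lerD2l lerN2.
  move: P; lra.
have [||||||||x [xW x1 x2 _]] := @transversal_exists R X W (fun p => psi (f p))
    beta b0 X0 (fun c => _) (fun p => (unattached h i T (f p))%:R)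
    (fun p q => (miss p q)%:R) (fun _ _ _ => 0) eta (2 * th + eta) 0 => //.
- apply: large; apply: (le_trans _ (sample_colored_count R col fS)).
  apply: le_trans D; rewrite ler_wpM2r ?exprn_ge0 ?(ltW N0)//.
  by rewrite lerD2l lerN2 ge_min lexx orbT.
- by rewrite mul0r big1// => p _; rewrite big1// => q _; rewrite big1.
- rewrite mul0r mulr0 addr0; apply: le_lt_trans thA.
  have -> : th * A = k * (th / beta) + k ^+ 2 * (3 * th / beta ^+ 2).
    by rewrite /A; field; rewrite !gt_eqF.
  have eth : eta <= th by apply: le_trans th2.
  apply: lerD; apply: ler_wpM2l; rewrite ?exprn_ge0//.
    by apply: ler_wpM2r => //; rewrite invr_ge0 ltW.
  apply: ler_wpM2r; first by rewrite invr_ge0 exprn_ge0// ltW.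
  by move: eth; lra.
exists (psi v), (fun a => f (x a)); split=> [a|].
  have := x1 a; case: (boolP (unattached _ _ _ _)) => [_|]; first by rewrite ltxx.
  rewrite negb_forall => /existsP[c]; rewrite negbK => att _.
  have E : c = a by rewrite -(coloring_attached sys col TS taT (fS (x a)) att) -[RHS]xW.
  by move: att; rewrite E.
apply/attachedP => a b gab.
have [_ _ ab] := triple_system_neq (sys_triple sys i) gab.
have := x2 a b ab; rewrite /miss /missing_pair !xW gab /=.
by case: (h _ _ _) => //=; rewrite ltxx.
Qed.

Lemma nat_above (x : R) : exists n : nat, x <= n%:R.
Proof.
exists `|Num.ceil x|%N.
rewrite natr_absz; apply: le_trans (ceil_ge x) _.
by rewrite ler_int ler_norm.
Qed.

(** The subsets of h that have to be colorable consist of a copy of a pattern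
    with a sample and one more vertex, or of a copy with the witnesses of the
    three vertices of an edge; their sizes depend on the system only. *)
Theorem coloring_from_min_degree :
  exists (L : nat) (eps : R), 0 < eps /\
  forall (V : finType) (h : V -> V -> V -> bool),
    is_triple_system h -> (0 < #|V|)%N -> locally_colorable g L h ->
    (forall v, (Lam - eps) * #|V|%:R ^+ 2 <= pair_count (h v)) ->
    exists i (psi : V -> W), forall a b c, h a b c ->
      g i (psi a) (psi b) (psi c).
Proof.
have [eta1 eta1_01 witP] := witness_exists.
have /andP[eta1_gt0 _] := eta1_01.
(* A third of the error eta1 ^+ 2 / 6 allowed when witnesses are sampled; the
   other two thirds are left for eps and 3 / L. *)
pose tau := eta1 ^+ 2 / 18.
have tau0 : 0 < tau by rewrite divr_gt0 ?exprn_gt0.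
have [eta2 eta2_01 coreP] := core_exists tau0.
have /andP[eta2_gt0 _] := eta2_01.
pose eps := Num.min tau (eta2 ^+ 2 / 12).
have eps0 : 0 < eps by rewrite lt_min tau0 divr_gt0 ?exprn_gt0.
have [l lP] := nat_above (3 / eps).
pose L := l.+1.
have L0 : 0 < L%:R :> R by rewrite ltr0n.
have Leps : 3 / L%:R <= eps.
  rewrite ler_pdivrMr// mulrC -ler_pdivrMr//; apply: le_trans lP _.
  by rewrite ler_nat.
have e1 : eps <= tau by rewrite ge_min lexx.
have e2 : eps <= eta2 ^+ 2 / 12 by rewrite ge_min lexx orbT.
have /andP[Lam0 Lam1] := sys_Lam sys.
set bound := (#|W| + L.+1 + (4 * #|W| + 3))%N.
have bound3 : (#|W| + L.+1 <= bound)%N by exact: leq_addr.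
have bound2 : (L < bound)%N by apply: leq_trans bound3; exact: leq_addl.
have bound1 : (L <= bound)%N by exact: ltnW.
have bound4 : (4 * #|W| + 3 <= bound)%N by exact: leq_addl.
exists bound, eps; split=> // V h hsys V0 loc deg.
set n : R := #|V|%:R in deg.
have n0 : 0 < n by rewrite ltr0n.
have cardL : #|'I_L| = L by exact: card_ord.
have hdens : (Lam - eps) * n ^+ 3 <= triple_count h.
  rewrite triple_count_link (le_trans _ (ler_sum _ (fun v _ => deg v)))//.
  by rewrite sumr_const_card -/n le_eqVlt; apply/orP; left; apply/eqP; ring.
have count_le (f : 'I_L -> V) :
    triple_count (fun p q r => h (f p) (f q) (f r)) <= Lam * #|'I_L|%:R ^+ 3.
  apply: (sample_count_le sys); apply: locally_colorableW loc.
  by rewrite cardL.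
have L0' : (0 < #|'I_L|)%N by rewrite cardL.
have [i [T [copyT unT]]] : exists i (T : W -> V), is_copy h (g i) T /\
    \sum_v (unattached h i T v)%:R <= tau * n.
  (* Sampling pairs from the average of all links makes the sample good for
     most vertices at the same time. *)
  pose e u v : R := n^-1 * \sum_w (h w u v)%:R.
  have [|||||f [D P _]] := @sample_exists R V 'I_L h e xpred0 Lam eps 0 eta2
    V0 L0' (ltW Lam0) eta2_01 _ count_le => //.
  - rewrite cardL; move: Leps e2; lra.
  - move=> u v; rewrite mulr_ge0 ?invr_ge0 ?sumr_ge0 ?(ltW n0)//=.
    rewrite /e [leLHS]mulrC ler_pdivrMr// mul1r.
    apply: (@le_trans _ _ (\sum_(w : V) 1)); last by rewrite sumr_const_card mulr1.
    by apply: ler_sum => w _; rewrite lern1 leq_b1.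
  - have -> : \sum_u \sum_v e u v = n^-1 * triple_count h.
      under eq_bigr do rewrite -mulr_sumr.
      rewrite -mulr_sumr; congr (_ * _).
      by under eq_bigr do rewrite exchange_big; rewrite exchange_big.
    rewrite [leRHS]mulrC ler_pdivlMr//; apply: le_trans hdens.
    by rewrite le_eqVlt; apply/orP; left; apply/eqP; rewrite /n; ring.
  - by rewrite big1// mul0r.
  apply: (coreP V 'I_L h f) => //.
    by apply: locally_colorableW loc; rewrite cardL.
  rewrite -ler_pdivlMr//; apply: (le_trans P).
  rewrite le_eqVlt; apply/orP; left; apply/eqP.
  under eq_bigr do rewrite -mulr_sumr.
  rewrite -mulr_sumr mulrC; congr (_ / _); rewrite [RHS]exchange_big.
  apply: eq_bigr => p _; rewrite [RHS]exchange_big.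
  by apply: eq_bigr => q _.
have wit v : exists cx : W * {ffun W -> V},
    (forall a, attached h (g i) T a (cx.2 a)) /\ attached h (g i) cx.2 cx.1 v.
  have [|||||f [D P U]] := @sample_exists R V 'I_L h (fun a b => (h v a b)%:R)
    (unattached h i T) Lam eps tau eta1 V0 L0' (ltW Lam0) eta1_01 _ count_le => //.
  - by rewrite cardL; move: Leps e1; rewrite /tau; lra.
  - by move=> a b; rewrite ler0n lern1 leq_b1.
  - exact: deg.
  have [|c [x [x1 x2]]] := witP V 'I_L h i T v f hsys L0' _ copyT D P U.
    by apply: locally_colorableW loc; rewrite cardL.
  exists (c, [ffun a => x a]); split=> /= [a|]; first by rewrite ffunE.
  apply/attachedP => a b; rewrite !ffunE; exact: (attachedP _ _ _ _ _ x2).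
have [cx cxP] := choice wit.
exists i, (fun v => (cx v).1).
apply: (coloring_from_witnesses sys (T := T) (wit := fun v a => (cx v).2 a)) => //.
- exact: locally_colorableW loc.
- by move=> v; case: (cxP v).
- by move=> v; case: (cxP v).
Qed.

End MainColoring.

(** * Vertices of low degree *)

Definition restrict (V : finType) (h : V -> V -> V -> bool) (U : {set V})
  a b c := [&& a \in U, b \in U, c \in U & h a b c].

Section LowDegree.
Variable R : realType.

Lemma restrict_triple_system (V : finType) (h : V -> V -> V -> bool) U :
  is_triple_system h -> is_triple_system (restrict h U).
Proof.
move=> [s12 s23 irr]; rewrite /restrict; split=> [a b c|a b c|a b].
- by rewrite s12; case: (a \in U); case: (b \in U).
- by rewrite s23; case: (a \in U); case: (b \in U); case: (c \in U).
- by rewrite irr !andbF.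
Qed.

Lemma restrict_count_le (V : finType) (h : V -> V -> V -> bool) (U : {set V}) :
  triple_count (restrict h U) <= #|U|%:R ^+ 3 :> R.
Proof.
apply: (@le_trans _ _ (\sum_a \sum_b \sum_c
   (a \in U)%:R * ((b \in U)%:R * (c \in U)%:R))).
  apply: ler_sum => a _; apply: ler_sum => b _; apply: ler_sum => c _.
  rewrite /restrict; case: (a \in U); case: (b \in U); case: (c \in U) => /=;
  by rewrite ?(mulr0, mul0r, mulr1) ?lern1 ?leq_b1.
under eq_bigr do under eq_bigr do rewrite -!mulr_sumr.
under eq_bigr do rewrite -mulr_sumr -mulr_suml.
rewrite -mulr_suml.
have -> : \sum_a (a \in U)%:R = #|U|%:R :> R.
  by rewrite -natr_sum -sum1_card [in RHS]big_mkcond; congr (_%:R);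
    apply: eq_bigr => a _; case: (a \in U).
by rewrite le_eqVlt; apply/orP; left; apply/eqP; ring.
Qed.

Lemma restrict_count_remove (V : finType) (h : V -> V -> V -> bool)
    (U : {set V}) (v : V) : is_triple_system h ->
  triple_count (restrict h U)
  <= triple_count (restrict h (U :\ v)) + 3 * pair_count (restrict h U v) :> R.
Proof.
move=> /(restrict_triple_system U) [s12 s23 irr]; set r := restrict h U.
pose d (x : V) : R := (x == v)%:R.
have sel (F : V -> R) : \sum_b d b * F b = F v.
  rewrite (bigD1 v)//= /d eqxx mul1r big1 ?addr0// => b /negPf ->.
  by rewrite mul0r.
have e1 : \sum_a \sum_b \sum_c d a * (r a b c)%:R = pair_count (r v) :> R.
  rewrite -(sel (fun a => pair_count (r a))); apply: eq_bigr => a _.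
  by rewrite mulr_sumr; apply: eq_bigr => b _; rewrite mulr_sumr.
have e2 : \sum_a \sum_b \sum_c d b * (r a b c)%:R = pair_count (r v) :> R.
  rewrite exchange_big -e1; apply: eq_bigr => a _; apply: eq_bigr => b _.
  by apply: eq_bigr => c _; rewrite /r s12.
have e3 : \sum_a \sum_b \sum_c d c * (r a b c)%:R = pair_count (r v) :> R.
  rewrite -e2; apply: eq_bigr => a _; rewrite exchange_big.
  by apply: eq_bigr => b _; apply: eq_bigr => c _; rewrite /r s23.
have -> : 3 * pair_count (r v) =
   pair_count (r v) + (pair_count (r v) + pair_count (r v)) :> R by ring.
rewrite -{1}e1 -{1}e2 -{1}e3 -!big_split; apply: ler_sum => a _.
rewrite -!big_split; apply: ler_sum => b _.
rewrite -!big_split; apply: ler_sum => c _ /=.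
case rabc: (r a b c); last by rewrite !mulr0 !addr0.
rewrite mulr1n !mulr1 /d; move: rabc; rewrite /r /restrict !inE.
case: (a == v) => /=; first by move=> _; rewrite mulr1n ler_wpDl// ler_wpDr// addr_ge0.
case: (b == v) => /=; first by move=> _; rewrite mulr1n mulr0n !add0r ler_wpDl// ler_wpDr.
case: (c == v) => /=; first by move=> _; rewrite mulr1n !mulr0n !add0r ler_wpDl.
by move=> ->; rewrite mulr0n !addr0.
Qed.

Variables (t : nat) (W : finType) (Lam : R) (xs : W -> R).
Variable g : 'I_t -> W -> W -> W -> bool.
Hypothesis sys : extremal_system Lam xs g.

Lemma restrict_colored_count_le i (V : finType) (h : V -> V -> V -> bool)
    (U : {set V}) (psi : V -> W) :
  coloring_on h (g i) U psi ->
  triple_count (restrict h U) <= Lam * #|U|%:R ^+ 3.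
Proof.
move=> col.
have -> : triple_count (restrict h U) = triple_count
    (fun a b c : {x | x \in U} => h (val a) (val b) (val c)) :> R.
  rewrite /triple_count -(big_sub _ (fun a => \sum_b \sum_c (h a (val b) (val c))%:R)).
  rewrite [RHS]big_mkcond; apply: eq_bigr => a _; case: ifP => aU; last first.
    by rewrite big1// => b _; rewrite big1// => c _; rewrite /restrict aU.
  rewrite -(big_sub _ (fun b => \sum_c (h a b (val c))%:R)) [RHS]big_mkcond.
  apply: eq_bigr => b _; case: ifP => bU; last first.
    by rewrite big1// => c _; rewrite /restrict bU andbF.
  rewrite -(big_sub _ (fun c => (h a b c)%:R)) [RHS]big_mkcond.
  apply: eq_bigr => c _; case: ifP => cU; last by rewrite /restrict cU !andbF.
  by rewrite /restrict aU bU cU.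
have := colored_triple_count_le sys i (fun a : {x | x \in U} => psi (val a)).
rewrite card_sig /=; apply: le_trans.
by apply: triple_count_le => a b c; apply: col; exact: valP.
Qed.

Lemma pair_count_sub (V : finType) (h : V -> V -> V -> bool) (U : {set V}) v :
  v \in U ->
  pair_count (fun a b : {x | x \in U} => h v (val a) (val b))
  = pair_count (restrict h U v) :> R.
Proof.
move=> vU; rewrite /pair_count -(big_sub _ (fun a => \sum_b (h v a (val b))%:R)).
rewrite [LHS]big_mkcond; apply: eq_bigr => a _; case: ifP => aU; last first.
  by rewrite big1// => b _; rewrite /restrict aU andbF.
rewrite -(big_sub _ (fun b => (h v a b)%:R)) [LHS]big_mkcond.
apply: eq_bigr => b _; case: ifP => bU; last by rewrite /restrict bU !andbF.
by rewrite /restrict aU bU vU.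
Qed.

(** What is needed about minimum degrees in the study of the number of triples:
    a large surplus of triples over the density Lam - e forces U to be large. *)
Definition has_dense_parts (L : nat) (e : R) (u0 : nat) :=
  [/\ 0 < e, e <= Lam
  & forall (V : finType) (h : V -> V -> V -> bool),
    is_triple_system h -> locally_colorable g L h ->
    exists U : {set V},
      triple_count h - (Lam - e) * #|V|%:R ^+ 3
        <= triple_count (restrict h U) - (Lam - e) * #|U|%:R ^+ 3 /\
      ((u0 <= #|U|)%N -> exists i psi, coloring_on h (g i) U psi)].

(** Take a set U that maximises the number of triples inside it minus
    (Lam - e) |U|^3.  By maximality no vertex of U has low degree in U. *)
Lemma dense_parts_exist : exists L e u0, has_dense_parts L e u0.
Proof.
have [L [eps0 [eps0_gt0 thmB]]] := coloring_from_min_degree sys.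
have /andP[Lam0 Lam1] := sys_Lam sys.
pose eps := Num.min eps0 Lam.
have eps_gt0 : 0 < eps by rewrite lt_min eps0_gt0.
have eps_le : eps <= eps0 by rewrite ge_min lexx.
have eps_Lam : eps <= Lam by rewrite ge_min lexx orbT.
have [u0 u0P] := nat_above (2 / eps).
exists L, (eps / 2), u0.+1; split; rewrite ?divr_gt0//; first by move: eps_Lam Lam0; lra.
move=> V h hsys loc.
pose al := Lam - eps / 2.
pose Psi (U : {set V}) : R := triple_count (restrict h U) - al * #|U|%:R ^+ 3.
have [U _ Umax'] : extremum_spec >=%R xpredT Psi [arg max_(U > [set: V]) Psi U]%O.
  exact: arg_maxP.
have Umax A : Psi A <= Psi U by exact: Umax'.
exists U; split.
  have := Umax [set: V]; rewrite /Psi cardsT.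
  have -> // : triple_count (restrict h [set: V]) = triple_count h :> R.
  apply: eq_bigr => a _; apply: eq_bigr => b _; apply: eq_bigr => c _.
  by rewrite /restrict !inE.
move=> u0U.
have U0 : (0 < #|U|)%N by apply: leq_trans u0U.
have u_large : 2 / eps <= #|U|%:R.
  by apply: (le_trans u0P); rewrite ler_nat ltnW.
set u : R := #|U|%:R in u_large *.
(* Compare U with U :\ v. *)
have deg v : v \in U -> (Lam - eps) * u ^+ 2 <= pair_count (restrict h U v).
  move=> vU.
  have := restrict_count_remove U v hsys.
  have := Umax (U :\ v); rewrite /Psi.
  have -> : #|U :\ v|%:R = u - 1 :> R.
    by rewrite /u (cardsD1 v U) vU natrD addrAC subrr add0r.
  rewrite -/u => H1 H2.
  have H3 : al * (3 * u ^+ 2 - 3 * u + 1) <= 3 * pair_count (restrict h U v).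
    have -> : al * (3 * u ^+ 2 - 3 * u + 1) = al * u ^+ 3 - al * (u - 1) ^+ 3 by ring.
    move: H1 H2; lra.
  rewrite -(ler_pM2l (_ : 0 < 3))//; apply: le_trans H3; rewrite -subr_ge0.
  have eu : 2 <= eps * u by rewrite mulrC -ler_pdivrMr.
  have u0' : 0 <= u by [].
  have : 2 * u <= eps * u * u by rewrite ler_wpM2r.
  have : al * u <= u by rewrite ler_piMl// /al; move: eps_gt0 Lam1; lra.
  have : 0 <= al by rewrite /al; move: eps_gt0 eps_Lam; lra.
  have -> : al * (3 * u ^+ 2 - 3 * u + 1) - 3 * ((Lam - eps) * u ^+ 2)
    = 3 / 2 * (eps * u * u) - 3 * (al * u) + al by rewrite /al; field.
  lra.
have [|||v|i [psi psiP]] := thmB {x | x \in U}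
    (fun a b c => h (val a) (val b) (val c)).
- case: hsys => s12 s23 irr; split=> *; [exact: s12|exact: s23|exact: irr].
- by rewrite card_sig.
- move=> S SL; have [|i [psi col]] := loc [set val x | x in S].
    exact: leq_trans (leq_imset_card _ _) SL.
  exists i, (psi \o val) => a b c aS bS cS; apply: col; exact: imset_f.
- have vU := valP v; have := deg _ vU; rewrite -(pair_count_sub h vU).
  apply: le_trans; rewrite card_sig/= -/u ler_wpM2r ?exprn_ge0//.
  by move: eps_le; lra.
have [v0 v0U] : exists v0, v0 \in U by apply/card_gt0P.
pose ext v := psi (insubd (Sub v0 v0U : {x | x \in U}) v).
exists i, ext => a b c aU bU cU habc.
by apply: psiP; rewrite !insubdK.
Qed.

Lemma exp3_ge (n : R) : 1 <= n -> n <= n ^+ 3.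
Proof. by move=> n1; rewrite ler_eXnr. Qed.

Lemma dense_part_large (e : R) (u0 : nat) : 0 < e ->
  exists N0, forall n u : nat, (N0 <= n)%N ->
    e * n%:R ^+ 3 <= u%:R ^+ 3 -> (u0 <= u)%N.
Proof.
move=> e0; have [N0 N0P] := nat_above (u0%:R ^+ 3 / e).
exists N0.+1 => n u Nn eu.
rewrite leqNgt; apply/negP => uu0.
have : u%:R ^+ 3 < u0%:R ^+ 3 :> R by rewrite ltr_pXn2r ?nnegrE// ltr_nat.
apply/negP; rewrite -leNgt; apply: le_trans eu.
rewrite -ler_pdivrMl// mulrC; apply: (le_trans N0P).
apply: (@le_trans _ _ n%:R); first by rewrite ler_nat ltnW.
by apply: exp3_ge; rewrite ler1n; apply: leq_trans Nn.
Qed.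

Section DenseParts.
Variables (L : nat) (e : R) (u0 : nat).
Hypothesis dense : has_dense_parts L e u0.

(** If h had more than Lam n^3 triples, its dense part would be large, hence
    colorable, and would have more triples than a colorable part can have. *)
Theorem turan_upper_bound : exists N0, forall (V : finType) (h : V -> V -> V -> bool),
  is_triple_system h -> locally_colorable g L h -> (N0 <= #|V|)%N ->
  triple_count h <= Lam * #|V|%:R ^+ 3.
Proof.
have [e0 eLam dp] := dense.
have [N0 N0P] := dense_part_large u0 e0.
exists N0 => V h hsys loc Vn; rewrite leNgt; apply/negP => hV.
have [U [PsiU colU]] := dp V h hsys loc.
have uU := restrict_count_le h U.
have e1 : 0 <= (Lam - e) * #|U|%:R ^+ 3 by rewrite mulr_ge0 ?subr_ge0 ?exprn_ge0.
have [|i [psi /restrict_colored_count_le]] := colU.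
  apply: (N0P _ _ Vn); move: PsiU uU hV e1; lra.
move=> NU.
have : #|U|%:R ^+ 3 <= #|V|%:R ^+ 3 :> R.
  by rewrite lerXn2r ?nnegrE// ler_nat max_card.
move/(ler_wpM2l (ltW e0)); move: PsiU hV NU; lra.
Qed.

(** The surplus over the density Lam - e of a colored part U is at most e |U|^3,
    while that of h is nearly e n^3; so |U| is nearly n. *)
Theorem large_colored_part (d : R) : 0 < d -> exists (e' : R) (N0 : nat),
  0 < e' /\ forall (V : finType) (h : V -> V -> V -> bool),
  is_triple_system h -> locally_colorable g L h -> (N0 <= #|V|)%N ->
  (Lam - e') * #|V|%:R ^+ 3 <= triple_count h ->
  exists (U : {set V}) i psi,
    coloring_on h (g i) U psi /\ (1 - d) * #|V|%:R <= #|U|%:R.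
Proof.
move=> d0; have [e0 eLam dp] := dense.
have [N0 N0P] := @dense_part_large (e / 2) u0 (divr_gt0 e0 (ltr0Sn _ 1)).
pose d' := Num.min d (1 / 2).
have d'0 : 0 < d' by rewrite lt_min d0 divr_gt0.
have d'd : d' <= d by rewrite ge_min lexx.
have d'2 : d' <= 1 / 2 by rewrite ge_min lexx orbT.
exists (e * d'), N0.+1; split; first by rewrite mulr_gt0.
move=> V h hsys loc Vn hV.
have [U [PsiU colU]] := dp V h hsys loc.
have uU := restrict_count_le h U.
set u : R := #|U|%:R in PsiU uU *; set n : R := #|V|%:R in hV PsiU *.
have e1 : 0 <= (Lam - e) * u ^+ 3 by rewrite mulr_ge0 ?subr_ge0 ?exprn_ge0.
have n0 : 0 < n by rewrite ltr0n; apply: leq_trans Vn.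
have n3 : 0 < n ^+ 3 by rewrite exprn_gt0.
have e2 : e * d' * n ^+ 3 <= e / 2 * n ^+ 3.
  by rewrite ler_wpM2r ?(ltW n3)// ler_wpM2l ?(ltW e0)//; move: d'2; lra.
have [|i [psi col]] := colU.
  apply: (N0P _ _ (ltnW Vn)); rewrite -/u -/n; move: PsiU uU hV e1 e2; lra.
exists U, i, psi; split=> //.
have := restrict_colored_count_le col; rewrite -/u => NU.
have un : u <= n by rewrite ler_nat max_card.
have key : (1 - d') * n ^+ 3 <= u ^+ 3.
  rewrite -(ler_pM2l e0); move: PsiU hV NU; lra.
have u0' : 0 <= u by [].
have : u ^+ 3 <= u * n ^+ 2.
  by rewrite exprS ler_wpM2l// lerXn2r ?nnegrE// ltW.
move/(le_trans key); rewrite (exprS n) mulrA ler_pM2r ?exprn_gt0//.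
by apply: le_trans; rewrite ler_wpM2r ?(ltW n0)//; move: d'd; lra.
Qed.

End DenseParts.
End LowDegree.

(** * Almost extremal triple systems and blowups *)

Section Matching.
Variable R : realFieldType.

(** Among all bijections V -> X take one with the fewest vertices whose color
    is not preserved.  For no color c is there both such a vertex of color c and
    one whose image has color c, since exchanging their images would preserve
    the color of the former. *)
Lemma color_matching (V X W : finType) (psi : V -> W) (chi : X -> W) (d : R) :
  #|V| = #|X| -> 0 <= d ->
  (forall c, `|class_size psi c - class_size chi c| <= d) ->
  exists pi : V -> X, bijective pi /\
    \sum_v (psi v != chi (pi v))%:R <= #|W|%:R * d.
Proof.
move=> VX d0 close.
pose bad (f : {ffun V -> X}) := [set v | psi v != chi (f v)].
pose f0 := [ffun v : V => enum_val (cast_ord VX (enum_rank v))].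
have f0_inj : injectiveb f0.
  apply/injectiveP => u v; rewrite !ffunE => /enum_val_inj/cast_ord_inj.
  exact: enum_rank_inj.
case: (@arg_minnP _ f0 (fun f => injectiveb f) (fun f => #|bad f|) f0_inj).
move=> f /injectiveP f_inj f_min.
have f_bij : bijective f by apply: inj_card_bij; rewrite ?VX.
exists f; split=> //.
pose D c : R := \sum_v ((psi v == c) && (psi v != chi (f v)))%:R.
pose D' c : R := \sum_v ((chi (f v) == c) && (psi v != chi (f v)))%:R.
have sizeD c : class_size psi c - class_size chi c = D c - D' c.
  have -> : class_size chi c = \sum_v (chi (f v) == c)%:R :> R.
    by rewrite /class_size (reindex f) //; exact: onW_bij.
  rewrite -!sumrB; apply: eq_bigr => v _.
  have [<-|_] := eqVneq (psi v) (chi (f v)); first by rewrite !andbF !subrr.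
  by rewrite !andbT.
have D_or c : D c = 0 \/ D' c = 0.
  have [v /andP[/eqP vc vbad]|noD] :=
      pickP (fun v => (psi v == c) && (psi v != chi (f v))); last first.
    by left; apply: big1 => v _; rewrite noD.
  have [w /andP[/eqP wc wbad]|noD'] :=
      pickP (fun v => (chi (f v) == c) && (psi v != chi (f v))); last first.
    by right; apply: big1 => w _; rewrite noD'.
  pose f' := [ffun x => f (tperm v w x)].
  have f'_inj : injectiveb f'.
    by apply/injectiveP => x y; rewrite !ffunE => /f_inj/perm_inj.
  have := f_min f' f'_inj; rewrite leqNgt => /negP; case.
  apply: proper_card; apply/properP; split; last first.
    by exists v; rewrite !inE ?vbad// ffunE tpermL vc wc eqxx.
  apply/fintype.subsetP => x; rewrite !inE ffunE.
  case: tpermP => [->|->|//]; first by rewrite vc wc eqxx.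
  by rewrite wbad.
have D_ge0 c : 0 <= D c by exact: sumr_ge0.
have D_le c : D c <= d.
  have := close c; rewrite sizeD ler_norml => /andP[_].
  by case: (D_or c) => -> //; rewrite subr0.
apply: (@le_trans _ _ (\sum_c D c)).
  rewrite /D exchange_big; apply: ler_sum => v _.
  by rewrite (bigD1 (psi v))//= eqxx lerDl sumr_ge0.
by rewrite -sumr_const_card; apply: ler_sum => c _.
Qed.

Lemma sum_over_triples (V : finType) (d : V -> R) :
  \sum_a \sum_b \sum_c (d a + (d b + d c)) = 3 * #|V|%:R ^+ 2 * \sum_v d v.
Proof.
under eq_bigr do under eq_bigr do rewrite !big_split /= !sumr_const_card.
under eq_bigr do rewrite !big_split /= !sumr_const_card -!mulr_sumr.
rewrite !big_split /= !sumr_const_card -!mulr_sumr.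
ring.
Qed.

Lemma recoloring_count (V W : finType) (g : W -> W -> W -> bool)
    (psi psi' : V -> W) :
  triple_count (fun a b c => g (psi a) (psi b) (psi c) &&
                          ~~ g (psi' a) (psi' b) (psi' c))
  <= 3 * #|V|%:R ^+ 2 * \sum_v (psi v != psi' v)%:R :> R.
Proof.
pose d v : R := (psi v != psi' v)%:R.
have -> : 3 * #|V|%:R ^+ 2 * \sum_v (psi v != psi' v)%:R =
   \sum_(a : V) \sum_(b : V) \sum_(c : V) (d a + (d b + d c)).
  by rewrite sum_over_triples.
apply: ler_sum => a _; apply: ler_sum => b _; apply: ler_sum => c _; rewrite /d.
have [->|_] := eqVneq (psi a) (psi' a); last first.
  by rewrite /= mulr1n (le_trans (y := 1)) ?lern1 ?leq_b1// lerDl addr_ge0.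
have [->|_] := eqVneq (psi b) (psi' b); last first.
  by rewrite /= mulr0n mulr1n add0r (le_trans (y := 1)) ?lern1 ?leq_b1// lerDl.
have [->|_] := eqVneq (psi c) (psi' c); last first.
  by rewrite /= !mulr0n mulr1n !add0r lern1 leq_b1.
by rewrite andbN /= !mulr0n !addr0.
Qed.

Lemma triples_meeting_complement (V : finType) (h : V -> V -> V -> bool)
    (U : {set V}) :
  (forall a b c, a \in U -> b \in U -> c \in U -> ~~ h a b c) ->
  triple_count h <= 3 * #|V|%:R ^+ 2 * (#|V|%:R - #|U|%:R) :> R.
Proof.
move=> hU; pose d v : R := (v \notin U)%:R.
have sumd : \sum_v d v = #|V|%:R - #|U|%:R.
  rewrite -(cardsC U) natrD addrAC subrr add0r -sum1_card natr_sum.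
  rewrite [RHS]big_mkcond; apply: eq_bigr => v _; rewrite /d inE.
  by case: (v \in U).
have -> : 3 * #|V|%:R ^+ 2 * (#|V|%:R - #|U|%:R) =
   \sum_(a : V) \sum_(b : V) \sum_(c : V) (d a + (d b + d c)).
  by rewrite sum_over_triples sumd.
apply: ler_sum => a _; apply: ler_sum => b _; apply: ler_sum => c _; rewrite /d.
have [aU|_] := boolP (a \in U); last first.
  by rewrite /= mulr1n (le_trans (y := 1)) ?lern1 ?leq_b1// lerDl addr_ge0.
have [bU|_] := boolP (b \in U); last first.
  by rewrite /= mulr0n mulr1n add0r (le_trans (y := 1)) ?lern1 ?leq_b1// lerDl.
have [cU|_] := boolP (c \in U); last first.
  by rewrite /= !mulr0n mulr1n !add0r lern1 leq_b1.
by rewrite (negPf (hU a b c aU bU cU)) /= !mulr0n !addr0.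
Qed.

End Matching.

Section Blowups.
Variables (R : realType) (t : nat) (W : finType) (Lam : R) (xs : W -> R).
Variable g : 'I_t -> W -> W -> W -> bool.
Hypothesis sys : extremal_system Lam xs g.

Local Notation k := (#|W|%:R : R).

(** Random colorings with distribution xs are almost extremal on average. *)
Lemma optimal_coloring_exists i (X : finType) : exists chi : X -> W,
  Lam * #|X|%:R ^+ 3 - 3 * #|X|%:R ^+ 2
  <= triple_count (fun p q r => g i (chi p) (chi q) (chi r)).
Proof.
have xs0 c : 0 <= xs c by exact: ltW (sys_pos sys c).
have := @mean_triple_ge R W X xs xs0 (sys_sum sys) (g i).
rewrite (sys_opt sys) => /(product_mean_exists (fun=> xs0) (fun=> sys_sum sys)).
by move=> [f [_ fP]]; exists f.
Qed.

Lemma near_optimal_classes (d : R) : 0 < d -> exists2 e : R, 0 < e &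
  forall i (X : finType) (chi : X -> W),
    (Lam - e) * #|X|%:R ^+ 3
      <= triple_count (fun p q r => g i (chi p) (chi q) (chi r)) ->
    forall c, `|class_size chi c - xs c * #|X|%:R| <= d * #|X|%:R.
Proof.
move=> d0; have [e e0 eP] := sys_stable sys d0; exists e => // i X chi D c.
rewrite triple_count_classes in D.
have := eP i (class_size chi) (class_size_ge0 R chi).
by rewrite sum_class_size => /(_ D c).
Qed.

(** A transversal of the classes of psi that meets no missing triple embeds the
    i-th pattern in the j-th one. *)
Lemma blowups_far_apart : exists2 e : R, 0 < e &
  forall i j (V : finType) (psi psi' : V -> W), (0 < #|V|)%N ->
    (Lam - e) * #|V|%:R ^+ 3
      <= triple_count (fun a b c => g i (psi a) (psi b) (psi c)) ->
    triple_count (fun a b c => g i (psi a) (psi b) (psi c) &&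
                            ~~ g j (psi' a) (psi' b) (psi' c))
      <= e * #|V|%:R ^+ 3 ->
    i = j.
Proof.
have [beta [eta0 [b0 eta0_gt0 large]]] := classes_large sys.
have A0 : 0 <= k ^+ 3 / beta ^+ 3 by rewrite divr_ge0 ?exprn_ge0 ?(ltW b0).
have [th /andP[th0 th1] thA] := small_pos_exists A0.
exists (Num.min th eta0); first by rewrite lt_min th0.
move=> i j V psi psi' V0 D M.
have m1 : Num.min th eta0 <= th by rewrite ge_min lexx.
have m2 : Num.min th eta0 <= eta0 by rewrite ge_min lexx orbT.
have n3 : 0 <= #|V|%:R ^+ 3 :> R by rewrite exprn_ge0.
have [||||||||T [TW _ _ T3]] := @transversal_exists R V W psi beta b0 V0
    _ (fun=> 0) (fun _ _ => 0)
    (fun a b c => (g i (psi a) (psi b) (psi c) &&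
                ~~ g j (psi' a) (psi' b) (psi' c))%:R) 0 0 th => //.
- apply: (large i); apply: le_trans D; rewrite ler_wpM2r//.
  by rewrite lerD2l lerN2.
- by rewrite big1// mul0r.
- by rewrite big1 ?mul0r// => a _; rewrite big1.
- by apply: (le_trans M); rewrite ler_wpM2r.
- by rewrite !mul0r !mulr0 !add0r mulrCA.
have hom a b c : g i a b c -> g j (psi' (T a)) (psi' (T b)) (psi' (T c)).
  move=> gabc; have [ab ac bc] := triple_system_neq (sys_triple sys i) gabc.
  have := T3 a b c ab ac bc; rewrite !TW gabc /=.
  by case: (g j _ _ _) => //=; rewrite ltxx.
apply: (sys_rigid sys _ hom) => a b sab; apply/eqP; apply: contraT.
move=> /(sys_cover sys i)[c /hom]; rewrite sab.
by have [_ _ ->] := sys_triple sys j.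
Qed.

Variables (L : nat) (e0 : R) (u0 : nat).
Hypothesis dense : has_dense_parts Lam g L e0 u0.

(** After the deletion of few vertices a nearly extremal h is contained in a
    blowup of a pattern; as the two have almost the same number of triples,
    they almost coincide, and the classes have nearly optimal sizes. *)
Theorem near_extremal_coloring (d : R) : 0 < d -> exists (e : R) (N0 : nat),
  0 < e /\ forall (V : finType) (h : V -> V -> V -> bool),
  is_triple_system h -> locally_colorable g L h -> (N0 <= #|V|)%N ->
  (Lam - e) * #|V|%:R ^+ 3 <= triple_count h ->
  exists i psi,
    [/\ triple_count (fun a b c => h a b c && ~~ g i (psi a) (psi b) (psi c))
          <= d * #|V|%:R ^+ 3,
        triple_count (fun a b c => g i (psi a) (psi b) (psi c) && ~~ h a b c)
          <= d * #|V|%:R ^+ 3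
      & forall c, `|class_size psi c - xs c * #|V|%:R| <= d * #|V|%:R].
Proof.
move=> d0; have [e1 e1_gt0 e1P] := near_optimal_classes d0.
pose d1 := Num.min d e1 / 6.
have m0 : 0 < Num.min d e1 by rewrite lt_min d0.
have d1_gt0 : 0 < d1 by rewrite divr_gt0.
have d1d : 6 * d1 <= d by rewrite /d1 [6 * _]mulrC divfK ?pnatr_eq0// ge_min lexx.
have d1e : 6 * d1 <= e1 by rewrite /d1 [6 * _]mulrC divfK ?pnatr_eq0// ge_min lexx orbT.
have [e2 [N0 [e2_gt0 e2P]]] := large_colored_part sys dense d1_gt0.
pose e := Num.min e2 (3 * d1).
have ee2 : e <= e2 by rewrite ge_min lexx.
have ed1 : e <= 3 * d1 by rewrite ge_min lexx orbT.
exists e, N0; split; first by rewrite lt_min e2_gt0 mulr_gt0.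
move=> V h hsys loc Vn hV; set n : R := #|V|%:R in hV *.
have n3 : 0 <= n ^+ 3 by rewrite exprn_ge0.
have [|U [i [psi [col UV]]]] := e2P V h hsys loc Vn.
  apply: le_trans hV; rewrite ler_wpM2r//.
  by rewrite lerD2l lerN2.
exists i, psi.
pose hg a b c := h a b c && ~~ g i (psi a) (psi b) (psi c).
pose gh a b c := g i (psi a) (psi b) (psi c) && ~~ h a b c.
have hg_le : triple_count hg <= 3 * d1 * n ^+ 3.
  have := @triples_meeting_complement R V hg U.
  move=> /(_ _)/le_trans; apply.
    move=> a b c aU bU cU; rewrite /hg negb_and negbK.
    by case habc: (h a b c) => //=; apply: col.
  have : 3 * n ^+ 2 * (n - #|U|%:R) <= 3 * n ^+ 2 * (d1 * n).
    by rewrite ler_wpM2l ?mulr_ge0 ?exprn_ge0//; move: UV; rewrite -/n; lra.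
  move=> /le_trans; apply.
  by rewrite le_eqVlt; apply/orP; left; apply/eqP; ring.
have split_count : triple_count h + triple_count gh =
    triple_count (fun a b c => g i (psi a) (psi b) (psi c)) + triple_count hg :> R.
  rewrite -!big_split; apply: eq_bigr => a _.
  rewrite -!big_split; apply: eq_bigr => b _.
  rewrite -!big_split; apply: eq_bigr => c _ /=.
  rewrite /gh /hg; case: (h a b c); case: (g i _ _ _);
  by rewrite /= ?addr0 ?add0r.
have gle := colored_triple_count_le sys i psi.
have gh0 : 0 <= triple_count gh :> R by exact: triple_count_ge0.
have en : e * n ^+ 3 <= 3 * d1 * n ^+ 3 by rewrite ler_wpM2r.
have dn : 6 * d1 * n ^+ 3 <= d * n ^+ 3 by rewrite ler_wpM2r.
have d1n : 0 <= d1 * n ^+ 3 by rewrite mulr_ge0// ltW.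
split.
- by apply: (le_trans hg_le); move: dn d1n; lra.
- move: gle split_count hV hg_le en dn; rewrite -/n -/(triple_count gh); lra.
- apply: (e1P i).
  have d1en : 6 * d1 * n ^+ 3 <= e1 * n ^+ 3 by rewrite ler_wpM2r.
  move: split_count hV hg_le en d1en gh0; rewrite -/n; lra.
Qed.

End Blowups.

(** * Patterns with two hubs *)

Section HubPattern.
Variable A : finType.

Definition cycle_adj (s : A -> A) a b := (b == s a) || (a == s b).

(** The vertices None and Some None are the two hubs.  Every pair of vertices lies
    in an edge, and s matters only for the edges that contain the first hub but not
    the second one; this makes the cubic form a function of the weights of the hubs
    and of three sums over the other vertices. *)
Definition hub_pattern (s : A -> A) (u v w : option (option A)) : bool :=
  match u, v, w with
  | None, Some None, Some (Some _) | None, Some (Some _), Some None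
  | Some None, None, Some (Some _) | Some None, Some (Some _), None
  | Some (Some _), None, Some None | Some (Some _), Some None, None => true
  | None, Some (Some a), Some (Some b) | Some (Some a), None, Some (Some b)
  | Some (Some a), Some (Some b), None => (a != b) && ~~ cycle_adj s a b
  | Some None, Some (Some a), Some (Some b)
  | Some (Some a), Some None, Some (Some b)
  | Some (Some a), Some (Some b), Some None => a != b
  | _, _, _ => false
  end.

Lemma cycle_adjC s a b : cycle_adj s a b = cycle_adj s b a.
Proof. by rewrite /cycle_adj orbC. Qed.

Lemma hub_pattern_triple_system s : is_triple_system (hub_pattern s).
Proof.
by split; [move=> [[a|]|] [[b|]|] [[c|]|] | move=> [[a|]|] [[b|]|] [[c|]|]
  | move=> [[a|]|] [[b|]|]] => //=; rewrite ?eqxx 1?eq_sym 1?cycle_adjC.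
Qed.

Lemma hub_pattern_cover s u v : (0 < #|A|)%N -> u != v ->
  exists w, hub_pattern s u v w.
Proof.
move=> /card_gt0P[a0 _]; case: u v => [[a|]|] [[b|]|]// ab.
- by exists (Some None).
- by exists None.
- by exists (Some None).
- by exists None.
- by exists (Some (Some a0)).
- by exists (Some None).
- by exists (Some (Some a0)).
Qed.

Lemma big_option (R : Type) (idx : R) (op : Monoid.com_law idx) (T : finType)
    (F : option T -> R) :
  \big[op/idx]_o F o = op (F None) (\big[op/idx]_x F (Some x)).
Proof.
rewrite (bigD1 None)//=; congr (op _ _).
rewrite (reindex_omap Some id) => [|[x|]]//=.
by apply: eq_bigl => x; rewrite eqxx.
Qed.

Section Form.
Variables (R : realFieldType) (s : A -> A).
Hypotheses (s_inj : injective s) (s_neq : forall a, s a != a)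
  (ss_neq : forall a, s (s a) != a).

Lemma cycle_adj_irr a : cycle_adj s a a = false.
Proof. by rewrite /cycle_adj orbb eq_sym (negPf (s_neq a)). Qed.

Lemma cycle_adj_nat a b :
  (cycle_adj s a b)%:R = (b == s a)%:R + (a == s b)%:R :> R.
Proof.
rewrite /cycle_adj; case: eqP => [->|_] /=; last by rewrite add0r.
by rewrite eq_sym (negPf (ss_neq a)) addr0.
Qed.

Let sum_eq (F : A -> R) b : \sum_a (a == b)%:R * F a = F b.
Proof.
rewrite (bigD1 b)//= eqxx mul1r big1 ?addr0// => a /negPf ->.
by rewrite mul0r.
Qed.

Lemma sum_cycle_adj (x : A -> R) :
  \sum_a \sum_b (cycle_adj s a b)%:R * (x a * x b) = 2 * \sum_a x a * x (s a).
Proof.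
have e1 : \sum_a \sum_b (b == s a)%:R * (x a * x b) = \sum_a x a * x (s a).
  by apply: eq_bigr => a _; rewrite (sum_eq (fun b => x a * x b)).
have e2 : \sum_a \sum_b (a == s b)%:R * (x a * x b) = \sum_a x a * x (s a).
  rewrite exchange_big -e1; apply: eq_bigr => a _; apply: eq_bigr => b _.
  by rewrite (mulrC (x a)).
have -> : 2 * \sum_a x a * x (s a) = \sum_a x a * x (s a) + \sum_a x a * x (s a).
  by ring.
rewrite -{1}e1 -e2 -big_split; apply: eq_bigr => a _.
by rewrite -big_split; apply: eq_bigr => b _; rewrite cycle_adj_nat mulrDl.
Qed.

Lemma sum_neq (x : A -> R) :
  \sum_a \sum_b (a != b)%:R * (x a * x b)
  = (\sum_a x a) ^+ 2 - \sum_a x a ^+ 2.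
Proof.
rewrite expr2 mulr_suml -sumrB; apply: eq_bigr => a _.
rewrite mulr_sumr expr2 -(sum_eq (fun b => x a * x b) a) -sumrB.
apply: eq_bigr => b _; rewrite eq_sym.
by case: (b == a) => /=; rewrite ?(mul0r, mul1r, subrr, subr0).
Qed.

Lemma sum_nonadj (x : A -> R) :
  \sum_a \sum_b ((a != b) && ~~ cycle_adj s a b)%:R * (x a * x b)
  = (\sum_a x a) ^+ 2 - \sum_a x a ^+ 2 - 2 * \sum_a x a * x (s a).
Proof.
rewrite -sum_neq -sum_cycle_adj -sumrB; apply: eq_bigr => a _.
rewrite -sumrB; apply: eq_bigr => b _; rewrite -mulrBl.
congr (_ * _); have [->|_] /= := eqVneq a b.
  by rewrite cycle_adj_irr subr0.
by case: cycle_adj; rewrite /= ?subrr ?subr0.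
Qed.

Lemma cubic_form_hub (x : option (option A) -> R) :
  let y := x None in let z := x (Some None) in
  let X a := x (Some (Some a)) in
  let S := \sum_a X a in let p := \sum_a X a ^+ 2 in
  let r := \sum_a X a * X (s a) in
  cubic_form (hub_pattern s) x
  = 3 * y * (S ^+ 2 - p - 2 * r) + 3 * z * (S ^+ 2 - p) + 6 * y * z * S.
Proof.
move=> y z X S p r.
rewrite -(sum_nonadj X) -(sum_neq X).
set Q := \sum_a \sum_b _; set E := \sum_a \sum_b _.
have zeroR (T : finType) (F : T -> R) : \sum_a 0 * F a = 0.
  by rewrite big1// => a _; rewrite mul0r.
have Y : \sum_v \sum_w (hub_pattern s None v w)%:R * (x v * x w)
    = 2 * z * S + Q.
  rewrite !big_option /= !(zeroR, mul0r, add0r, mul1r).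
  under [X in _ + X = _]eq_bigr do rewrite !big_option /= !(mul0r, add0r, mul1r).
  rewrite big_split /= -mulr_suml -!mulr_sumr -/S -/z.
  rewrite (_ : \sum_i \sum_j _ = Q) //; ring.
have Z : \sum_v \sum_w (hub_pattern s (Some None) v w)%:R * (x v * x w)
    = 2 * y * S + E.
  rewrite !big_option /= !(zeroR, mul0r, add0r, addr0, mul1r).
  under [X in _ + X = _]eq_bigr do rewrite !big_option /= !(mul0r, add0r, mul1r).
  rewrite big_split /= -mulr_suml -!mulr_sumr -/S -/y.
  rewrite (_ : \sum_i \sum_j _ = E) //; ring.
have XX a : \sum_v \sum_w (hub_pattern s (Some (Some a)) v w)%:R * (x v * x w)
    = 2 * y * z
      + 2 * y * (\sum_b ((a != b) && ~~ cycle_adj s a b)%:R * X b)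
      + 2 * z * (\sum_b (a != b)%:R * X b).
  pose G v := \sum_w (hub_pattern s (Some (Some a)) v w)%:R * (x v * x w).
  have GX b : G (Some (Some b)) = ((a != b) && ~~ cycle_adj s a b)%:R * (X b * y)
      + (a != b)%:R * (X b * z).
    by rewrite /G !big_option /= !(zeroR, mul0r, add0r, addr0, mul1r).
  have GZ : G (Some None) = z * y + \sum_b (a != b)%:R * (z * X b).
    by rewrite /G !big_option /= !(zeroR, mul0r, add0r, addr0, mul1r).
  have GY : G None
      = y * z + \sum_b ((a != b) && ~~ cycle_adj s a b)%:R * (y * X b).
    by rewrite /G !big_option /= !(zeroR, mul0r, add0r, addr0, mul1r).
  rewrite -/(\sum_v G v) !big_option GY GZ; under eq_bigr do rewrite GX.
  rewrite !big_split /=  !mulr_sumr.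
  have -> : forall F : A -> R, \sum_b 2 * y * F b = \sum_b y * F b + \sum_b y * F b.
    move=> F; rewrite -big_split; apply: eq_bigr => b _ /=; ring.
  have -> : forall F : A -> R, \sum_b 2 * z * F b = \sum_b z * F b + \sum_b z * F b.
    move=> F; rewrite -big_split; apply: eq_bigr => b _ /=; ring.
  have h1 c : \sum_b ((a != b) && ~~ cycle_adj s a b)%:R * (c * X b)
     = \sum_b c * (((a != b) && ~~ cycle_adj s a b)%:R * X b).
    by apply: eq_bigr => b _; rewrite mulrCA.
  have h2 c : \sum_b (a != b)%:R * (c * X b) = \sum_b c * ((a != b)%:R * X b).
    by apply: eq_bigr => b _; rewrite mulrCA.
  have h3 c : \sum_b ((a != b) && ~~ cycle_adj s a b)%:R * (X b * c)
     = \sum_b c * (((a != b) && ~~ cycle_adj s a b)%:R * X b).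
    by apply: eq_bigr => b _; ring.
  have h4 c : \sum_b (a != b)%:R * (X b * c) = \sum_b c * ((a != b)%:R * X b).
    by apply: eq_bigr => b _; ring.
  by rewrite h1 h2 h3 h4; ring.
pose L u := \sum_v \sum_w (hub_pattern s u v w)%:R * (x v * x w).
have -> : cubic_form (hub_pattern s) x = \sum_u x u * L u.
  apply: eq_bigr => u _; rewrite mulr_sumr; apply: eq_bigr => v _.
  by rewrite mulr_sumr; apply: eq_bigr => w _; rewrite mulrCA.
rewrite !big_option [L None]Y [L (Some None)]Z.
under eq_bigr do rewrite [L _]XX.
pose q a := \sum_b ((a != b) && ~~ cycle_adj s a b)%:R * X b.
pose e a := \sum_b (a != b)%:R * X b.
have -> : Q = \sum_a X a * q a.
  apply: eq_bigr => a _; rewrite mulr_sumr; apply: eq_bigr => b _.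
  by rewrite mulrCA.
have -> : E = \sum_a X a * e a.
  apply: eq_bigr => a _; rewrite mulr_sumr; apply: eq_bigr => b _.
  by rewrite mulrCA.
have -> : \sum_a X a * (2 * y * z + 2 * y * q a + 2 * z * e a)
    = 2 * y * z * S + 2 * y * (\sum_a X a * q a) + 2 * z * (\sum_a X a * e a).
  rewrite !mulr_sumr -!big_split; apply: eq_bigr => a _ /=; ring.
move: (\sum_a X a * q a) (\sum_a X a * e a) => Q' E'.
rewrite /= -[x None]/y -[x (Some None)]/z; clearbody y z S.
ring.
Qed.

End Form.
End HubPattern.

(** * Maximising the cubic form of a pattern with two hubs *)

Section HubOptimum.
Variables (R : realType) (mu : R).
Hypotheses (mu_gt0 : 0 < mu) (mu_le : mu <= 1 / 4).

(** The total weight of the vertices other than the hubs at the optimum, for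
    1 / mu such vertices: the root in (0, 1) of the derivative of the cubic that
    remains after maximising over all other parameters. *)
Definition hub_sum : R := (4 * mu + Num.sqrt (3 - 12 * mu + 13 * mu ^+ 2))^-1.
Definition hub_Lam : R := hub_sum * (1 - 2 * mu * hub_sum).

Local Notation S0 := hub_sum.
(* For total weight tau, and weight S of the vertices other than the hubs, the
   best value falls short of hub_Lam * tau ^+ 3 by
   3 / 2 * (S - S0 * tau) ^+ 2 * (kap * S + c0 * tau). *)
Let kap : R := 1 - 4 * mu - mu ^+ 2.
Let c0 : R := 4 * mu + 2 * kap * S0.

Let c32 : 0 <= 3 / 2 :> R. Proof. lra. Qed.

Let rad_gt0 : 0 < 3 - 12 * mu + 13 * mu ^+ 2.
Proof.
rewrite (_ : _ + _ = 13 * mu ^+ 2 + 3 * (1 - 4 * mu)); last by ring.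
by rewrite ltr_pwDl ?mulr_gt0 ?exprn_gt0// mulr_ge0//; move: mu_le; lra.
Qed.

Let q := Num.sqrt (3 - 12 * mu + 13 * mu ^+ 2).

Let q2 : q ^+ 2 = 3 - 12 * mu + 13 * mu ^+ 2.
Proof. by rewrite sqr_sqrtr// ltW. Qed.

Let q_gt0 : 0 < q. Proof. by rewrite sqrtr_gt0. Qed.

Let den_gt0 : 0 < 4 * mu + q. Proof. by rewrite addr_gt0// mulr_gt0. Qed.

Lemma hub_sum_gt0 : 0 < S0. Proof. by rewrite invr_gt0. Qed.

Lemma hub_sum_lt : S0 * (1 + 3 * mu) < 1.
Proof.
rewrite mulrC ltr_pdivrMr// mul1r -/q.
suff : 1 - mu < q by lra.
have h0 : 0 <= 1 - mu by move: mu_le; lra.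
rewrite -ltr_sqr ?nnegrE ?(ltW q_gt0)// q2 -subr_gt0.
rewrite (_ : _ - _ = 2 * ((1 - 2 * mu) * (1 - 3 * mu))); last by ring.
by rewrite !mulr_gt0//; move: mu_le; lra.
Qed.

Lemma hub_sum_root : 1 - 8 * mu * S0 - 3 * kap * S0 ^+ 2 = 0.
Proof.
have d0 : 4 * mu + q != 0 by rewrite gt_eqF.
rewrite /hub_sum -/q.
have -> : 1 - 8 * mu * (4 * mu + q)^-1 - 3 * kap * (4 * mu + q)^-1 ^+ 2
   = (q ^+ 2 - 16 * mu ^+ 2 - 3 * kap) / (4 * mu + q) ^+ 2.
  by field.
by rewrite q2 /kap (_ : _ - _ - _ = 0) ?mul0r//; ring.
Qed.

Lemma hub_sum_lt1 : S0 < 1.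
Proof.
have := hub_sum_lt; have : 0 <= S0 * mu by rewrite mulr_ge0// ltW// hub_sum_gt0.
lra.
Qed.

Lemma hub_Lam_E : hub_Lam = 3 / 2 * S0 ^+ 2 * c0.
Proof.
have r := hub_sum_root.
have -> : 3 / 2 * S0 ^+ 2 * c0
   = S0 * (1 - 2 * mu * S0) - S0 * (1 - 8 * mu * S0 - 3 * kap * S0 ^+ 2).
  by rewrite /c0; field.
by rewrite r mulr0 subr0.
Qed.

Lemma hub_Lam_gt0 : 0 < hub_Lam.
Proof.
rewrite mulr_gt0 ?hub_sum_gt0// subr_gt0.
have := hub_sum_lt; have : 0 <= S0 * mu by rewrite mulr_ge0// ltW// hub_sum_gt0.
have := hub_sum_gt0; lra.
Qed.

Lemma hub_Lam_lt1 : hub_Lam < 1.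
Proof.
apply: le_lt_trans hub_sum_lt1; rewrite ler_piMr ?(ltW hub_sum_gt0)//.
by rewrite gerBl !mulr_ge0// ltW// hub_sum_gt0.
Qed.

Lemma hub_slope (S tau : R) : 0 <= S -> S <= tau ->
  2 * mu * tau <= kap * S + c0 * tau.
Proof.
move=> S_ge0 S_le; have s0 := hub_sum_gt0; have s1 := hub_sum_lt1.
have tau0 : 0 <= tau by apply: le_trans S_le.
have t1 : 0 <= S + 2 * S0 * tau by rewrite addr_ge0// !mulr_ge0// ltW.
have t3 : S + 2 * S0 * tau <= 3 * tau.
  have : S0 * tau <= 1 * tau by rewrite ler_wpM2r// ltW.
  by move: S_le; lra.
rewrite (_ : kap * S + c0 * tau = 4 * mu * tau + kap * (S + 2 * S0 * tau));
  last by rewrite /c0; ring.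
have mt : 0 <= mu * tau by rewrite mulr_ge0// ltW.
have [k0|k0] := leP 0 kap.
  have : 0 <= kap * (S + 2 * S0 * tau) by rewrite mulr_ge0.
  by move: mt; lra.
have : kap * (3 * tau) <= kap * (S + 2 * S0 * tau) by rewrite ler_wnM2l// ltW.
have : 0 <= (2 * mu + 3 * kap) * tau.
  rewrite mulr_ge0//.
  rewrite (_ : _ + _ = 1 / 4 + (5 / 2 - 10 * mu) + (1 / 4 - 3 * mu ^+ 2));
    last by rewrite /kap; field.
  have : mu ^+ 2 <= 1 / 4 * (1 / 4) by rewrite expr2 ler_pM// ltW.
  by move: mu_le; lra.
by lra.
Qed.

(** If z <= y, the form may increase with p for a fixed value of p + r.  The bound
    on p + r compensates for this, and a gap of order S^3 to the maximum
    remains. *)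
Lemma hub_deficit_small (y z S p r tau : R) :
  0 <= y -> 0 <= z -> 0 <= S -> 0 <= r -> tau = y + z + S ->
  2 * mu * S ^+ 2 <= p + r -> z <= y ->
  3 * y * (S ^+ 2 - p - 2 * r) + 3 * z * (S ^+ 2 - p) + 6 * y * z * S
    + 3 / 2 * ((S - S0 * tau) ^+ 2 * (kap * S + c0 * tau))
    + 3 / 2 * mu ^+ 2 * S ^+ 3
  <= hub_Lam * tau ^+ 3.
Proof.
move=> y0 z0 S_ge0 r0 tauE pr zy; rewrite -subr_ge0.
have rel := hub_sum_root.
rewrite (_ : _ - _ = 3 * (y - z) * r + 3 * (y + z) * (p + r - 2 * mu * S ^+ 2)
   + 3 / 2 * S * (z - y) ^+ 2
   - 3 / 2 * S * tau ^+ 2 * (1 - 8 * mu * S0 - 3 * kap * S0 ^+ 2)); last first.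
  by rewrite hub_Lam_E tauE /c0 /kap; field.
rewrite rel mulr0 subr0.
have zy0 : 0 <= y - z by rewrite subr_ge0.
have pr0 : 0 <= p + r - 2 * mu * S ^+ 2 by rewrite subr_ge0.
have sq0 : 0 <= 3 / 2 * S * (z - y) ^+ 2.
  by rewrite mulr_ge0 ?sqr_ge0// mulr_ge0.
by rewrite addr_ge0// addr_ge0// mulr_ge0// mulr_ge0// addr_ge0.
Qed.

(** Modulo the critical point equation this is an identity.  For y < z the last
    four summands are nonnegative in the range of interest, and the first three of
    them bound the distances of S, z - y and p from their optimal values. *)
Lemma hub_deficit_large (y z S p r tau : R) :
  tau = y + z + S ->
  hub_Lam * tau ^+ 3
  = 3 * y * (S ^+ 2 - p - 2 * r) + 3 * z * (S ^+ 2 - p) + 6 * y * z * S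
    + 3 / 2 * ((S - S0 * tau) ^+ 2 * (kap * S + c0 * tau))
    + 3 / 2 * S * (z - y - mu * S) ^+ 2
    + 3 * (z - y) * (p - mu * S ^+ 2) + 6 * y * (p + r - 2 * mu * S ^+ 2).
Proof.
move=> tauE; have rel := hub_sum_root; apply/eqP; rewrite -subr_eq0; apply/eqP.
rewrite (_ : _ - _ =
   - 3 / 2 * S * tau ^+ 2 * (1 - 8 * mu * S0 - 3 * kap * S0 ^+ 2)).
  by rewrite rel mulr0.
by rewrite hub_Lam_E tauE /c0 /kap; field.
Qed.

Lemma hub_bound (y z S p r tau : R) :
  0 <= y -> 0 <= z -> 0 <= S -> 0 <= r -> tau = y + z + S ->
  mu * S ^+ 2 <= p -> 2 * mu * S ^+ 2 <= p + r ->
  3 * y * (S ^+ 2 - p - 2 * r) + 3 * z * (S ^+ 2 - p) + 6 * y * z * S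
  <= hub_Lam * tau ^+ 3.
Proof.
move=> y0 z0 S_ge0 r0 tauE p1 pr.
have Stau : S <= tau by rewrite tauE; move: y0 z0; lra.
have sl : 0 <= kap * S + c0 * tau.
  apply: le_trans (hub_slope S_ge0 Stau).
  by rewrite !mulr_ge0 ?(ltW mu_gt0)// (le_trans S_ge0).
have h1 : 0 <= 3 / 2 * ((S - S0 * tau) ^+ 2 * (kap * S + c0 * tau)).
  by rewrite mulr_ge0// mulr_ge0// sqr_ge0.
have m2 : 0 <= mu ^+ 2 by exact: sqr_ge0.
have S3 : 0 <= S ^+ 3 by exact: exprn_ge0.
have [zy|yz] := leP z y.
  apply: le_trans (hub_deficit_small y0 z0 S_ge0 r0 tauE pr zy).
  have h2 : 0 <= 3 / 2 * mu ^+ 2 * S ^+ 3 by rewrite mulr_ge0// mulr_ge0.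
  by apply: ler_wpDr => //; apply: ler_wpDr.
rewrite (hub_deficit_large p r tauE).
have h2 : 0 <= 3 / 2 * S * (z - y - mu * S) ^+ 2.
  by rewrite mulr_ge0 ?sqr_ge0// mulr_ge0.
have h3 : 0 <= 3 * (z - y) * (p - mu * S ^+ 2).
  by rewrite !mulr_ge0 ?subr_ge0// ltW.
have h4 : 0 <= 6 * y * (p + r - 2 * mu * S ^+ 2).
  by rewrite !mulr_ge0 ?subr_ge0.
by do 4 (apply: ler_wpDr => //).
Qed.

Let norm_le_of_sqr (x r : R) : 0 <= r -> x ^+ 2 <= r ^+ 2 -> `|x| <= r.
Proof. by move=> r0 xr; rewrite -ler_sqr ?nnegrE// real_normK ?num_real. Qed.

(** The first term of the minimum makes the summands of the deficit small; the
    second one rules out that z <= y. *)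
Lemma hub_stability (d y z S p r : R) :
  0 < d -> d <= mu * S0 / 4 ->
  0 <= y -> 0 <= z -> 0 <= S -> 0 <= r -> 1 = y + z + S ->
  mu * S ^+ 2 <= p -> 2 * mu * S ^+ 2 <= p + r ->
  hub_Lam - Num.min (3 / 4 * mu * S0 * d ^+ 2) (1 / 8 * mu ^+ 2 * S0 ^+ 3)
  <= 3 * y * (S ^+ 2 - p - 2 * r) + 3 * z * (S ^+ 2 - p) + 6 * y * z * S ->
  [/\ `|S - S0| <= d, `|z - y - mu * S| <= d & p - mu * S ^+ 2 <= d ^+ 2].
Proof.
move=> d0 dle y0 z0 S_ge0 r0 tauE p1 pr.
set e := Num.min _ _; set P := (X in _ <= X) => PL.
have s0 := hub_sum_gt0; have s1 := hub_sum_lt1.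
have e1 : e <= 3 / 4 * mu * S0 * d ^+ 2 by rewrite ge_min lexx.
have e2 : e <= 1 / 8 * mu ^+ 2 * S0 ^+ 3 by rewrite ge_min lexx orbT.
have d2 : 0 < d ^+ 2 by rewrite exprn_gt0.
have m2 : 0 < mu ^+ 2 by rewrite exprn_gt0.
have S03 : 0 < S0 ^+ 3 by rewrite exprn_gt0.
have S3 : 0 <= S ^+ 3 by rewrite exprn_ge0.
have Stau : S <= 1 by rewrite tauE; move: y0 z0; lra.
have sl := hub_slope S_ge0 Stau.
have sl0 : 0 <= kap * S + c0 * 1.
  by apply: le_trans sl; rewrite !mulr_ge0// ltW.
have h1 : 0 <= 3 / 2 * ((S - S0 * 1) ^+ 2 * (kap * S + c0 * 1)).
  by rewrite mulr_ge0// mulr_ge0// sqr_ge0.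
have [defS def2] : 3 / 2 * ((S - S0 * 1) ^+ 2 * (kap * S + c0 * 1)) <= e /\
    (z <= y -> 3 / 2 * mu ^+ 2 * S ^+ 3 <= e).
  have [zy|yz] := leP z y.
    have := hub_deficit_small y0 z0 S_ge0 r0 tauE pr zy.
    have : 0 <= 3 / 2 * mu ^+ 2 * S ^+ 3 by rewrite mulr_ge0// mulr_ge0// ltW.
    by move=> *; split=> [|_]; move: PL; rewrite /P; lra.
  have := hub_deficit_large p r tauE.
  have : 0 <= 3 / 2 * S * (z - y - mu * S) ^+ 2.
    by rewrite mulr_ge0 ?sqr_ge0// mulr_ge0.
  have : 0 <= 3 * (z - y) * (p - mu * S ^+ 2).
    by rewrite !mulr_ge0 ?subr_ge0// ltW.
  have : 0 <= 6 * y * (p + r - 2 * mu * S ^+ 2).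
    by rewrite !mulr_ge0 ?subr_ge0.
  by move=> *; split=> //; move: PL; rewrite /P; lra.
have near : `|S - S0| <= d.
  apply: norm_le_of_sqr; first exact: ltW.
  have k1 : 3 * mu * (S - S0) ^+ 2 <= e.
    apply: le_trans defS; rewrite !mulr1.
    rewrite (_ : 3 * mu * _ = 3 / 2 * ((S - S0) ^+ 2 * (2 * mu * 1))); last by field.
    rewrite ler_wpM2l// ler_wpM2l ?sqr_ge0//.
    by move: sl; rewrite !mulr1.
  have k2 : 3 / 4 * mu * S0 * d ^+ 2 <= 3 * mu * d ^+ 2.
    rewrite ler_wpM2r ?(ltW d2)//.
    have : mu * S0 <= mu by rewrite ler_piMr// ltW.
    by move: mu_gt0; lra.
  have m3 : 0 < 3 * mu by rewrite mulr_gt0.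
  by rewrite -(ler_pM2l m3); apply: (le_trans k1); apply: (le_trans e1).
have mS0 : mu * S0 <= 1 / 4 * S0 by rewrite ler_wpM2r// ltW.
have Shalf : S0 / 2 <= S.
  by move: near; rewrite ler_norml => /andP[+ _]; move: dle mS0 s0; lra.
have yz : y < z.
  rewrite ltNge; apply/negP => /def2 h.
  have : (S0 / 2) ^+ 3 <= S ^+ 3.
    by rewrite lerXn2r ?nnegrE//; move: s0; lra.
  have -> : (S0 / 2) ^+ 3 = S0 ^+ 3 / 8 by field.
  move=> /(ler_wpM2l (ltW m2)) h'.
  have : 0 < mu ^+ 2 * S0 ^+ 3 by rewrite mulr_gt0.
  by move: h h' e2; lra.
have defL := hub_deficit_large p r tauE.
have h2 : 0 <= 3 / 2 * S * (z - y - mu * S) ^+ 2.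
  by rewrite mulr_ge0 ?sqr_ge0// mulr_ge0.
have h3 : 0 <= 3 * (z - y) * (p - mu * S ^+ 2).
  by rewrite !mulr_ge0 ?subr_ge0// ltW.
have h4 : 0 <= 6 * y * (p + r - 2 * mu * S ^+ 2).
  by rewrite !mulr_ge0 ?subr_ge0.
have zy : `|z - y - mu * S| <= d.
  apply: norm_le_of_sqr; first exact: ltW.
  have k1 : 3 / 2 * S * (z - y - mu * S) ^+ 2 <= e.
    by move: PL defL h1 h3 h4; rewrite /P; lra.
  have k2 : 3 / 4 * S0 * (z - y - mu * S) ^+ 2 <= 3 / 2 * S * (z - y - mu * S) ^+ 2.
    by rewrite ler_wpM2r ?sqr_ge0//; move: Shalf; lra.
  have k3 : 3 / 4 * mu * S0 * d ^+ 2 <= 3 / 4 * S0 * d ^+ 2.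
    by rewrite ler_wpM2r ?(ltW d2)//; move: mS0 s0; lra.
  have m3 : 0 < 3 / 4 * S0 by rewrite mulr_gt0// divr_gt0.
  rewrite -(ler_pM2l m3); apply: (le_trans k2); apply: (le_trans k1).
  exact: (le_trans e1).
split=> //.
have k1 : 3 * (z - y) * (p - mu * S ^+ 2) <= e.
  by move: PL defL h1 h2 h4; rewrite /P; lra.
have k2 : mu * S0 / 4 <= z - y.
  move: zy; rewrite ler_norml => /andP[+ _].
  have : mu * (S0 / 2) <= mu * S by rewrite ler_wpM2l// ltW.
  by move: dle; lra.
have p0 : 0 <= p - mu * S ^+ 2 by rewrite subr_ge0.
have k3 : mu * S0 / 4 * (p - mu * S ^+ 2) <= (z - y) * (p - mu * S ^+ 2).
  by rewrite ler_wpM2r.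
have m3 : 0 < mu * S0 / 4 by rewrite divr_gt0// mulr_gt0.
by rewrite -(ler_pM2l m3); move: k1 k3 e1; lra.
Qed.
End HubOptimum.

(** * The extremal system of the patterns with two hubs *)

Section HubSystem.
Variables (R : realType) (A : finType) (t : nat) (s : 'I_t -> A -> A).
Hypotheses (A_ge4 : (4 <= #|A|)%N) (s_inj : forall i, injective (s i))
  (s_neq : forall i a, s i a != a) (ss_neq : forall i a, s i (s i a) != a).
Hypothesis s_rigid : forall i j (pi : A -> A), injective pi ->
  (forall a b, cycle_adj (s i) a b = cycle_adj (s j) (pi a) (pi b)) -> i = j.

Let m : R := #|A|%:R.
Let mu : R := m^-1.
Let m_gt0 : 0 < m. Proof. by rewrite ltr0n; apply: leq_trans A_ge4. Qed.
Let mu_gt0 : 0 < mu. Proof. by rewrite invr_gt0. Qed.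
Let mmu : m * mu = 1. Proof. by rewrite divff// gt_eqF. Qed.
Let mu_le : mu <= 1 / 4.
Proof. by rewrite mul1r lef_pV2 ?posrE// ler_nat. Qed.

Local Notation S0 := (hub_sum mu).

Definition hub_weight (c : option (option A)) : R :=
  match c with
  | None => (1 - S0 - mu * S0) / 2
  | Some None => (1 - S0 + mu * S0) / 2
  | Some (Some _) => mu * S0
  end.

Let muS0_gt0 : 0 < mu * S0.
Proof. by rewrite mulr_gt0// hub_sum_gt0. Qed.

Lemma hub_weight_order a :
  hub_weight (Some (Some a)) < hub_weight None < hub_weight (Some None).
Proof.
have := hub_sum_lt mu_gt0 mu_le; move: muS0_gt0 => /= h1 h2.
by apply/andP; split; lra.
Qed.

Let sum_const (x : R) : \sum_(a : A) x = m * x.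
Proof. by rewrite sumr_const_card. Qed.

Lemma square_sum_ge (X : A -> R) :
  \sum_a X a ^+ 2 - mu * (\sum_a X a) ^+ 2 = \sum_a (X a - mu * \sum_a X a) ^+ 2.
Proof.
have -> : forall c, \sum_a (X a - mu * c) ^+ 2
  = \sum_a X a ^+ 2 - 2 * (mu * c) * (\sum_a X a) + m * (mu * c) ^+ 2.
  move=> c; rewrite -sum_const mulr_sumr -sumrB -big_split.
  by apply: eq_bigr => a _ /=; ring.
move: (\sum_a X a) => S.
rewrite (_ : m * (mu * S) ^+ 2 = (m * mu) * mu * S ^+ 2); last by ring.
by rewrite mmu; ring.
Qed.

(** By Cauchy-Schwarz for the sums X a + X (s i a) of consecutive values. *)
Lemma cycle_sum_ge i (X : A -> R) :
  2 * mu * (\sum_a X a) ^+ 2 <= \sum_a X a ^+ 2 + \sum_a X a * X (s i a).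
Proof.
rewrite -subr_ge0.
have eS : \sum_a X (s i a) = \sum_a X a by rewrite [RHS](reindex_inj (@s_inj i)).
have eP : \sum_a X (s i a) ^+ 2 = \sum_a X a ^+ 2.
  by rewrite [RHS](reindex_inj (@s_inj i)).
have sq c : \sum_a (X a + X (s i a) - 2 * mu * c) ^+ 2
     = \sum_a X a ^+ 2 + \sum_a X (s i a) ^+ 2 + 2 * (\sum_a X a * X (s i a))
       - 4 * mu * c * (\sum_a X a) - 4 * mu * c * (\sum_a X (s i a))
       + m * (2 * mu * c) ^+ 2.
  rewrite -sum_const !mulr_sumr -!(sumrB, big_split).
  by apply: eq_bigr => a _ /=; ring.
have -> : \sum_a X a ^+ 2 + \sum_a X a * X (s i a) - 2 * mu * (\sum_a X a) ^+ 2
  = (\sum_a (X a + X (s i a) - 2 * mu * (\sum_a X a)) ^+ 2) / 2.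
  rewrite sq eS eP; move: (\sum_a X a) => S.
  rewrite (_ : m * (2 * mu * S) ^+ 2 = 4 * (m * mu) * mu * S ^+ 2); last by ring.
  by rewrite mmu; field.
by rewrite divr_ge0// sumr_ge0// => a _; exact: sqr_ge0.
Qed.

Local Notation g := (fun i => hub_pattern (s i)).
Local Notation Lam := (hub_Lam mu).

Lemma sum_colors (x : option (option A) -> R) :
  \sum_c x c = x None + x (Some None) + \sum_a x (Some (Some a)).
Proof. by rewrite !big_option /= addrA. Qed.

Lemma hub_weight_sum : \sum_c hub_weight c = 1.
Proof.
rewrite sum_colors /= sum_const mulrA mmu; by field.
Qed.

Lemma hub_weight_gt0 c : 0 < hub_weight c.
Proof.
have [a0 _] : exists a0 : A, a0 \in A by apply/card_gt0P; apply: leq_trans A_ge4.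
have /andP[h1 h2] := hub_weight_order a0.
case: c => [[a|]|]; first by [].
  by apply: lt_trans h2; apply: lt_trans h1.
exact: lt_trans h1.
Qed.

Lemma hub_weight_optimal i : cubic_form (g i) hub_weight = Lam.
Proof.
rewrite (cubic_form_hub (@s_neq i) (@ss_neq i)) /= !sum_const.
have := hub_deficit_large mu_gt0 mu_le (y := hub_weight None)
  (z := hub_weight (Some None)) (S := S0) (mu * S0 ^+ 2) (mu * S0 ^+ 2)
  (tau := 1).
rewrite expr1n mulr1 => ->; last by rewrite /=; field.
have e1 : m * (mu * S0) = S0 by rewrite mulrA mmu mul1r.
have e2 : m * (mu * S0) ^+ 2 = mu * S0 ^+ 2.
  by rewrite (_ : m * (mu * S0) ^+ 2 = m * mu * mu * S0 ^+ 2); [rewrite mmu mul1r|ring].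
by rewrite e1 e2 /=; field.
Qed.

Lemma hub_bound_system i x : (forall c, 0 <= x c) ->
  cubic_form (g i) x <= Lam * (\sum_c x c) ^+ 3.
Proof.
move=> x0; rewrite (cubic_form_hub (@s_neq i) (@ss_neq i)) sum_colors /=.
apply: hub_bound => //.
- exact: sumr_ge0.
- by apply: sumr_ge0 => a _; rewrite mulr_ge0.
- rewrite -subr_ge0 square_sum_ge sumr_ge0// => a _; exact: sqr_ge0.
- exact: cycle_sum_ge.
Qed.

Lemma cubic_form_scale (W : finType) (g0 : W -> W -> W -> bool) (a : R) x :
  cubic_form g0 (fun c => a * x c) = a ^+ 3 * cubic_form g0 x.
Proof.
rewrite mulr_sumr; apply: eq_bigr => u _.
rewrite mulr_sumr; apply: eq_bigr => v _.
by rewrite mulr_sumr; apply: eq_bigr => w _; ring.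
Qed.

Lemma hub_stable_normalized d : 0 < d -> exists2 e : R, 0 < e &
  forall i x, (forall c, 0 <= x c) -> \sum_c x c = 1 ->
    Lam - e <= cubic_form (g i) x ->
    forall c, `|x c - hub_weight c| <= d.
Proof.
move=> d0; pose d1 := Num.min (d / 2) (mu * S0 / 4).
have d1_gt0 : 0 < d1 by rewrite lt_min; apply/andP; split; apply: divr_gt0.
have d1d : d1 <= d / 2 by rewrite ge_min lexx.
have d1s : d1 <= mu * S0 / 4 by rewrite ge_min lexx orbT.
exists (Num.min (3 / 4 * mu * S0 * d1 ^+ 2) (1 / 8 * mu ^+ 2 * S0 ^+ 3)).
  have S0_gt0 := hub_sum_gt0 mu_gt0 mu_le.
  by rewrite lt_min; apply/andP; split; do !apply: mulr_gt0 => //; rewrite ?exprn_gt0 ?invr_gt0.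
move=> i x x0; rewrite sum_colors => x1.
rewrite (cubic_form_hub (@s_neq i) (@ss_neq i)) /=.
set y := x None; set z := x (Some None); pose X a := x (Some (Some a)).
set S := \sum_a x (Some (Some a)) => PL.
have X0 : 0 <= S by exact: sumr_ge0.
have [||||nS nzy np] := hub_stability mu_gt0 mu_le d1_gt0 d1s
  (x0 None) (x0 (Some None)) X0 _ _ _ _ PL.
- by apply: sumr_ge0 => a _; rewrite mulr_ge0.
- by rewrite -x1.
- rewrite -subr_ge0 (square_sum_ge X) sumr_ge0// => a _; exact: sqr_ge0.
- exact: (cycle_sum_ge i X).
have nX a : `|X a - mu * S| <= d1.
  rewrite -ler_sqr ?nnegrE ?(ltW d1_gt0)// real_normK ?num_real//.
  apply: le_trans np; rewrite (square_sum_ge X) (bigD1 a)//= lerDl sumr_ge0// => b _.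
  exact: sqr_ge0.
have S0_gt0 := hub_sum_gt0 mu_gt0 mu_le.
have nmuS : `|mu * S - mu * S0| <= d1.
  rewrite -mulrBr normrM ger0_norm ?(ltW mu_gt0)//.
  apply: (@le_trans _ _ (1 * d1)); last by rewrite mul1r.
  by apply: ler_pM => //; rewrite ?(ltW mu_gt0)//; move: mu_le; lra.
have x1' : y + z + S = 1 by [].
move: nS nzy nmuS; rewrite !ler_norml -/y -/z => /andP[a1 a2] /andP[b1 b2] /andP[c1 c2].
case=> [[a|]|]; rewrite ler_norml /=; apply/andP; split.
all: try by move: (nX a); rewrite ler_norml => /andP[]; rewrite /X; move: d1d d1_gt0; lra.
all: rewrite -/y -/z; move: d1d d1_gt0 x1'; lra.
Qed.

Lemma hub_stable d : 0 < d -> exists2 e : R, 0 < e &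
  forall i x, (forall c, 0 <= x c) ->
    (Lam - e) * (\sum_c x c) ^+ 3 <= cubic_form (g i) x ->
    forall c, `|x c - hub_weight c * \sum_c x c| <= d * \sum_c x c.
Proof.
move=> d0; have [e e0 eP] := hub_stable_normalized d0; exists e => // i x x0.
set tau := \sum_c x c => PL c.
have tau0 : 0 <= tau by exact: sumr_ge0.
have [tz|tnz] := eqVneq tau 0.
  have -> : x c = 0.
    apply/eqP; rewrite eq_le x0 andbT -tz /tau (bigD1 c)//= lerDl.
    exact: sumr_ge0.
  by rewrite tz !mulr0 subrr normr0.
have {}tau0 : 0 < tau by rewrite lt_def tnz.
have := eP i (fun c => tau^-1 * x c).
rewrite cubic_form_scale -mulr_sumr mulVf// => /(_ _ erefl _ c) H.
have -> : x c - hub_weight c * tau = tau * (tau^-1 * x c - hub_weight c).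
  by rewrite mulrBr mulrA divff// mul1r mulrC.
rewrite normrM (gtr0_norm tau0) mulrC ler_pM2r//; apply: H.
  by move=> b; rewrite mulr_ge0// invr_ge0 ltW.
by rewrite exprVn mulrC ler_pdivlMr ?exprn_gt0.
Qed.

Lemma card_cycle_adj i :
  #|[set p : A * A | cycle_adj (s i) p.1 p.2]| = (2 * #|A|)%N.
Proof.
have := @sum_cycle_adj A R _ (@ss_neq i) (fun=> 1).
rewrite sum_const !mulr1 => H.
apply/eqP; rewrite -(eqr_nat R) natrM -/m -H.
rewrite -sum1_card natr_sum big_mkcond pair_big; apply/eqP.
by apply: eq_bigr => -[a b] _; rewrite !inE !mulr1; case: cycle_adj.
Qed.

(** The weights of an optimal point tell the two hubs and the remaining
    vertices apart, so an embedding of patterns preserves this partition; on the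
    remaining vertices it is an isomorphism of the graphs of the cycles. *)
Lemma hub_rigid i j (f : option (option A) -> option (option A)) :
  injective f ->
  (forall a b c, g i a b c -> g j (f a) (f b) (f c)) -> i = j.
Proof.
move=> f_inj hom.
have wf c : hub_weight (f c) = hub_weight c.
  pose x c := hub_weight (invF f_inj c).
  have sx : \sum_c x c = 1.
    rewrite -hub_weight_sum [LHS](reindex_inj f_inj).
    by apply: eq_bigr => b _; rewrite /x invF_f.
  have Px : Lam <= cubic_form (g j) x.
    rewrite -(hub_weight_optimal i) /cubic_form.
    rewrite [leRHS](reindex_inj f_inj); apply: ler_sum => u _.
    rewrite [leRHS](reindex_inj f_inj); apply: ler_sum => v _.
    rewrite [leRHS](reindex_inj f_inj); apply: ler_sum => w _.
    rewrite /x !invF_f ler_wpM2r ?mulr_ge0 ?(ltW (hub_weight_gt0 _))//.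
    by have := hom u v w; case: (hub_pattern (s i) u v w) => // ->.
  apply/eqP; rewrite -subr_eq0 -normr_le0 -{1}(invF_f f_inj c) distrC.
  apply/ler_addgt0Pr => d d0; rewrite add0r.
  have [e e0 eP] := hub_stable_normalized d0.
  have := eP j x _ sx _ (f c); rewrite /x invF_f; apply.
    by move=> b; exact: ltW (hub_weight_gt0 _).
  by apply: le_trans Px; rewrite gerBl ltW.
have [a0 _] : exists a0 : A, a0 \in A by apply/card_gt0P; apply: leq_trans A_ge4.
have /andP[lt1 lt2] := hub_weight_order a0.
have fY : f None = None.
  have := wf None; case: (f None) => [[a|]|]// E.
    by have /andP[] := hub_weight_order a; rewrite E ltxx.
  by move: lt2; rewrite E ltxx.
have fX a : exists b, f (Some (Some a)) = Some (Some b).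
  have := wf (Some (Some a)); case: (f _) => [[b|]|] E; first by exists b.
    by have := lt_trans lt1 lt2; rewrite E ltxx.
  by move: lt1; rewrite E ltxx.
have /choice[pi piP] := fX.
have pi_inj : injective pi.
  move=> a b ab; have := f_inj (Some (Some a)) (Some (Some b)).
  by rewrite !piP ab => /(_ erefl) [].
(* The first hub has an edge with each pair that is not adjacent; both graphs
   have the same number of adjacent pairs, so the inclusion is an equality. *)
have sub a b : cycle_adj (s j) (pi a) (pi b) -> cycle_adj (s i) a b.
  have [->|ab] := eqVneq a b; first by rewrite cycle_adj_irr.
  move=> adj; apply: contraT => nadj.
  have := hom None (Some (Some a)) (Some (Some b)).
  by rewrite fY !piP /= ab nadj adj andbF => /(_ isT).
apply: (s_rigid pi_inj) => a b; apply/idP/idP; last exact: sub.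
pose Pi i := [set p : A * A | cycle_adj (s i) p.1 p.2].
pose pi2 (p : A * A) := (pi p.1, pi p.2).
have pi2_inj : injective pi2.
  by move=> [a1 b1] [a2 b2] [/pi_inj -> /pi_inj ->].
have PiE : Pi j = pi2 @: Pi i.
  apply/eqP; rewrite eqEcard card_imset// !card_cycle_adj leqnn andbT.
  apply/fintype.subsetP => -[a' b']; rewrite inE /= => adj.
  apply/imsetP; exists (invF pi_inj a', invF pi_inj b').
    by rewrite inE /=; apply: sub; rewrite !f_invF.
  by rewrite /pi2 /= !f_invF.
move=> adj; have : pi2 (a, b) \in pi2 @: Pi i by rewrite imset_f// inE.
by rewrite -PiE inE.
Qed.

Theorem hub_system : extremal_system Lam hub_weight g.
Proof.
split.
- by move=> i; exact: hub_pattern_triple_system.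
- by move=> i a b; apply: hub_pattern_cover; apply: leq_trans A_ge4.
- by rewrite hub_Lam_gt0//= ltW// hub_Lam_lt1.
- exact: hub_bound_system.
- exact: hub_stable.
- exact: hub_weight_optimal.
- exact: hub_weight_gt0.
- exact: hub_weight_sum.
- exact: hub_rigid.
Qed.

End HubSystem.

(** * Pairs of cycles *)

Section TwoCycles.
Variable m : nat.

(** The permutation of 'I_m with the cycles (0 1 ... l-1) and (l ... m-1). *)
Definition two_cycle (l : nat) (a : 'I_m) : 'I_m :=
  insubd a (if a.+1 == l then 0%N else if a.+1 == m then l else a.+1).

Lemma val_two_cycle l (a : 'I_m) : (l < m)%N ->
  val (two_cycle l a)
  = (if a.+1 == l then 0%N else if a.+1 == m then l else a.+1).
Proof.
move=> lm; rewrite val_insubd; case: ifP => //; have am := ltn_ord a.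
by case: eqP => [|_]; [lia|case: eqP => [|]; lia].
Qed.

Lemma two_cycle_inj l : (l < m)%N -> injective (two_cycle l).
Proof.
move=> lm a b /(congr1 val); rewrite !val_two_cycle// => E; apply: val_inj.
have am := ltn_ord a; have bm := ltn_ord b; move: E => /=.
by do !case: eqP; lia.
Qed.

Lemma two_cycle_neq l a : (l + 3 <= m)%N -> (l == 0%N) || (3 <= l)%N ->
  two_cycle l a != a.
Proof.
move=> lm l3; apply/eqP => /(congr1 val); rewrite val_two_cycle; last by lia.
by have am := ltn_ord a; move=> /=; do !case: eqP; lia.
Qed.

Lemma two_cycle2_neq l a : (l + 3 <= m)%N -> (l == 0%N) || (3 <= l)%N ->
  two_cycle l (two_cycle l a) != a.
Proof.
move=> lm l3; apply/eqP => /(congr1 val); rewrite val_two_cycle; last by lia.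
rewrite val_two_cycle; last by lia.
by have am := ltn_ord a; move=> /=; do !case: eqP; lia.
Qed.

Definition adj_closed (s : 'I_m -> 'I_m) (K : {set 'I_m}) :=
  forall a b, a \in K -> cycle_adj s a b -> b \in K.

Lemma card_ord_below l : (l <= m)%N -> #|[set a : 'I_m | (a < l)%N]| = l.
Proof.
move=> lm; rewrite -sum1_card.
under eq_bigl do rewrite inE.
by rewrite -(big_ord_widen _ (fun=> 1%N) lm) sum1_card card_ord.
Qed.

Lemma card_ord_above l : (l <= m)%N -> #|[set a : 'I_m | (l <= a)%N]| = (m - l)%N.
Proof.
move=> lm; have := cardsC [set a : 'I_m | (a < l)%N].
rewrite card_ord_below// card_ord => H.
rewrite (_ : [set a : 'I_m | (l <= a)%N] = ~: [set a : 'I_m | (a < l)%N]).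
  by lia.
by apply/setP => a; rewrite !inE -leqNgt.
Qed.

Lemma two_cycle_block_closed l : (l < m)%N ->
  adj_closed (two_cycle l) [set a : 'I_m | (a < l)%N].
Proof.
move=> lm a b; rewrite !inE => al /orP[] /eqP/(congr1 val);
  rewrite val_two_cycle//= => E; have am := ltn_ord a; have bm := ltn_ord b.
- by move: E; do !case: eqP; lia.
- by move: E; do !case: eqP; lia.
Qed.

(** A closed set that meets a cycle contains all of it. *)
Lemma card_adj_closed l (K : {set 'I_m}) : (l < m)%N ->
  adj_closed (two_cycle l) K ->
  [\/ #|K| = 0%N, #|K| = l, #|K| = (m - l)%N | #|K| = m].
Proof.
move=> lm closed.
pose P n := if insub n is Some a then a \in K else false.
have PE (a : 'I_m) : P a = (a \in K) by rewrite /P valK.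
have step n : (n < m)%N -> P n ->
    P (if n.+1 == l then 0%N else if n.+1 == m then l else n.+1).
  move=> nm; rewrite (_ : n = Ordinal nm)// -val_two_cycle// !PE => nK.
  by apply: closed nK _; rewrite /cycle_adj eqxx.
have up1 n k : P n -> (n + k < l)%N -> P (n + k)%N.
  elim: k => [|k IH] Pn; first by rewrite addn0.
  rewrite addnS => nkl; have := step (n + k)%N _ (IH Pn _).
  rewrite ifF; last by apply/negbTE; rewrite neq_ltn nkl.
  rewrite ifF; last by apply/negbTE; rewrite neq_ltn (ltn_trans nkl).
  by apply; lia.
have up2 n k : P n -> (l <= n)%N -> (n + k < m)%N -> P (n + k)%N.
  elim: k => [|k IH] Pn ln; first by rewrite addn0.
  rewrite addnS => nkm; have := step (n + k)%N _ (IH Pn ln _).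
  rewrite ifF; last by apply/negbTE; lia.
  rewrite ifF; last by apply/negbTE; lia.
  by apply; lia.
have full1 (a b : 'I_m) : a \in K -> (a < l)%N -> (b < l)%N -> b \in K.
  rewrite -!PE => Pa al bl.
  have Pl : P l.-1 by have := up1 a (l.-1 - a)%N Pa; rewrite subnKC; [apply|]; lia.
  have P0 : P 0%N by have := step l.-1 _ Pl; rewrite prednK ?eqxx; [apply|]; lia.
  by apply: (up1 0%N b P0).
have full2 (a b : 'I_m) : a \in K -> (l <= a)%N -> (l <= b)%N -> b \in K.
  rewrite -!PE => Pa al bl; have am := ltn_ord a; have bm := ltn_ord b.
  have Pm : P m.-1 by have := up2 a (m.-1 - a)%N Pa al; rewrite subnKC; [apply|]; lia.
  have Pl : P l.
    have := step m.-1 _ Pm; rewrite prednK; last by lia.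
    by rewrite ifF ?eqxx; [apply; lia|apply/negbTE; lia].
  by have := up2 l (b - l)%N Pl (leqnn l); rewrite subnKC//; apply.
have [a /andP[aK al]|no1] := pickP (fun a : 'I_m => (a \in K) && (a < l)%N);
have [b /andP[bK bl]|no2] := pickP (fun b : 'I_m => (b \in K) && (l <= b)%N).
- apply: Or44; rewrite -[RHS]card_ord; apply: eq_card => c.
  by rewrite inE; case: (ltnP c l) => cl; [apply: (full1 a)|apply: (full2 b)].
- apply: Or42; rewrite -[RHS](card_ord_below (ltnW lm)); apply: eq_card => c.
  rewrite inE; case: ltnP => cl; first exact: (full1 a).
  by have := no2 c; rewrite cl andbT.
- apply: Or43; rewrite -(card_ord_above (ltnW lm)); apply: eq_card => c.
  rewrite inE; case: leqP => cl; first exact: (full2 b).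
  by have := no1 c; rewrite cl andbT.
- apply: Or41; apply: eq_card0 => c; apply/negbTE/negP => cK.
  by have := no1 c; have := no2 c; rewrite cK /=; case: ltnP.
Qed.

Lemma two_cycle_iso_lengths l l' (pi : 'I_m -> 'I_m) : (l < m)%N -> (l' < m)%N ->
  injective pi ->
  (forall a b, cycle_adj (two_cycle l) a b
             = cycle_adj (two_cycle l') (pi a) (pi b)) ->
  [\/ l = 0%N, l = l' | l = (m - l')%N].
Proof.
move=> lm lm' pi_inj iso.
have closed : adj_closed (two_cycle l') (pi @: [set a : 'I_m | (a < l)%N]).
  move=> _ y /imsetP[a al ->]; rewrite -(f_invF pi_inj y) -iso => adj.
  by rewrite imset_f//; exact: two_cycle_block_closed adj.
have := card_adj_closed lm' closed.
rewrite card_imset// card_ord_below 1?ltnW// => -[->|->|->|lE].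
- exact: Or31.
- exact: Or32.
- exact: Or33.
- by rewrite lE ltnn in lm.
Qed.

Lemma two_cycle_iso l l' (pi : 'I_m -> 'I_m) :
  (2 * l <= m)%N -> (2 * l' <= m)%N -> (0 < m)%N -> injective pi ->
  (forall a b, cycle_adj (two_cycle l) a b
             = cycle_adj (two_cycle l') (pi a) (pi b)) ->
  l = l'.
Proof.
move=> lm lm' m0 pi_inj iso.
have l1 : (l < m)%N by lia.
have l1' : (l' < m)%N by lia.
have := two_cycle_iso_lengths l1 l1' pi_inj iso.
have inv_inj : injective (invF pi_inj) by exact: can_inj (f_invF pi_inj).
have iso' a b : cycle_adj (two_cycle l') a b
    = cycle_adj (two_cycle l) (invF pi_inj a) (invF pi_inj b).
  by rewrite iso !f_invF.
have := two_cycle_iso_lengths l1' l1 inv_inj iso'.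
case=> [|->|]// h1; case=> [|->|]// h2; clear -lm lm' m0 h1 h2; lia.
Qed.

End TwoCycles.

(** At least 2 * (t + 1), which leaves room for t pairs of cycles with different
    lengths; divisible by 4, which makes the density irrational. *)
Definition core_size (t : nat) : nat := (4 * (t./2).+1)%N.

(** Length 0 stands for a single cycle; cycles of length 1 and 2 are excluded, as
    every vertex has to have two neighbours. *)
Definition cycle_length (i : nat) : nat := if i == 0%N then 0%N else i.+2.

Lemma core_size_bounds t : (0 < t)%N ->
  [/\ 4 <= core_size t, 2 * t.+1 <= core_size t
    & core_size t + 2 <= 3 * t + 5]%N.
Proof. by rewrite /core_size; move=> t0; split; lia. Qed.

Definition cycle_pattern (t : nat) (i : 'I_t) :=
  hub_pattern (@two_cycle (core_size t) (cycle_length i)).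

Theorem cycle_system (R : realType) (t : nat) : (0 < t)%N ->
  extremal_system (hub_Lam ((core_size t)%:R^-1 : R))
    (@hub_weight R 'I_(core_size t)) (@cycle_pattern t).
Proof.
move=> t0; have [m4 mt _] := core_size_bounds t0.
have lm (i : 'I_t) : (2 * cycle_length i <= core_size t)%N.
  by have := ltn_ord i; rewrite /cycle_length; case: eqP; lia.
have lm3 (i : 'I_t) : (cycle_length i + 3 <= core_size t)%N.
  by have := ltn_ord i; rewrite /cycle_length; case: eqP; lia.
have l03 (i : 'I_t) : (cycle_length i == 0%N) || (3 <= cycle_length i)%N.
  by rewrite /cycle_length; case: (nat_of_ord i).
have := @hub_system R 'I_(core_size t) t
  (fun i => @two_cycle (core_size t) (cycle_length i)).
rewrite card_ord; apply=> //.
- by move=> i; apply: two_cycle_inj; have := lm3 i; lia.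
- by move=> i a; apply: two_cycle_neq.
- by move=> i a; apply: two_cycle2_neq.
- move=> i j pi pi_inj iso; apply: val_inj.
  have : cycle_length i = cycle_length j.
    by apply: (two_cycle_iso (lm i) (lm j) _ pi_inj iso); lia.
  rewrite /cycle_length /=; case: (nat_of_ord i) (nat_of_ord j) => [|a] [|b] //=.
  by case=> ->.
Qed.

(** * Irrationality of the density *)

(** Squares are 0, 1 or 4 modulo 8. *)
Lemma not_rat_square (N : nat) (r : rat) : (N %% 8)%N = 5%N -> r ^+ 2 != N%:R.
Proof.
move=> N5; apply/eqP; case: (ratP r) => n d nd E.
have {}E : n ^+ 2 = Posz (N * d.+1 ^ 2).
  move: E; rewrite expr_div_n => /(canRL (divfK _)) E.
  have dn0 : (d.+1%:Q ^+ 2 != 0)%R by rewrite expf_neq0// intr_eq0.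
  have := E dn0; rewrite -!rmorphXn /= -[N%:R]/(N%:Z%:~R) -rmorphM /= => /intr_inj ->.
  by rewrite PoszM expnS expn1 PoszM -expr2.
have {}E : (`|n| ^ 2 = N * d.+1 ^ 2)%N.
  by move/(congr1 absz): E; rewrite abszX.
have d1 : d.+1 = 1%N.
  apply/eqP; rewrite -dvdn1 -(eqP nd) dvdn_gcd dvdnn andbT.
  rewrite -(@Gauss_dvdr _ `|n|); last by rewrite coprime_sym.
  by rewrite -[(_ * _)%N]/(`|n| ^ 2)%N E expnS mulnA mulnAC dvdn_mull.
move: E; rewrite d1 exp1n muln1 => E.
have : (`|n| ^ 2 %% 8 = 5)%N by rewrite E.
rewrite -modnXm; have := ltn_pmod `|n| (isT : (0 < 8)%N).
by move: (_ %% 8)%N => k; do 8 (case: k => [|k]//).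
Qed.

Section Irrational.
Variable R : realType.

(** If hub_Lam is rational, so is the square root q in the definition of hub_sum.
    With m = 4 j, the square of m q is 3 m^2 - 12 m + 13, which is 5 modulo 8. *)
Theorem hub_Lam_irrational (j : nat) : (0 < j)%N ->
  irrational (hub_Lam ((4 * j)%:R^-1 : R) / 6).
Proof.
move=> j0 [r _ rE]; pose m := (4 * j)%N; pose mu : R := m%:R^-1.
have m0 : (0 : R) < m%:R by rewrite ltr0n muln_gt0.
have mu0 : 0 < mu by rewrite invr_gt0.
have mu4 : mu <= 1 / 4.
  by rewrite mul1r lef_pV2 ?posrE// ler_nat leq_pmulr.
have [N N5 NE] : exists2 N, (N %% 8)%N = 5%N &
    N%:R = 3 * m%:R ^+ 2 - 12 * m%:R + 13 :> R.
  exists (48 * (j * j.-1) + 13)%N.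
    rewrite (_ : _ + _ = (6 * (j * j.-1) + 1) * 8 + 5)%N; last by lia.
    by rewrite modnMDl.
  by rewrite /m !natrD !natrM -[in LHS](prednK j0) -[in RHS](prednK j0) -!natr1 /=; ring.
pose D := 3 - 12 * mu + 13 * mu ^+ 2; pose q := Num.sqrt D.
have DN : D = N%:R * mu ^+ 2.
  rewrite NE.
  by rewrite /D /mu; field; rewrite gt_eqF.
have D0 : 0 < D by rewrite DN mulr_gt0 ?exprn_gt0// ltr0n; case: (N) N5.
have q2 : q ^+ 2 = D by rewrite sqr_sqrtr// ltW.
have q0 : 0 < q by rewrite sqrtr_gt0.
set L := hub_Lam mu in rE.
have LE : L * (16 * mu ^+ 2 + D + 8 * mu * q) = 2 * mu + q.
  rewrite -q2 /L /hub_Lam /hub_sum -/D -/q; field.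
  by rewrite gt_eqF// addr_gt0// mulr_gt0.
have key : q * (8 * mu * L - 1) = 2 * mu - L * (16 * mu ^+ 2 + D).
  by move: LE; lra.
have L1 : 8 * mu * L - 1 != 0.
  apply/eqP => L1; move: key; rewrite L1 mulr0 => key.
  have E0 : L * (16 * mu ^+ 2 + D) = 2 * mu by move: key; lra.
  have : 8 * mu * L * (16 * mu ^+ 2 + D) = 16 * mu ^+ 2.
    by rewrite -[LHS]mulrA E0; ring.
  have -> : 8 * mu * L = 1 by move: L1; lra.
  by rewrite mul1r; move: D0; lra.
have [mur muE] : exists mur : rat, ratr mur = mu.
  by exists (m%:R^-1); rewrite fmorphV rmorph_nat.
have [Lr LrE] : exists Lr : rat, ratr Lr = L.
  by exists (r * 6); rewrite rmorphM rmorph_nat /= rE divfK ?pnatr_eq0.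
pose qr := (2 * mur - Lr * (16 * mur ^+ 2 + N%:R * mur ^+ 2)) / (8 * mur * Lr - 1).
have qE : ratr qr = q.
  rewrite /qr fmorph_div !(rmorph_nat, rmorph1, rmorphXn, rmorphB, rmorphM, rmorphD) /=.
  by rewrite LrE muE -DN -key mulfK.
have : (m%:R * qr) ^+ 2 = N%:R.
  apply: (fmorph_inj (@ratr R)).
  rewrite rmorphXn rmorphM /= qE !rmorph_nat exprMn q2 DN mulrCA -exprMn.
  by rewrite divff ?expr1n ?mulr1// gt_eqF.
apply/eqP; exact: not_rat_square.
Qed.

End Irrational.

(** * Edges as ordered triples *)

Definition edge_rel (V : finType) (A : {set {set V}}) (a b c : V) : bool :=
  [set a; b; c] \in A.

Definition rel_edges (V : finType) (h : V -> V -> V -> bool) : {set {set V}} :=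
  [set E : {set V} | (#|E| == 3%N) &&
    [exists a, exists b, exists c, (E == [set a; b; c]) && h a b c]].

Lemma rel_edges_uniform (V : finType) (h : V -> V -> V -> bool) :
  is_uniform 3 (rel_edges h).
Proof. by apply/forall_inP => E; rewrite inE => /andP[]. Qed.

Definition rel_hypergraph (V : finType) (h : V -> V -> V -> bool) :
  hypergraph 3 V := Hypergraph (rel_edges_uniform h).

Section SetTriples.
Variable V : finType.
Implicit Types (E : {set V}) (A : {set {set V}}).

Lemma card_set3 (a b c : V) :
  (#|[set a; b; c]| == 3%N) = [&& a != b, a != c & b != c].
Proof.
rewrite finset.setUC cardsU1 cards2 !inE negb_or !(eq_sym c).
by case: (a == b); case: (a == c); case: (b == c).
Qed.

Lemma set3C12 (a b c : V) : [set a; b; c] = [set b; a; c].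
Proof. by congr (_ :|: _); rewrite finset.setUC. Qed.

Lemma set3C23 (a b c : V) : [set a; b; c] = [set a; c; b].
Proof. by rewrite -!finset.setUA; congr (_ :|: _); rewrite finset.setUC. Qed.

Lemma set3E E a b c : #|E| = 3%N ->
  ([set a; b; c] == E) = [&& a \in E, b \in E :\ a & c \in E :\ a :\ b].
Proof.
move=> E3; apply/eqP/and3P => [abcE|[aE]].
  move: E3; rewrite -abcE => /eqP; rewrite card_set3 => /and3P[ab ac bc].
  by rewrite !inE !eqxx ?orbT /= !(eq_sym _ a) (eq_sym c b) ab ac bc.
rewrite !inE => /andP[ba bE] /and3P[cb ca cE].
apply/eqP; rewrite eqEcard E3; apply/andP; split.
  by apply/fintype.subsetP => x; rewrite !inE => /orP[/orP[]|] /eqP ->.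
by apply: eq_leq; apply/esym/eqP; rewrite card_set3 eq_sym ba eq_sym ca eq_sym cb.
Qed.

Lemma set3P E : #|E| = 3%N -> exists a b c, E = [set a; b; c].
Proof.
move=> E3; have [a aE] : exists a, a \in E by apply/card_gt0P; rewrite E3.
have /cards2P[b [c [_ bc]]] : #|E :\ a| == 2%N.
  by move: E3; rewrite (cardsD1 a) aE add1n => -[->].
by exists a, b, c; rewrite -(finset.setD1K aE) bc finset.setUA.
Qed.

Lemma imset_set3 (W : finType) (f : V -> W) a b c :
  f @: [set a; b; c] = [set f a; f b; f c].
Proof. by rewrite !imsetU !imset_set1. Qed.

Lemma edge_rel_triple_system A : is_uniform 3 A -> is_triple_system (edge_rel A).
Proof.
move=> /forall_inP A3; split=> [a b c|a b c|a b]; rewrite /edge_rel.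
- by rewrite set3C12.
- by rewrite set3C23.
- by apply/negbTE/negP => /A3; rewrite card_set3 eqxx.
Qed.

Lemma rel_edgesE (h : V -> V -> V -> bool) a b c : is_triple_system h ->
  edge_rel (rel_edges h) a b c = h a b c.
Proof.
move=> hsys; apply/idP/idP; last first.
  move=> habc; have [ab ac bc] := triple_system_neq hsys habc.
  rewrite /edge_rel inE card_set3 ab ac bc /=.
  apply/existsP; exists a; apply/existsP; exists b; apply/existsP; exists c.
  by rewrite eqxx.
have [s12 s23 _] := hsys.
rewrite /edge_rel inE => /andP[abc3] /existsP[x /existsP[y /existsP[z /andP[/eqP E hxyz]]]].
have : a \in [set x; y; z] by rewrite -E !inE eqxx.
have : b \in [set x; y; z] by rewrite -E !inE eqxx orbT.
have : c \in [set x; y; z] by rewrite -E !inE eqxx orbT.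
move: abc3; rewrite card_set3 !inE => /and3P[ab ac bc].
move=> /orP[/orP[]|] /eqP ec /orP[/orP[]|] /eqP eb /orP[/orP[]|] /eqP ea;
  move: ab ac bc; rewrite ?ea ?eb ?ec ?eqxx // => _ _ _; subst;
  by [|rewrite s12|rewrite s23|rewrite s12 s23|rewrite s23 s12
      |rewrite s12 s23 s12].
Qed.

Section Counts.
Variable R : realFieldType.

Lemma sum_in_set (T : finType) (E : {set T}) :
  \sum_x (x \in E)%:R = #|E|%:R :> R.
Proof.
rewrite -sum1_card natr_sum [RHS]big_mkcond; apply: eq_bigr => x _.
by case: (x \in E).
Qed.

Lemma sum_pairs_completing E v : #|E| = 3%N ->
  \sum_b \sum_c ([set v; b; c] == E)%:R = 2 * (v \in E)%:R :> R.
Proof.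
move=> E3.
under eq_bigr do under eq_bigr do rewrite set3E//.
have [vE|vE] := boolP (v \in E); last first.
  by rewrite big1 ?mulr0// => b _; rewrite big1.
have E2 : #|E :\ v| = 2%N by move: E3; rewrite (cardsD1 v) vE add1n => -[].
transitivity (\sum_b (b \in E :\ v)%:R : R); last by rewrite sum_in_set E2 mulr1.
apply: eq_bigr => b _; have [bE|bE] := boolP (b \in E :\ v); last by rewrite big1.
rewrite sum_in_set; congr (_%:R).
by move: E2; rewrite (cardsD1 b) bE add1n => -[].
Qed.

Lemma pair_count_edges A v : is_uniform 3 A ->
  pair_count (edge_rel A v) = 2 * #|[set E in A | v \in E]|%:R :> R.
Proof.
move=> /forall_inP A3.
have memE E : (E \in A)%:R = \sum_(F in A) (E == F)%:R :> R.
  have [EA|EA] := boolP (E \in A).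
    by rewrite (bigD1 E)//= eqxx big1 ?addr0// => F /andP[_]; rewrite eq_sym => /negPf ->.
  by rewrite big1// => F FA; case: eqP => // EF; rewrite EF FA in EA.
transitivity (\sum_(F in A) \sum_b \sum_c ([set v; b; c] == F)%:R : R).
  rewrite exchange_big; apply: eq_bigr => b _.
  by rewrite exchange_big; apply: eq_bigr => c _; rewrite -memE.
rewrite -(sum_in_set [set E in A | v \in E]) mulr_sumr [LHS]big_mkcond; apply: eq_bigr => F _.
rewrite inE; case: ifP => FA; last by rewrite mulr0.
by rewrite sum_pairs_completing//; apply/eqP; exact: A3.
Qed.

Lemma triple_count_edges A : is_uniform 3 A ->
  triple_count (edge_rel A) = 6 * #|A|%:R :> R.
Proof.
move=> A3; rewrite triple_count_link.
under eq_bigr do rewrite pair_count_edges//.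
rewrite -mulr_sumr.
have -> : \sum_v #|[set E in A | v \in E]|%:R = \sum_(E in A) 3 :> R.
  transitivity (\sum_v \sum_(E in A) (v \in E)%:R : R).
    apply: eq_bigr => v _; rewrite -sum1_card natr_sum big_mkcond [RHS]big_mkcond.
    by apply: eq_bigr => E _; rewrite inE; case: (E \in A); case: (v \in E).
  rewrite exchange_big; apply: eq_bigr => E EA.
  have /forall_inP/(_ E EA)/eqP E3 := A3.
  have := sum_in_set E; rewrite E3 => <-.
  by [].
by rewrite sumr_const -mulr_natr; ring.
Qed.

End Counts.
End SetTriples.

(** * The forbidden family and its density *)

Section Obstructions.
Variables (R : realType) (t : nat) (W : finType) (w0 : W) (Lam : R) (xs : W -> R).
Variable g : 'I_t -> W -> W -> W -> bool.
Hypothesis sys : extremal_system Lam xs g.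

Definition colored_by (i : 'I_t) (V : finType) (H : hypergraph 3 V)
    (psi : V -> W) : Prop :=
  forall a b c, edge_rel (edges H) a b c -> g i (psi a) (psi b) (psi c).

(** All small 3-graphs that no pattern colors.  Avoiding them means that all small
    subsets of vertices are colorable. *)
Definition obstructions (L : nat) : hfamily 3 :=
  (fun F => (tag F <= L)%N /\ forall i psi, ~ colored_by i (tagged F) psi).

Lemma obstructions_finite L : finite_set (obstructions L).
Proof.
apply: (@sub_finite_set _ _ (\bigcup_(k in `I_L.+1)
    [set existT (fun k => hypergraph 3 'I_k) k F | F in setT])%classic).
  by move=> [k F] [/= kL _]; exists k => //; exists F.
by apply: bigcup_finite => [|k _]; [exact: finite_II|exact: finite_image].
Qed.

Lemma colored_family_free L i (V : finType) (H : hypergraph 3 V) psi :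
  colored_by i H psi -> family_free (obstructions L) H.
Proof.
move=> col F [_ nocol] [phi [phi_inj copy]]; apply: (nocol i (psi \o phi)).
move=> a b c /copy; rewrite imset_set3; exact: col.
Qed.

Lemma family_free_colorable L (V : finType) (H : hypergraph 3 V) :
  family_free (obstructions L) H -> locally_colorable g L (edge_rel (edges H)).
Proof.
move=> free S SL; apply: contrapT => nocol.
pose e (x : 'I_#|S|) : V := enum_val x.
have e_inj : injective e by exact: enum_val_inj.
pose h x y z := edge_rel (edges H) (e x) (e y) (e z).
have [s12 s23 irr] := edge_rel_triple_system (edges_uniform H).
have hsys : is_triple_system h by split=> *; [exact: s12|exact: s23|exact: irr].
apply: (free (existT (fun k => hypergraph 3 'I_k) #|S| (rel_hypergraph h))).
  split=> //= i psi col; apply: nocol.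
  have [S0|[s0 s0S]] := set_0Vmem S.
    by exists i, (fun=> w0) => a b c; rewrite S0 inE.
  exists i, (fun v => psi (enum_rank_in s0S v)) => a b c aS bS cS habc.
  apply: col; rewrite rel_edgesE// /h /e !enum_rankK_in//.
exists e; split=> // E /=; rewrite inE => /andP[_ /existsP[x /existsP[y /existsP[z]]]].
by move=> /andP[/eqP ->]; rewrite imset_set3.
Qed.

Definition blowup (n : nat) (chi : 'I_n -> W) (i : 'I_t) : hypergraph 3 'I_n :=
  rel_hypergraph (fun a b c => g i (chi a) (chi b) (chi c)).

Lemma pullback_triple_system (V : Type) i (psi : V -> W) :
  is_triple_system (fun a b c => g i (psi a) (psi b) (psi c)).
Proof.
by have [s12 s23 irr] := sys_triple sys i; split=> *; [exact: s12|exact: s23|exact: irr].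
Qed.

Lemma blowup_rel n (chi : 'I_n -> W) i a b c :
  edge_rel (edges (blowup chi i)) a b c = g i (chi a) (chi b) (chi c).
Proof. by rewrite rel_edgesE//; exact: pullback_triple_system. Qed.

Lemma blowup_free L n (chi : 'I_n -> W) i :
  family_free (obstructions L) (blowup chi i).
Proof.
by apply: (@colored_family_free L i _ _ chi) => a b c; rewrite blowup_rel.
Qed.

Lemma edges_count (V : finType) (H : hypergraph 3 V) :
  6 * #|edges H|%:R = triple_count (edge_rel (edges H)) :> R.
Proof. by rewrite triple_count_edges//; exact: edges_uniform. Qed.

Lemma optimal_colorings : exists chi : 'I_t -> forall n, 'I_n -> W, forall i n,
  Lam * n%:R ^+ 3 - 3 * n%:R ^+ 2 <= 6 * #|edges (blowup (chi i n) i)|%:R.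
Proof.
have P (i : 'I_t) (n : nat) : exists chi : 'I_n -> W,
    Lam * n%:R ^+ 3 - 3 * n%:R ^+ 2 <= 6 * #|edges (blowup chi i)|%:R.
  have [chi] := optimal_coloring_exists sys i 'I_n.
  rewrite card_ord => chiP; exists chi; rewrite edges_count.
  apply: (le_trans chiP); apply: triple_count_le => a b c.
  by rewrite blowup_rel.
by exists (fun i n => projT1 (cid (P i n))) => i n; case: cid.
Qed.

Section Extremal.
Variables (L : nat) (N0 : nat).
Hypothesis upper : forall (V : finType) (h : V -> V -> V -> bool),
  is_triple_system h -> locally_colorable g L h -> (N0 <= #|V|)%N ->
  triple_count h <= Lam * #|V|%:R ^+ 3.

Local Notation M := (obstructions L).

Lemma turan_number_le n : (N0 <= n)%N ->
  6 * (turan_number M n)%:R <= Lam * n%:R ^+ 3.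
Proof.
move=> nN; rewrite /turan_number.
elim/big_ind: _ => [|x y xP yP|H /asboolP free].
- by rewrite mulr0 mulr_ge0 ?exprn_ge0//; case/andP: (sys_Lam sys) => /ltW.
- by rewrite /maxn; case: ifP.
- rewrite edges_count; have := upper (V := 'I_n) (h := edge_rel (edges H)).
  rewrite card_ord; apply=> //; first exact: edge_rel_triple_system (edges_uniform H).
  exact: family_free_colorable.
Qed.

Lemma turan_number_ge n (H : hypergraph 3 'I_n) :
  family_free M H -> (#|edges H| <= turan_number M n)%N.
Proof. by move=> free; apply: leq_bigmax_cond; apply/asboolP. Qed.

Lemma turan_number_lower n : (0 < t)%N ->
  Lam * n%:R ^+ 3 - 3 * n%:R ^+ 2 <= 6 * (turan_number M n)%:R.
Proof.
move=> t0; have [chi chiP] := optimal_colorings.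
apply: (le_trans (chiP (Ordinal t0) n)).
by rewrite ler_pM2l// ler_nat turan_number_ge//; exact: blowup_free.
Qed.

Lemma binomial3 n : (3 <= n)%N ->
  6 * ('C(n, 3))%:R = n%:R ^+ 3 - 3 * n%:R ^+ 2 + 2 * n%:R :> R.
Proof.
move=> n3; have -> : 6 = (3`!)%:R :> R by [].
rewrite -natrM mulnC bin_ffact ffactnS ffactnS ffactn1 !natrM.
case: n n3 => [|[|n]]// _; rewrite /= -!natr1; ring.
Qed.

Lemma nat_large (x : R) : exists n0 : nat, forall n : nat, (n0 <= n)%N -> x <= n%:R.
Proof.
have [n0 xn] := nat_above x; exists n0 => n n0n.
by apply: (le_trans xn); rewrite ler_nat.
Qed.

(** For large n the number of triples lies between Lam n^3 - 3 n^2 and Lam n^3. *)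
Lemma turan_density : (0 < t)%N -> has_turan_density M Lam.
Proof.
move=> t0; rewrite /has_turan_density.
apply/cvgrPdist_le => e e0.
have [n1 n1P] := nat_large (3 + 3 / e).
exists (maxn 4 (maxn N0 n1)) => // n /=.
rewrite !geq_max => /andP[n4 /andP[nN nn1]].
have n0 : (0 : R) < n%:R by rewrite ltr0n; apply: leq_trans n4.
have C0 : (0 : R) < 'C(n, 3)%:R by rewrite ltr0n bin_gt0; apply: leq_trans n4.
have bin := binomial3 (ltnW n4).
have up := turan_number_le nN.
have low := turan_number_lower n t0.
have en : 3 * n%:R ^+ 2 <= e * (n%:R ^+ 3 - 3 * n%:R ^+ 2).
  rewrite (_ : n%:R ^+ 3 - _ = (n%:R - 3) * n%:R ^+ 2); last by ring.
  rewrite [leRHS]mulrA ler_wpM2r ?exprn_ge0 ?(ltW n0)// mulrC -ler_pdivrMr//.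
  by have := n1P _ nn1; lra.
have e2n : 0 <= e * n%:R by rewrite mulr_ge0// ltW.
have /andP[L0 L1] := sys_Lam sys.
have Ln : 0 <= Lam * n%:R ^+ 2 <= n%:R ^+ 2.
  by rewrite mulr_ge0 ?exprn_ge0 ?(ltW L0) ?(ltW n0)//= ler_piMl ?exprn_ge0 ?(ltW n0).
have Ln1 : 0 <= Lam * n%:R <= n%:R.
  by rewrite mulr_ge0 ?(ltW L0) ?(ltW n0)//= ler_piMl ?(ltW n0).
have Lnn : Lam * n%:R <= Lam * n%:R ^+ 2.
  by rewrite ler_pM2l// ler_eXnr// ler1n; apply: leq_trans n4.
set T : R := (turan_number M n)%:R in up low *.
set C : R := 'C(n, 3)%:R in bin C0 *.
case/andP: Ln => Ln Ln'; case/andP: Ln1 => Ln1 Ln1'.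
have h1 : T / C <= Lam + e.
  rewrite ler_pdivrMr// -(@ler_pM2l _ 6)//.
  have -> : 6 * ((Lam + e) * C) = (Lam + e) * (6 * C) by ring.
  by rewrite bin; move: up en e2n Ln' Ln1; lra.
have h2 : Lam - e <= T / C.
  rewrite ler_pdivlMr// -(@ler_pM2l _ 6)//.
  have -> : 6 * ((Lam - e) * C) = (Lam - e) * (6 * C) by ring.
  by rewrite bin; move: low en e2n Ln Lnn; lra.
by rewrite ler_norml; apply/andP; split; move: h1 h2; lra.
Qed.

End Extremal.
End Obstructions.

(** * The stability number *)

Section Stability.
Variables (R : realType) (t : nat) (W : finType) (w0 : W) (Lam : R) (xs : W -> R).
Variable g : 'I_t -> W -> W -> W -> bool.
Hypothesis sys : extremal_system Lam xs g.
Hypothesis t_gt0 : (0 < t)%N.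

Variables (L L0 : nat) (e0 : R) (u0 : nat) (N0 : nat).
Hypothesis dense : has_dense_parts Lam g L0 e0 u0.
Hypothesis L0L : (L0 <= L)%N.
Hypothesis upper : forall (V : finType) (h : V -> V -> V -> bool),
  is_triple_system h -> locally_colorable g L h -> (N0 <= #|V|)%N ->
  triple_count h <= Lam * #|V|%:R ^+ 3.

Local Notation M := (obstructions g L).
Local Notation k := (#|W|%:R : R).

Lemma triple_count_or (V : finType) (h h1 h2 : V -> V -> V -> bool) :
  (forall a b c, h a b c -> h1 a b c || h2 a b c) ->
  triple_count h <= triple_count h1 + triple_count h2 :> R.
Proof.
move=> H; rewrite -big_split; apply: ler_sum => a _.
rewrite -big_split; apply: ler_sum => b _.
rewrite -big_split; apply: ler_sum => c _ /=.
case: (h a b c) (H a b c) => [/(_ isT)/orP[|] ->|_]; last exact: addr_ge0.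
  by rewrite lerDl.
by rewrite lerDr.
Qed.

Lemma triple_count_bij (U V : finType) (pi : U -> V) (h : V -> V -> V -> bool) :
  bijective pi ->
  triple_count (fun a b c => h (pi a) (pi b) (pi c)) = triple_count h :> R.
Proof.
move=> pi_bij; have on : {on [pred _ : V | true], bijective pi} by exact: onW_bij.
rewrite /triple_count [RHS](reindex pi)//; apply: eq_bigr => a _.
rewrite [RHS](reindex pi)//; apply: eq_bigr => b _.
by rewrite [RHS](reindex pi).
Qed.

(** The set whose size is bounded in edit_close. *)
Definition edit_set (V X : finType) (H : hypergraph 3 V) (G : hypergraph 3 X)
    (pi : V -> X) : {set {set V}} :=
  let G' := [set E : {set V} | pi @: E \in edges G] in
  (edges H :\: G') :|: (G' :\: edges H).

Lemma edit_set_uniform (V X : finType) (H : hypergraph 3 V)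
    (G : hypergraph 3 X) (pi : V -> X) : injective pi ->
  is_uniform 3 (edit_set H G pi).
Proof.
move=> pi_inj; apply/forall_inP => E; rewrite !inE => /orP[/andP[_]|/andP[_]].
  by move: E; apply/forall_inP; exact: edges_uniform.
by have /forall_inP G3 := edges_uniform G; move=> /G3; rewrite card_imset.
Qed.

Lemma edge_rel_edit_set (V X : finType) (H : hypergraph 3 V)
    (G : hypergraph 3 X) (pi : V -> X) a b c :
  edge_rel (edit_set H G pi) a b c
  = (edge_rel (edges H) a b c != edge_rel (edges G) (pi a) (pi b) (pi c)).
Proof.
rewrite /edge_rel !inE imset_set3.
by case: (_ \in edges H); case: (_ \in edges G).
Qed.

(** An almost extremal H nearly coincides with a blowup of a pattern, whose class
    sizes are nearly those of the fixed optimal blowup; so some bijection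
    matches the color of all but few vertices. *)
Lemma blowups_s_stable : s_stable R M t.
Proof.
have [chi chiP] := optimal_colorings sys.
exists (fun i n => blowup g (chi i n) i) => delta delta0.
(* H and the blowup given by its coloring psi differ in at most 2 d n^3 ordered
   triples.  Both blowups have class sizes within d n of the optimum, so that at
   most 2 d k n vertices change their color, and each of them affects at most
   3 n^2 triples in either direction: this adds 12 d k n^3. *)
pose d := delta / (2 + 12 * k).
have k0 : 0 <= k by [].
have k12 : 0 < 2 + 12 * k by rewrite ltr_wpDr// mulr_ge0.
have d0 : 0 < d by rewrite divr_gt0.
have dE : (2 + 12 * k) * d = delta by rewrite /d mulrC divfK// gt_eqF.
have [e [N1 [e_gt0 near]]] := near_extremal_coloring sys dense d0.
have [e' e'_gt0 near'] := near_optimal_classes sys d0.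
pose eps := Num.min (e / 2) (1 / 2).
have eps_e : eps <= e / 2 by rewrite ge_min lexx.
have eps_1 : eps <= 1 / 2 by rewrite ge_min lexx orbT.
have eps_gt0 : 0 < eps by rewrite lt_min !divr_gt0.
have [n1 n1P] := nat_large (6 / e + 3 / e').
exists eps, (maxn N1 (maxn n1 1)); split=> // n.
rewrite !geq_max => /andP[nN1 /andP[nn1 n_gt0]] V H Vn free dense_H.
have n0 : (0 : R) < n%:R by rewrite ltr0n.
have n2 : (0 : R) <= n%:R ^+ 2 by rewrite exprn_ge0// ltW.
have n3 : (0 : R) <= n%:R ^+ 3 by rewrite exprn_ge0// ltW.
have large := n1P n nn1.
have e'6 : 0 <= 3 / e' by rewrite divr_ge0// ltW.
have e6 : 0 <= 6 / e by rewrite divr_ge0// ltW.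
have ne : 6 * n%:R ^+ 2 <= e * n%:R ^+ 3.
  rewrite (exprS _ 2) [leRHS]mulrA ler_wpM2r// mulrC -ler_pdivrMr//; move: large; lra.
have ne' : 3 * n%:R ^+ 2 <= e' * n%:R ^+ 3.
  rewrite (exprS _ 2) [leRHS]mulrA ler_wpM2r// mulrC -ler_pdivrMr//; move: large; lra.
have /andP[Lam0 Lam1] := sys_Lam sys.
have low := turan_number_lower sys L n t_gt0.
pose h := edge_rel (edges H).
have hsys : is_triple_system h := edge_rel_triple_system (edges_uniform H).
have hdens : (Lam - e) * #|V|%:R ^+ 3 <= triple_count h.
  rewrite -edges_count Vn.
  have h1 : 6 * ((1 - eps) * (turan_number M n)%:R) <= 6 * #|edges H|%:R.
    by rewrite ler_pM2l// ltW.
  apply: le_trans h1.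
  have -> : 6 * ((1 - eps) * (turan_number M n)%:R)
    = (1 - eps) * (6 * (turan_number M n)%:R) by ring.
  have eps1 : 0 <= 1 - eps by move: eps_1; lra.
  apply: le_trans (ler_wpM2l eps1 low).
  have h2 : eps * (Lam * n%:R ^+ 3) <= e / 2 * n%:R ^+ 3.
    rewrite mulrA ler_wpM2r//; apply: le_trans eps_e.
    by rewrite ler_piMr// ltW.
  have h3 : 0 <= eps * n%:R ^+ 2 by rewrite mulr_ge0// ltW.
  by move: ne h2 h3; lra.
have loc : locally_colorable g L0 h.
  exact: locally_colorableW L0L (family_free_colorable w0 free).
have [|i [psi [hg gh cl]]] := near V h hsys loc _ hdens; first by rewrite Vn.
have cl' : forall c, `|class_size (chi i n) c - xs c * n%:R| <= d * n%:R.
  have := near' i 'I_n (chi i n); rewrite card_ord; apply.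
  have := chiP i n; rewrite edges_count.
  rewrite (_ : triple_count _ = triple_count (fun a b c =>
     g i (chi i n a) (chi i n b) (chi i n c))) => [|]; last first.
    apply: eq_bigr => a _; apply: eq_bigr => b _; apply: eq_bigr => c _.
    by rewrite (blowup_rel sys).
  by move: ne'; lra.
have [|||pi [pi_bij mism]] := @color_matching R V 'I_n W psi (chi i n) (2 * d * n%:R).
- by rewrite card_ord.
- by rewrite !mulr_ge0// ltW.
- move=> c; rewrite (_ : _ - _ = (class_size psi c - xs c * n%:R)
     - (class_size (chi i n) c - xs c * n%:R)); last by ring.
  apply: (le_trans (ler_normB _ _)).
  by have := cl c; have := cl' c; rewrite Vn; lra.
exists i, pi; split=> //.
change (#|edit_set H (blowup g (chi i n) i) pi|%:R <= delta * n%:R ^+ 3).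
pose phi v := chi i n (pi v).
pose A1 a b c := h a b c && ~~ g i (psi a) (psi b) (psi c).
pose A2 a b c := g i (psi a) (psi b) (psi c) && ~~ h a b c.
pose B1 a b c := g i (psi a) (psi b) (psi c) && ~~ g i (phi a) (phi b) (phi c).
pose B2 a b c := g i (phi a) (phi b) (phi c) && ~~ g i (psi a) (psi b) (psi c).
have b1 : triple_count B1 <= 3 * n%:R ^+ 2 * (k * (2 * d * n%:R)).
  have := recoloring_count R (g i) psi phi; rewrite Vn => /le_trans; apply.
  by rewrite ler_wpM2l// mulr_ge0.
have b2 : triple_count B2 <= 3 * n%:R ^+ 2 * (k * (2 * d * n%:R)).
  have := recoloring_count R (g i) phi psi; rewrite Vn => /le_trans; apply.
  rewrite ler_wpM2l ?mulr_ge0//; apply: le_trans mism.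
  by apply: ler_sum => v _; rewrite eq_sym.
have cnt : triple_count (edge_rel (edit_set H (blowup g (chi i n) i) pi))
    <= (triple_count A1 + triple_count B1) + (triple_count A2 + triple_count B2) :> R.
  pose C1 a b c := h a b c && ~~ g i (phi a) (phi b) (phi c).
  pose C2 a b c := g i (phi a) (phi b) (phi c) && ~~ h a b c.
  apply: (le_trans (@triple_count_or _ _ C1 C2 _)).
    move=> a b c; rewrite edge_rel_edit_set (blowup_rel sys) -/(h a b c) /C1 /C2 /phi.
    by case: (h a b c); case: (g i _ _ _).
  apply: lerD; apply: triple_count_or => a b c.
    rewrite /C1 /A1 /B1; case: (h a b c) => //=.
    by case: (g i (phi a) _ _) => //; case: (g i (psi a) _ _).
  rewrite /C2 /A2 /B2; case: (h a b c); rewrite ?andbF//=.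
  by case: (g i (phi a) _ _) => //; case: (g i (psi a) _ _).
have pi_inj : injective pi by exact: bij_inj.
rewrite -(@ler_pM2l R 6)// -triple_count_edges; last exact: edit_set_uniform.
rewrite Vn in hg gh.
have knd : 0 <= delta * n%:R ^+ 3 by rewrite mulr_ge0// ltW.
apply: (@le_trans _ _ ((2 + 12 * k) * d * n%:R ^+ 3)); last first.
  by rewrite dE; move: knd; lra.
apply: (le_trans cnt).
have -> : (2 + 12 * k) * d * n%:R ^+ 3 = (d * n%:R ^+ 3 + 3 * n%:R ^+ 2 * (k * (2 * d * n%:R)))
  + (d * n%:R ^+ 3 + 3 * n%:R ^+ 2 * (k * (2 * d * n%:R))) by ring.
by apply: lerD; apply: lerD.
Qed.

(** With fewer than t hypergraphs S_j, two of the t optimal blowups would be close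
    to the same S_j, and hence to each other. *)
Lemma s_stable_lower_bound s : (0 < s)%N -> s_stable R M s -> (t <= s)%N.
Proof.
move=> s_gt0 [S SP]; rewrite leqNgt; apply/negP => st.
have [chi chiP] := optimal_colorings sys.
have [e e_gt0 far] := blowups_far_apart sys.
have [eps [N1 [eps_gt0 stab]]] := SP (e / 12) (divr_gt0 e_gt0 (ltr0Sn _ 11)).
have /andP[Lam0 Lam1] := sys_Lam sys.
pose eps' := Num.min eps 1.
have eps'0 : 0 < eps' by rewrite lt_min eps_gt0 ltr01.
have eps'1 : eps' <= 1 by rewrite ge_min lexx orbT.
have eps'e : eps' <= eps by rewrite ge_min lexx.
have epsL : 0 < eps' * Lam by rewrite mulr_gt0.
have [n1 n1P] := nat_large (3 / (eps' * Lam) + 3 / e + 1).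
pose n := maxn N1 (maxn N0 (maxn n1 1)).
have [nN1 nN0 nn1 n_gt0] : [/\ N1 <= n, N0 <= n, n1 <= n & 0 < n]%N.
  by rewrite /n; split; rewrite !leq_max ?leqnn ?orbT.
have n0 : (0 : R) < n%:R by rewrite ltr0n.
have n2 : (0 : R) < n%:R ^+ 2 by rewrite exprn_gt0.
have n3 : (0 : R) <= n%:R ^+ 3 by rewrite exprn_ge0// ltW.
have large := n1P n nn1.
have e6 : 0 <= 3 / e by rewrite divr_ge0// ltW.
have e7 : 0 <= 3 / (eps' * Lam) by rewrite divr_ge0// ltW.
have ne : 3 * n%:R ^+ 2 <= e * n%:R ^+ 3.
  by rewrite (exprS _ 2) [leRHS]mulrA ler_wpM2r ?(ltW n2)// mulrC -ler_pdivrMr//; move: large; lra.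
have neps : 3 * n%:R ^+ 2 < eps' * Lam * n%:R ^+ 3.
  by rewrite (exprS _ 2) [ltRHS]mulrA ltr_pM2r// mulrC -ltr_pdivrMr//; move: large; lra.
have up := turan_number_le w0 sys upper nN0.
pose B i := blowup g (chi i n) i.
have close i : exists jp : 'I_s * {ffun 'I_n -> 'I_n},
    bijective jp.2 /\ #|edit_set (B i) (S jp.1 n) jp.2|%:R <= e / 12 * n%:R ^+ 3.
  have [||j [phi [phi_bij phiP]]] := stab n nN1 'I_n (B i) (card_ord n).
  - exact: blowup_free sys _ _ _ _.
  - rewrite -(@ltr_pM2l R 6)//; apply: lt_le_trans (chiP i n).
    have -> : 6 * ((1 - eps) * (turan_number M n)%:R)
      = (1 - eps) * (6 * (turan_number M n)%:R) by ring.
    have T0 : 0 <= 6 * (turan_number M n)%:R :> R by rewrite mulr_ge0.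
    have h1 : (1 - eps) * (6 * (turan_number M n)%:R)
        <= (1 - eps') * (6 * (turan_number M n)%:R).
      by rewrite ler_wpM2r//; move: eps'e; lra.
    apply: (le_lt_trans h1).
    have h2 : (1 - eps') * (6 * (turan_number M n)%:R)
        <= (1 - eps') * (Lam * n%:R ^+ 3).
      by rewrite ler_wpM2l//; move: eps'1; lra.
    apply: (le_lt_trans h2).
    by move: neps; lra.
  have phiE : [ffun x => phi x] =1 phi by move=> x; rewrite ffunE.
  exists (j, [ffun x => phi x]); split=> /=.
    by apply: (eq_bij phi_bij) => x; rewrite ffunE.
  rewrite (_ : edit_set _ _ _ = edit_set (B i) (S j n) phi)//.
  by rewrite /edit_set; under eq_finset do rewrite (eq_imset _ phiE).
have /choice[jp jpP] := close.
have /injectivePn[i [i' ii' jj]] : ~~ injectiveb (fun i => (jp i).1).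
  apply/negP => /injectiveP inj; move: st.
  by rewrite -(card_ord t) -(card_ord s) ltnNge (leq_card _ inj).
have [bi ci] := jpP i; have [bi' ci'] := jpP i'.
have [inv inv1 inv2] := bi'.
pose pi x := inv ((jp i).2 x).
have pi_bij : bijective pi.
  by apply: bij_comp => //; exists (jp i').2.
have jpi x : (jp i').2 (pi x) = (jp i).2 x by rewrite /pi inv2.
apply/negP: ii'; rewrite negbK; apply/eqP.
apply: (far i i' 'I_n (chi i n) (fun x => chi i' n (pi x))).
- by rewrite card_ord.
- have := chiP i n; rewrite edges_count card_ord.
  rewrite (_ : triple_count _ = triple_count (fun a b c =>
     g i (chi i n a) (chi i n b) (chi i n c))) => [|]; last first.
    apply: eq_bigr => a _; apply: eq_bigr => b _; apply: eq_bigr => c _.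
    by rewrite (blowup_rel sys).
  by move: ne; lra.
pose D := edit_set (B i) (S (jp i).1 n) (jp i).2.
pose D' := edit_set (B i') (S (jp i').1 n) (jp i').2.
have cD : triple_count (edge_rel D) <= 6 * (e / 12 * n%:R ^+ 3).
  rewrite triple_count_edges ?ler_pM2l//; apply: edit_set_uniform; exact: bij_inj.
have cD' : triple_count (edge_rel D') <= 6 * (e / 12 * n%:R ^+ 3).
  rewrite triple_count_edges ?ler_pM2l//; apply: edit_set_uniform; exact: bij_inj.
have := @triple_count_or _ (fun a b c => g i (chi i n a) (chi i n b) (chi i n c) &&
    ~~ g i' (chi i' n (pi a)) (chi i' n (pi b)) (chi i' n (pi c)))
  (edge_rel D) (fun a b c => edge_rel D' (pi a) (pi b) (pi c)).
rewrite triple_count_bij// card_ord => /(_ _)/le_trans; apply.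
  move=> a b c; rewrite /D /D' !edge_rel_edit_set !(blowup_rel sys) !jpi jj.
  by case: (g i _ _ _); case: (g i' _ _ _); case: (edge_rel _ _ _ _).
by move: cD cD'; lra.
Qed.

Theorem stability_number_eq : stability_number R M = Some t.
Proof.
rewrite /stability_number; case: pselect => [h|]; last first.
  by case; exists t; apply/asboolP; split=> //; exact: blowups_s_stable.
congr Some; case: ex_minnP => s /asboolP[s0 sst] smin.
apply/eqP; rewrite eqn_leq (s_stable_lower_bound s0 sst) andbT.
by apply: smin; apply/asboolP; split=> //; exact: blowups_s_stable.
Qed.

End Stability.

(** * The main theorem *)

Lemma embedded_pattern (W X : finType) (g : W -> W -> W -> bool) (f : W -> X) :
  is_triple_system g -> injective f ->
  exists G : hypergraph 3 X, forall (V : finType) (H : hypergraph 3 V) psi,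
    (forall a b c, edge_rel (edges H) a b c -> g (psi a) (psi b) (psi c)) ->
    hcolorable G H.
Proof.
move=> gsys f_inj; pose GE := [set f @: (E : {set W}) | E in rel_edges g].
have GU : is_uniform 3 GE.
  apply/forall_inP => _ /imsetP[E EG ->]; rewrite card_imset//.
  by move: E EG; apply/forall_inP; exact: rel_edges_uniform.
exists (Hypergraph GU) => V H psi col; exists (f \o psi) => E EH.
have /forall_inP/(_ E EH)/eqP E3 := edges_uniform H.
have [a [b [c Eabc]]] := set3P E3.
apply/imsetP; exists (psi @: E); last first.
  by apply/setP => x; rewrite -imset_comp.
rewrite Eabc imset_set3 -[_ \in _]/(edge_rel _ _ _ _) rel_edgesE//.
by apply: col; rewrite /edge_rel -Eabc.
Qed.

Lemma min_degree_le (V : finType) (H : hypergraph 3 V) v :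
  (min_degree H <= hdegree H v)%N.
Proof.
rewrite /min_degree; elim: (index_enum V) (mem_index_enum v) => // u r IH.
rewrite inE big_cons => /orP[/eqP ->|/IH vr]; first exact: geq_minl.
exact: leq_trans (geq_minr _ _) vr.
Qed.

Theorem theorem1p2 (R : realType) (t : nat) (t_gt0 : (0 < t)%N) :
  exists (lambda : R) (G : 'I_t -> hypergraph 3 'I_(3 * t + 5)%N) (M : hfamily 3),
    [/\ irrational lambda, 0 < lambda < 1 / 6 & finite_set M] /\
    [/\ has_turan_density M (6 * lambda),
        exists (eps : R) (N0 : nat), 0 < eps /\
          forall n : nat, (N0 <= n)%N ->
          forall (V : finType) (H : hypergraph 3 V), #|V| = n -> family_free M H ->
            (3 * lambda - eps) * n%:R ^+ 2 <= (min_degree H)%:R ->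
            exists i : 'I_t, hcolorable (G i) H
      & stability_number R M = Some t].
Proof.
pose W : finType := option (option 'I_(core_size t)).
pose Lam : R := hub_Lam ((core_size t)%:R^-1).
have sys : extremal_system Lam (@hub_weight R _) (@cycle_pattern t).
  exact: cycle_system.
have [m4 _ m3t] := core_size_bounds t_gt0.
have [L1 [eps1 [eps1_gt0 colB]]] := coloring_from_min_degree sys.
have [L2 [e0 [u0 dense]]] := dense_parts_exist sys.
pose L := maxn L1 L2.
have LL1 : (L1 <= L)%N by rewrite leq_maxl.
have LL2 : (L2 <= L)%N by rewrite leq_maxr.
have [N0 upper] := turan_upper_bound sys dense.
have upperL (V : finType) (h : V -> V -> V -> bool) : is_triple_system h ->
    locally_colorable (@cycle_pattern t) L h -> (N0 <= #|V|)%N ->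
    triple_count h <= Lam * #|V|%:R ^+ 3.
  by move=> hsys loc; apply: upper => //; exact: locally_colorableW loc.
have [f f_inj] : exists f : W -> 'I_(3 * t + 5), injective f.
  have cW : (#|W| <= 3 * t + 5)%N by rewrite !card_option card_ord; lia.
  exists (fun w => widen_ord cW (enum_rank w)) => a b /(congr1 val) /= ab.
  by apply: enum_rank_inj; exact: val_inj.
have [G GP] := choice (fun i => embedded_pattern (sys_triple sys i) f_inj).
exists (Lam / 6), G, (obstructions (@cycle_pattern t) L).
have Lam6 : 6 * (Lam / 6) = Lam by rewrite mulrC divfK// pnatr_eq0.
have mu_gt0 : 0 < ((core_size t)%:R^-1 : R).
  by rewrite invr_gt0 ltr0n; apply: leq_trans m4.
have mu_le : ((core_size t)%:R^-1 : R) <= 1 / 4.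
  by rewrite mul1r lef_pV2 ?posrE ?ltr0n ?ler_nat//; apply: leq_trans m4.
split; split.
- exact: hub_Lam_irrational.
- rewrite divr_gt0 ?hub_Lam_gt0//= ltr_pdivrMr// -[1 / 6 * 6]mulrA mulVf ?pnatr_eq0//.
  by rewrite mulr1 hub_Lam_lt1.
- exact: obstructions_finite.
- rewrite Lam6; exact: (turan_density None sys upperL).
- exists (eps1 / 2), 1%N; split; first by rewrite divr_gt0.
  move=> n n_gt0 V H Vn free deg.
  have hsys := edge_rel_triple_system (edges_uniform H).
  have [|v|i [psi col]] := colB V (edge_rel (edges H)) hsys _
      (locally_colorableW LL1 (family_free_colorable None free)).
  + by rewrite Vn.
  + rewrite pair_count_edges ?edges_uniform// -/(hdegree H v) Vn.
    have dv : (min_degree H)%:R <= (hdegree H v)%:R :> R by rewrite ler_nat min_degree_le.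
    apply: le_trans (ler_wpM2l (ler0n R 2) dv).
    apply: le_trans (ler_wpM2l (ler0n R 2) deg).
    by rewrite le_eqVlt; apply/orP; left; apply/eqP; field.
  by exists i; exact: GP col.
- exact: (stability_number_eq None sys t_gt0 dense LL2 upperL).
Qed.
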